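(* Let $\alpha,\gamma>0$. The standard LQR problem for the diffusion equation, $$\inf_u\int_0^\infty\langle\boldsymbol\psi(t),\gamma^2\boldsymbol\psi(t)\rangle_{L^2(\mathbb{T})}+\langle\boldsymbol u(t),\boldsymbol u(t)\rangle_{L^2(\mathbb{T})}\,dt\quad\text{s.t. }\ \partial_t\psi(t,\theta)=\alpha\partial_\theta^2\psi(t,\theta)+u(t,\theta),\ \boldsymbol\psi(0)=\psi_0\in L^2(\mathbb{T}),$$ and the $\mathcal{H}_2$ problem $$\arg\min_{\Phi^{\psi},\Phi^u\in\mathcal{H}_\infty}\ \|C\Phi^\psi+D\Phi^u\|_{\mathcal{H}_2}$$ subject to: $\Phi^\psi,\Phi^u$ spatially invariant, strictly proper, and for all $\eta,\vartheta\in L^2(\mathbb{T})$ and all $s\in\mathbb{C}$ with $\mathrm{Re}(s)\ge0$ $$\langle\eta,((s+1)I-(A+I))\Phi^\psi(s)\vartheta\rangle_{L^2(\mathbb{T})}-\langle\eta,\Phi^u(s)\vartheta\rangle_{L^2(\mathbb{T})}=\langle\eta,\vartheta\rangle_{L^2(\mathbb{T})},$$ have the same solution $K^{\rm opt}$. That is, the optimal state feedback gain $K^{\rm opt}$ for the LQR problem (so that $\boldsymbol u(t)=K^{\rm opt}\boldsymbol\psi(t)$ is optimal for every $\psi_0$) coincides with the controller whose symbol is $\hat K_\kappa(s)=\hat\Phi^u_\kappa(s)/\hat\Phi^\psi_\kappa(s)$, $\kappa\in\mathbb{Z}$, where $(\Phi^\psi,\Phi^u)$ is the solution of the $\mathcal{H}_2$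 problem.
   Context: $\mathbb{T}$ is the unit circle; $\langle f,g\rangle_{L^2(\mathbb{T})}=\int_{\mathbb{T}}f^*(\theta)g(\theta)\,d\theta$; $\boldsymbol\psi(t)=\psi(t,\cdot)$, $\boldsymbol u(t)=u(t,\cdot)\in L^2(\mathbb{T})$. $A=\alpha\partial_\theta^2$ on $\mathcal{D}(A)=\{f\in L^2(\mathbb{T}):f',f''\in L^2(\mathbb{T})\}$ (weak derivatives); $C\psi=\begin{bmatrix}\gamma\psi\\ 0\end{bmatrix}$, $Du=\begin{bmatrix}0\\ u\end{bmatrix}$, mapping $L^2(\mathbb{T})\to L^2(\mathbb{T})\oplus L^2(\mathbb{T})$. Fourier transform: $(\mathcal{F}f)(\kappa)=\frac1{2\pi}\int_{\mathbb{T}}f(\theta)e^{-j\kappa\theta}d\theta$, $\kappa\in\mathbb{Z}$. An operator on $L^2(\mathbb{T})$ is spatially invariant if it commutes with all translations; it then equals $\mathcal{F}^{-1}M_{\hat B}\mathcal{F}$ with $(M_{\hat B}\hat f)(\kappa)=\hat B_\kappa\hat f(\kappa)$, and $\hat B_\kappa$ is its symbol. An operator-valued transfer function $H(s)$ is spatially invariant if each $H(s)$ is; its symbol is $\hat H_\kappa(s)$. The system $\Sigma(A',B',C',D')$: $\dot x=A'x+B'v$, $y=C'x+D'v$, with $A'$ generating a $C_0$-semigroup $T_{A'}(t)$, has transfer function $C'(sI-A')^{-1}B'+D'$, called strictly proper if $D'=0$. For $D'=0$, $L_O=\int_0^\infty T_{A'}(t)^\dagger C'^\dagger C'T_{A'}(t)\,dt$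 (when absolutely convergent in operator norm), and when $B'$ is bounded and $L_O$ is trace class, the $\mathcal{H}_2$ norm of the system and of its transfer function is $\frac1{2\pi}\mathrm{Tr}(B'^\dagger L_OB')$. $\mathcal{H}_\infty$ is the set of operator-valued transfer functions $\Phi$ defined on $\{\mathrm{Re}(s)\ge0\}$ with values in the linear operators on $L^2(\mathbb{T})$ and $\sup_{\mathrm{Re}(s)\ge0}\|\Phi(s)\|_{L^2(\mathbb{T})\to L^2(\mathbb{T})}<\infty$. *)

(* Defs.v *)
From HB Require Import structures.
From mathcomp Require Import all_boot all_order all_algebra.
From mathcomp Require Import all_classical all_reals all_analysis.
From mathcomp Require Import measurable_realfun.
From mathcomp Require Import complex ring lra.

Set Implicit Arguments.
Unset Strict Implicit.
Unset Printing Implicit Defensive.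

Import Order.TTheory GRing.Theory Num.Theory.
Import numFieldNormedType.Exports.

Local Open Scope classical_set_scope.
Local Open Scope ring_scope.
Local Open Scope quotient_scope.
Local Open Scope complex_scope.

(* Num.Theory shadows the real-valued projections of R[i]. *)
Notation Re := complex.Re.
Notation Im := complex.Im.

(* Complex inner product spaces; the inner product is conjugate-linear in its
   FIRST argument. *)
HB.mixin Record hasInner (R : realType) V of GRing.Lmodule R[i] V := {
  inner : V -> V -> R[i];
  innerDr : forall x y z, inner x (y + z) = inner x y + inner x z;
  innerZr : forall a x y, inner x (a *: y) = a * inner x y;
  inner_conj : forall x y, inner y x = (inner x y)^*%C;
  inner_ge0 : forall x, 0 <= inner x x;
  inner_eq0 : forall x, inner x x = 0 -> x = 0 }.

#[short(type="innerType")]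
HB.structure Definition Inner (R : realType) :=
  {V of GRing.Lmodule R[i] V & hasInner R V}.

Definition hnorm (R : realType) (V : innerType R) (x : V) : R :=
  Num.sqrt (Re (inner x x)).

HB.mixin Record isHilbert (R : realType) V of Inner R V := {
  hilbert_complete : forall u : nat -> V,
    (forall eps : R, 0 < eps -> exists N, forall m n, (N <= m)%N -> (N <= n)%N ->
       hnorm (u m - u n) < eps) ->
    exists l, (fun n => hnorm (u n - l)) @ \oo --> (0 : R) }.

#[short(type="hilbertType")]
HB.structure Definition Hilbert (R : realType) :=
  {V of Inner R V & isHilbert R V}.

Section DirectSum.
Variables (R : realType) (U V : innerType R).

Let inner_pair (x y : U * V) : R[i] := inner x.1 y.1 + inner x.2 y.2.

Let inner_pairDr x y z : inner_pair x (y + z) = inner_pair x y + inner_pair x z.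
Proof. by rewrite /inner_pair !innerDr addrACA. Qed.

Let inner_pairZr a x y : inner_pair x (a *: y) = a * inner_pair x y.
Proof. by rewrite /inner_pair !innerZr mulrDr. Qed.

Let inner_pair_conj x y : inner_pair y x = (inner_pair x y)^*%C.
Proof.
by rewrite /inner_pair (inner_conj x.1) (inner_conj x.2) rmorphD.
Qed.

Let inner_pair_ge0 x : 0 <= inner_pair x x.
Proof. by rewrite addr_ge0 ?inner_ge0. Qed.

Let inner_pair_eq0 x : inner_pair x x = 0 -> x = 0.
Proof.
move/eqP; rewrite paddr_eq0 ?inner_ge0// => /andP[/eqP h1 /eqP h2].
by case: x h1 h2 => a b /= /inner_eq0 -> /inner_eq0 ->.
Qed.

HB.instance Definition _ := hasInner.Build R (U * V)%type
  inner_pairDr inner_pairZr inner_pair_conj inner_pair_ge0 inner_pair_eq0.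

End DirectSum.

Section ComplexIntegral.
Variable R : realType.
Implicit Types (D : set R) (f g : R -> R[i]).

Definition cmeasurable D f : Prop :=
  measurable_fun (D : set (measurableTypeR R)) (fun x => Re (f x)) /\
  measurable_fun (D : set (measurableTypeR R)) (fun x => Im (f x)).

Definition cintegrable D f : Prop :=
  (@lebesgue_measure R).-integrable D (EFin \o (fun x => Re (f x))) /\
  (@lebesgue_measure R).-integrable D (EFin \o (fun x => Im (f x))).

Definition cintegral D f : R[i] :=
  (\int[@lebesgue_measure R]_(x in D) Re (f x)) +i*
  (\int[@lebesgue_measure R]_(x in D) Im (f x)).

Definition sqmod (z : R[i]) : R := Re z ^+ 2 + Im z ^+ 2.

Definition expi (t : R) : R[i] := cos t +i* sin t.

End ComplexIntegral.

(* The circle is R / 2 pi Z: functions on it are 2 pi-periodic functions on R,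
   integrated over the fundamental domain [0, 2 pi[. *)
Section Circle.
Variable R : realType.
Implicit Types f g h : R -> R[i].

Definition arc : set R := `[0, 2 * pi[%classic.

Definition sqint f : Prop :=
  [/\ forall t, f (t + 2 * pi) = f t,
      cmeasurable setT f &
      (@lebesgue_measure R).-integrable arc (EFin \o (fun t => sqmod (f t)))].

Record sqfun := SqFun { sqval :> R -> R[i]; sqvalP : sqint sqval }.

HB.instance Definition _ := gen_eqMixin sqfun.
HB.instance Definition _ := gen_choiceMixin sqfun.

Definition aeq f g : Prop := ae_eq (@lebesgue_measure R) arc f g.

Lemma aeq_refl f : aeq f f.
Proof. exact: ae_eq_refl. Qed.

Lemma aeq_sym f g : aeq f g -> aeq g f.
Proof. exact: ae_eq_sym. Qed.

Lemma aeq_trans f g h : aeq f g -> aeq g h -> aeq f h.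
Proof. exact: ae_eq_trans. Qed.

Definition sqeq (f g : sqfun) : bool := `[< aeq f g >].

Let sqeq_refl : reflexive sqeq.
Proof. by move=> f; apply/asboolP/aeq_refl. Qed.

Let sqeq_sym : symmetric sqeq.
Proof. by move=> f g; apply/asboolP/asboolP; exact: aeq_sym. Qed.

Let sqeq_trans : transitive sqeq.
Proof. by move=> f g h /asboolP gf /asboolP fh; apply/asboolP/(aeq_trans gf). Qed.

Canonical sqeq_equiv := EquivRel sqeq sqeq_refl sqeq_sym sqeq_trans.

Definition L2T : Type := {eq_quot sqeq}.
HB.instance Definition _ := Choice.on L2T.
HB.instance Definition _ := EqQuotient.on L2T.

Definition L2fun (x : L2T) : R -> R[i] := repr x.
Coercion L2fun : L2T >-> Funclass.

Definition mkL2 f (hf : sqint f) : L2T := \pi_L2T (SqFun hf).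

Lemma mkL2E f (hf : sqint f) : aeq (mkL2 hf) f.
Proof.
have /eqmodP/asboolP := reprK (mkL2 hf).
by rewrite /mkL2 /L2fun.
Qed.

Lemma L2P (x y : L2T) : aeq x y -> x = y.
Proof.
move=> xy; rewrite -(reprK x) -(reprK y).
by apply/eqmodP/asboolP.
Qed.

Lemma sqint_L2 (x : L2T) : sqint x.
Proof. exact: sqvalP. Qed.


Let mu := @lebesgue_measure R.

Lemma measurable_arc : measurable (arc : set (measurableTypeR R)).
Proof. exact: measurable_itv. Qed.
#[local] Hint Resolve measurable_arc : core.

Lemma cmeasurableD D f g :
  cmeasurable D f -> cmeasurable D g -> cmeasurable D (fun t => f t + g t).
Proof.
move=> [f1 f2] [g1 g2]; split.
- apply: eq_measurable_fun (measurable_funD f1 g1) => t _ /=.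
  by case: (f t) (g t) => a b [].
- apply: eq_measurable_fun (measurable_funD f2 g2) => t _ /=.
  by case: (f t) (g t) => a b [].
Qed.

Lemma cmeasurableM D f g :
  cmeasurable D f -> cmeasurable D g -> cmeasurable D (fun t => f t * g t).
Proof.
move=> [f1 f2] [g1 g2]; split.
- apply: eq_measurable_fun (measurable_funB (measurable_funM f1 g1)
    (measurable_funM f2 g2)) => t _ /=.
  by case: (f t) (g t) => a b [].
- apply: eq_measurable_fun (measurable_funD (measurable_funM f1 g2)
    (measurable_funM f2 g1)) => t _ /=.
  by case: (f t) (g t) => a b [].
Qed.

Lemma cmeasurable_conj D f : cmeasurable D f -> cmeasurable D (fun t => (f t)^*%C).
Proof.
move=> [f1 f2]; split.
- by apply: eq_measurable_fun f1 => t _; case: (f t).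
- apply: eq_measurable_fun (measurableT_comp (@oppr_measurable R setT) f2) => t _ /=.
  by case: (f t).
Qed.

Lemma cmeasurable_cst (D : set R) (a : R[i]) : cmeasurable D (fun=> a).
Proof. by split; exact: measurable_cst. Qed.

Lemma measurable_sqmod D f : cmeasurable D f ->
  measurable_fun (D : set (measurableTypeR R)) (fun t => sqmod (f t)).
Proof. by move=> [f1 f2]; apply: measurable_funD; exact: measurable_funX. Qed.

Lemma sqmod_ge0 (z : R[i]) : 0 <= sqmod z.
Proof. by rewrite addr_ge0 ?sqr_ge0. Qed.

Lemma sqint0 : sqint (fun=> 0 : R[i]).
Proof.
split => //.
rewrite [X in _.-integrable _ X](_ : _ = cst 0%E); last first.
  by apply/funext => t /=; rewrite /sqmod/= expr0n/= addr0.
exact: integrable0.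
Qed.

Lemma sqintD f g : sqint f -> sqint g -> sqint (fun t => f t + g t).
Proof.
move=> [fp fm fi] [gp gm gi]; split.
- by move=> t; rewrite fp gp.
- exact: cmeasurableD.
- have hi := integrableZl measurable_arc 2 (integrableD measurable_arc fi gi).
  apply: (le_integrable measurable_arc _ _ hi) => [|t _ /=].
    apply/measurable_EFinP; apply: measurable_funTS.
    by apply: measurable_sqmod; exact: cmeasurableD.
  rewrite lee_fin !ger0_norm ?mulr_ge0 ?addr_ge0 ?sqr_ge0//.
  case: (f t) (g t) => a b [c d]; rewrite /sqmod /=.
  have := sqr_ge0 (a - c); have := sqr_ge0 (b - d); rewrite !expr2.
  by nra.
Qed.

Lemma sqintZ a f : sqint f -> sqint (fun t => a * f t).
Proof.
move=> [fp fm fi]; split.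
- by move=> t; rewrite fp.
- by apply: cmeasurableM => //; exact: cmeasurable_cst.
- have := integrableZl measurable_arc (sqmod a) fi.
  congr (_.-integrable _ _); apply/funext => t /=; rewrite -EFinM; congr EFin.
  by case: a (f t) => a b [c d]; rewrite /sqmod /=; ring.
Qed.

Definition addL2 (x y : L2T) : L2T := mkL2 (sqintD (sqint_L2 x) (sqint_L2 y)).
Definition scaleL2 (a : R[i]) (x : L2T) : L2T := mkL2 (sqintZ a (sqint_L2 x)).
Definition oppL2 (x : L2T) : L2T := scaleL2 (-1) x.
Definition zeroL2 : L2T := mkL2 sqint0.

Let addE x y : aeq (addL2 x y) (fun t => x t + y t).
Proof. exact: mkL2E. Qed.
Let scaleE a x : aeq (scaleL2 a x) (fun t => a * x t).
Proof. exact: mkL2E. Qed.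
Let zeroE : aeq zeroL2 (fun=> 0).
Proof. exact: mkL2E. Qed.

Let aeqD f f' g g' : aeq f f' -> aeq g g' ->
  aeq (fun t => f t + g t) (fun t => f' t + g' t).
Proof. by apply: filterS2 => t h1 h2 At; rewrite h1// h2. Qed.

Let aeqZ a f f' : aeq f f' -> aeq (fun t => a * f t) (fun t => a * f' t).
Proof. by apply: filterS => t h1 At; rewrite h1. Qed.

Let addL2A : associative addL2.
Proof.
move=> x y z; apply: L2P; apply: aeq_trans (addE _ _) _.
apply: aeq_trans (aeqD (aeq_refl _) (addE _ _)) _.
apply: aeq_sym; apply: aeq_trans (addE _ _) _.
apply: aeq_trans (aeqD (addE _ _) (aeq_refl _)) _.
by apply: aeW => t _; rewrite addrA.
Qed.

Let addL2C : commutative addL2.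
Proof.
move=> x y; apply: L2P; apply: aeq_trans (addE _ _) _.
apply: aeq_sym; apply: aeq_trans (addE _ _) _.
by apply: aeW => t _; rewrite addrC.
Qed.

Let add0L2 : left_id zeroL2 addL2.
Proof.
move=> x; apply: L2P; apply: aeq_trans (addE _ _) _.
apply: aeq_trans (aeqD zeroE (aeq_refl _)) _.
by apply: aeW => t _; rewrite add0r.
Qed.

Let addNL2 : left_inverse zeroL2 oppL2 addL2.
Proof.
move=> x; apply: L2P; apply: aeq_trans (addE _ _) _.
apply: aeq_trans (aeqD (scaleE _ _) (aeq_refl _)) _.
apply: aeq_sym; apply: aeq_trans zeroE _.
by apply: aeW => t _; rewrite mulN1r addNr.
Qed.

HB.instance Definition _ := GRing.isZmodule.Build L2T addL2A addL2C add0L2 addNL2.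

Let scaleL2A a b x : scaleL2 a (scaleL2 b x) = scaleL2 (a * b) x.
Proof.
apply: L2P; apply: aeq_trans (scaleE _ _) _.
apply: aeq_trans (aeqZ _ (scaleE _ _)) _.
apply: aeq_sym; apply: aeq_trans (scaleE _ _) _.
by apply: aeW => t _; rewrite mulrA.
Qed.

Let scale1L2 : left_id 1 scaleL2.
Proof.
move=> x; apply: L2P; apply: aeq_trans (scaleE _ _) _.
by apply: aeW => t _; rewrite mul1r.
Qed.

Let scaleL2Dr : right_distributive scaleL2 +%R.
Proof.
move=> a x y; apply: L2P; apply: aeq_trans (scaleE _ _) _.
apply: aeq_trans (aeqZ _ (addE _ _)) _.
apply: aeq_sym; apply: aeq_trans (addE _ _) _.
apply: aeq_trans (aeqD (scaleE _ _) (scaleE _ _)) _.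
by apply: aeW => t _; rewrite mulrDr.
Qed.

Let scaleL2Dl x : {morph scaleL2^~ x : a b / a + b}.
Proof.
move=> a b; apply: L2P; apply: aeq_trans (scaleE _ _) _.
apply: aeq_sym; apply: aeq_trans (addE _ _) _.
apply: aeq_trans (aeqD (scaleE _ _) (scaleE _ _)) _.
by apply: aeW => t _; rewrite mulrDl.
Qed.

HB.instance Definition _ := GRing.Zmodule_isLmodule.Build R[i] L2T
  scaleL2A scale1L2 scaleL2Dr scaleL2Dl.

Lemma L2addE (x y : L2T) : aeq (x + y : L2T) (fun t => x t + y t).
Proof. exact: addE. Qed.

Lemma L2scaleE a (x : L2T) : aeq (a *: x : L2T) (fun t => a * x t).
Proof. exact: scaleE. Qed.

Lemma L20E : aeq (0 : L2T) (fun=> 0).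
Proof. exact: zeroE. Qed.

Definition innerL2 (x y : L2T) : R[i] := cintegral arc (fun t => (x t)^*%C * y t).

Lemma cintegrable_conjM f g : sqint f -> sqint g ->
  cintegrable arc (fun t => (f t)^*%C * g t).
Proof.
move=> [_ fm fi] [_ gm gi].
have [m1 m2] := cmeasurableM (cmeasurable_conj fm) gm.
have hi := integrableD measurable_arc fi gi.
split; apply: (le_integrable measurable_arc _ _ hi).
- by apply/measurable_EFinP; exact: measurable_funTS m1.
- move=> t _ /=; rewrite lee_fin.
  rewrite [leRHS]ger0_norm ?addr_ge0 ?sqr_ge0//.
  case: (f t) (g t) => a b [c d]; rewrite /sqmod /= ler_norml.
  have := sqr_ge0 (a - c); have := sqr_ge0 (b - d).
  have := sqr_ge0 (a + c); have := sqr_ge0 (b + d); rewrite !expr2.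
  by move=> *; apply/andP; split; nra.
- by apply/measurable_EFinP; exact: measurable_funTS m2.
- move=> t _ /=; rewrite lee_fin.
  rewrite [leRHS]ger0_norm ?addr_ge0 ?sqr_ge0//.
  case: (f t) (g t) => a b [c d]; rewrite /sqmod /= ler_norml.
  have := sqr_ge0 (a - d); have := sqr_ge0 (b - c).
  have := sqr_ge0 (a + d); have := sqr_ge0 (b + c); rewrite !expr2.
  by move=> *; apply/andP; split; nra.
Qed.

Lemma cintegral_aeq f g : cmeasurable arc f -> cmeasurable arc g -> aeq f g ->
  cintegral arc f = cintegral arc g.
Proof.
move=> [f1 f2] [g1 g2] fg; rewrite /cintegral; congr (_ +i* _);
  rewrite /Rintegral; congr fine; apply: ae_eq_integral => //.
- exact/measurable_EFinP.
- exact/measurable_EFinP.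
- by apply: filterS fg => t h At; rewrite h.
- exact/measurable_EFinP.
- exact/measurable_EFinP.
- by apply: filterS fg => t h At; rewrite h.
Qed.

Let cmeas f D : sqint f -> cmeasurable D f.
Proof. by move=> [_ [m1 m2] _]; split; exact: measurable_funTS. Qed.

Let innerL2_ae (x y : L2T) f : cmeasurable arc f -> aeq y f ->
  innerL2 x y = cintegral arc (fun t => (x t)^*%C * f t).
Proof.
move=> mf yf; apply: cintegral_aeq.
- by apply: cmeasurableM; [apply: cmeasurable_conj|]; apply: cmeas; exact: sqint_L2.
- by apply: cmeasurableM => //; apply: cmeasurable_conj; apply: cmeas; exact: sqint_L2.
- by apply: filterS yf => t h At; rewrite h.
Qed.

Let innerL2Dr (x y z : L2T) : innerL2 x (y + z) = innerL2 x y + innerL2 x z.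
Proof.
rewrite (innerL2_ae x _ (L2addE y z)); last first.
  by apply: cmeasurableD; apply: cmeas; exact: sqint_L2.
have [y1 y2] := cintegrable_conjM (sqint_L2 x) (sqint_L2 y).
have [z1 z2] := cintegrable_conjM (sqint_L2 x) (sqint_L2 z).
rewrite /innerL2 /cintegral -[RHS]/(_ +i* _) -!RintegralD//.
congr (_ +i* _); apply: eq_Rintegral => t _;
  by case: (x t) (y t) (z t) => a b [c d] [e f] /=; ring.
Qed.

Let integrableZ (c : R) (f : R -> R) : mu.-integrable arc (EFin \o f) ->
  mu.-integrable arc (EFin \o (fun t => c * f t)).
Proof.
move=> /(integrableZl measurable_arc c); congr (_.-integrable _ _).
Qed.

Let innerL2Zr a (x y : L2T) : innerL2 x (a *: y) = a * innerL2 x y.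
Proof.
rewrite (innerL2_ae x _ (L2scaleE a y)); last first.
  by apply: cmeasurableM; [exact: cmeasurable_cst|apply: cmeas; exact: sqint_L2].
have [y1 y2] := cintegrable_conjM (sqint_L2 x) (sqint_L2 y).
rewrite /innerL2 /cintegral; case: a => a b.
rewrite -[RHS]/(_ +i* _) -!RintegralZl//.
rewrite -RintegralB//; [|exact: integrableZ..].
rewrite -RintegralD//; [|exact: integrableZ..].
congr (_ +i* _); apply: eq_Rintegral => t _;
  by case: (x t) (y t) => c d [e f] /=; ring.
Qed.

Let innerL2_conj (x y : L2T) : innerL2 y x = (innerL2 x y)^*%C.
Proof.
have [y1 y2] := cintegrable_conjM (sqint_L2 x) (sqint_L2 y).
rewrite /innerL2 /cintegral -[RHS]/(_ +i* _).
rewrite -mulN1r -RintegralZl//.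
congr (_ +i* _); apply: eq_Rintegral => t _;
  by case: (x t) (y t) => c d [e f] /=; ring.
Qed.

Lemma innerL2E (x : L2T) : innerL2 x x = (\int[mu]_(t in arc) sqmod (x t))%:C.
Proof.
rewrite /innerL2 /cintegral; congr (_ +i* _).
  by apply: eq_Rintegral => t _; case: (x t) => a b; rewrite /sqmod /=; ring.
rewrite -[RHS](_ : \int[mu]_(t in arc) (0 : R) = 0); last first.
  by rewrite Rintegral_cst// mul0r.
by apply: eq_Rintegral => t _; case: (x t) => a b /=; ring.
Qed.

Let innerL2_ge0 (x : L2T) : 0 <= innerL2 x x.
Proof.
rewrite innerL2E ler0c; apply: Rintegral_ge0 => t _; exact: sqmod_ge0.
Qed.

Let innerL2_eq0 (x : L2T) : innerL2 x x = 0 -> x = 0.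
Proof.
rewrite innerL2E => -[h].
have [_ xm xi] := sqint_L2 x.
have h0 : (\int[mu]_(t in arc) `|(sqmod (x t))%:E|)%E = 0%E.
  rewrite -[RHS]/(0%:E) -h /Rintegral fineK; last exact: integrable_fin_num.
  by apply: eq_integral => t _; rewrite /= ger0_norm ?sqmod_ge0.
have /(ae_eq_integral_abs mu measurable_arc) h1 := h0.
apply: L2P; apply: aeq_trans (aeq_sym L20E).
apply: filterS (h1 _) => [t ht At|]; last first.
  by apply/measurable_EFinP/measurable_funTS; exact: measurable_sqmod.
have [/eqP] := ht At; case: (x t) => a b; rewrite /sqmod /=.
by rewrite paddr_eq0 ?sqr_ge0// !sqrf_eq0 => /andP[/eqP -> /eqP ->].
Qed.

HB.instance Definition _ := hasInner.Build R L2T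
  innerL2Dr innerL2Zr innerL2_conj innerL2_ge0 innerL2_eq0.

End Circle.

Definition closed_rhp (R : realType) : set R[i] := [set s | 0 <= Re s].

Section Operators.
Variable R : realType.
Implicit Types U V X : innerType R.

Definition opnorm U V (f : U -> V) : \bar R :=
  ereal_sup [set (hnorm (f x))%:E | x in [set x | hnorm x <= 1]].

Definition bounded_op U V (f : U -> V) : Prop := (opnorm f < +oo)%E.

Definition is_adjoint U V (f : U -> V) (fd : V -> U) : Prop :=
  forall x y, inner y (f x) = inner (fd y) x.

Definition orthonormal_basis V (I : choiceType) (e : I -> V) : Prop :=
  (forall i j, inner (e i) (e j) = (i == j)%:R) /\
  (forall x, (forall i, inner (e i) x = 0) -> x = 0).

(* Only used for positive operators, for which the sum has nonnegative terms
   and being trace class means that it is finite. *)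
Definition is_trace V (L : V -> V) (v : \bar R) : Prop :=
  forall (I : choiceType) (e : I -> V), orthonormal_basis e ->
    (\esum_(i in [set: I]) (Re (inner (e i) (L (e i))))%:E)%E = v.

Definition trace_class V (L : V -> V) : Prop := exists w : R, is_trace L w%:E.

Definition c0_semigroup X (T : R -> X -> X) : Prop :=
  [/\ forall t, 0 <= t -> bounded_op (T t),
      forall x, T 0 x = x,
      forall s t x, 0 <= s -> 0 <= t -> T (s + t) x = T s (T t x) &
      forall x, (fun t => hnorm (T t x - x)) @ 0^'+ --> (0 : R)].

(* x lies in the domain of the generator of T, which maps it to y. *)
Definition generator X (T : R -> X -> X) (x y : X) : Prop :=
  (fun t => hnorm ((t^-1)%:C *: (T t x - x) - y)) @ 0^'+ --> (0 : R).

(* Q = (s I - A)^-1, where A generates T. *)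
Definition is_resolvent X (T : R -> X -> X) (s : R[i]) (Q : {linear X -> X}) : Prop :=
  [/\ bounded_op Q,
      forall x, generator T (Q x) (s *: Q x - x) &
      forall x y, generator T x y -> Q (s *: x - y) = x].

End Operators.

Section Systems.
Variables (R : realType) (U Y : innerType R).

(* The system x' = A x + B v, y = C x + D v on a complex Hilbert space; A is
   given through the C0-semigroup T that it generates. *)
Record system := System {
  state : hilbertType R;
  opT : R -> {linear state -> state};
  opB : {linear U -> state};
  opC : {linear state -> Y};
  opD : {linear U -> Y};
  opT_c0 : c0_semigroup opT;
  opB_bounded : bounded_op opB;
  opC_bounded : bounded_op opC;
  opD_bounded : bounded_op opD }.

Implicit Types (S : system) (Phi : R[i] -> U -> Y).

Definition is_transfer_function S Phi : Prop :=
  forall s, closed_rhp s ->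
    exists2 Q : {linear state S -> state S}, is_resolvent (@opT S) s Q &
      forall v, Phi s v = opC S (Q (opB S v)) + opD S v.

Definition zero_feedthrough S : Prop := forall v, opD S v = 0.

Definition strictly_proper Phi : Prop :=
  exists2 S, is_transfer_function S Phi & zero_feedthrough S.

Definition in_Hinfty Phi : Prop :=
  (ereal_sup [set opnorm (Phi s) | s in @closed_rhp R] < +oo)%E.

Definition is_observability_gramian S (L : {linear state S -> state S}) : Prop :=
  exists (Td : R -> {linear state S -> state S}) (Cd : {linear Y -> state S}),
    let G t x := Td t (Cd (opC S (opT S t x))) in
    [/\ forall t, 0 <= t -> is_adjoint (opT S t) (Td t),
        is_adjoint (opC S) Cd,
        (\int[@lebesgue_measure R]_(t in `[0%R, +oo[) opnorm (G t) < +oo)%E &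
        forall x y, inner x (L y) = cintegral `[0, +oo[ (fun t => inner x (G t y))].

Definition is_system_H2norm S (v : R) : Prop :=
  zero_feedthrough S /\
  exists (L : {linear state S -> state S}) (Bd : {linear state S -> U}) (w : R),
    [/\ is_observability_gramian L, trace_class L, is_adjoint (opB S) Bd,
        is_trace (fun x => Bd (L (opB S x))) w%:E & v = (2 * pi)^-1 * w].

(* A transfer function none of whose realizations has a trace class
   observability Gramian has no (finite) H2 norm. *)
Definition is_H2norm Phi (v : R) : Prop :=
  exists2 S, is_transfer_function S Phi & is_system_H2norm S v.

End Systems.

Section CircleOperators.
Variable R : realType.
Local Notation L2T := (L2T R).

Definition fourier (f : L2T) (k : int) : R[i] :=
  ((2 * pi)^-1)%:C * cintegral (@arc R) (fun t => f t * expi (- (k%:~R * t))).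

Definition is_translate (a : R) (f g : L2T) : Prop := aeq g (fun t => f (t - a)).

Definition spatially_invariant (B : L2T -> L2T) : Prop :=
  forall a f g, is_translate a f g -> is_translate a (B f) (B g).

Definition is_symbol (B : L2T -> L2T) (b : int -> R[i]) : Prop :=
  forall f k, fourier (B f) k = b k * fourier f k.

Definition test_function (phi : R -> R) : Prop :=
  (forall t, phi (t + 2 * pi) = phi t) /\
  (forall n t, derivable (derive1n n phi) t 1).

Definition weak_derivative (f g : L2T) : Prop :=
  forall phi, test_function phi ->
    cintegral (@arc R) (fun t => f t * (derive1 phi t)%:C) =
    - cintegral (@arc R) (fun t => g t * (phi t)%:C).

(* f lies in the domain of A = alpha d^2/dtheta^2, and A f = g. *)
Definition diffusion (alpha : R) (f g : L2T) : Prop :=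
  exists f1 f2, [/\ weak_derivative f f1, weak_derivative f1 f2 &
                    g = alpha%:C *: f2].

End CircleOperators.

Section LQR.
Variables (R : realType) (alpha gamma : R).
Local Notation L2T := (L2T R).
Implicit Types u psi : R -> L2T.

(* Weakly (equivalently, L^2(T) being separable, strongly) measurable and
   locally square integrable in time. *)
Definition admissible_control u : Prop :=
  (forall f, cmeasurable `[0, +oo[ (fun t => inner f (u t))) /\
  (forall T, (\int[@lebesgue_measure R]_(t in `[0%R, T]) (hnorm (u t) ^+ 2)%:E < +oo)%E).

(* Weak (equivalently, mild) solutions of d psi/dt = A psi + u, psi(0) = psi0,
   A being self-adjoint. *)
Definition solves_diffusion (psi0 : L2T) u psi : Prop :=
  [/\ psi 0 = psi0,
      forall t, 0 <= t ->
        hnorm (psi s - psi t) @[s --> within `[0, +oo[ (nbhs t)] --> (0 : R) &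
      forall f g, diffusion alpha f g -> forall t, 0 <= t ->
        inner f (psi t) = inner f psi0 +
          cintegral `[0, t] (fun s => inner g (psi s) + inner f (u s))].

Definition lqr_cost psi u : \bar R :=
  (\int[@lebesgue_measure R]_(t in `[0%R, +oo[)
    (Re (inner (psi t) ((gamma ^+ 2)%:C *: psi t) + inner (u t) (u t)))%:E)%E.

Definition lqr_value (psi0 : L2T) : \bar R :=
  ereal_inf [set J | exists u psi, [/\ admissible_control u,
                       solves_diffusion psi0 u psi & J = lqr_cost psi u]].

Definition lqr_optimal_gain (K : {linear L2T -> L2T}) : Prop :=
  bounded_op K /\
  forall psi0 : L2T, exists psi,
    [/\ admissible_control (fun t => K (psi t)),
        solves_diffusion psi0 (fun t => K (psi t)) psi &
        lqr_cost psi (fun t => K (psi t)) = lqr_value psi0].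

End LQR.

Section H2Problem.
Variables (R : realType) (alpha gamma : R).
Local Notation L2T := (L2T R).
Implicit Types Phipsi Phiu : R[i] -> {linear L2T -> L2T}.

Definition weightC (psi : L2T) : L2T * L2T := (gamma%:C *: psi, 0).
Definition weightD (u : L2T) : L2T * L2T := (0, u).

Definition affine_constraint Phipsi Phiu : Prop :=
  forall s, closed_rhp s -> forall th, exists2 g, diffusion alpha (Phipsi s th) g &
    forall eta,
      inner eta ((s + 1) *: Phipsi s th - (g + Phipsi s th)) - inner eta (Phiu s th)
      = inner eta th.

Definition h2_feasible Phipsi Phiu : Prop :=
  [/\ in_Hinfty Phipsi /\ in_Hinfty Phiu,
      forall s, closed_rhp s ->
        spatially_invariant (Phipsi s) /\ spatially_invariant (Phiu s),
      strictly_proper Phipsi /\ strictly_proper Phiu &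
      affine_constraint Phipsi Phiu].

Definition is_h2_objective Phipsi Phiu (v : R) : Prop :=
  is_H2norm (fun s th => weightC (Phipsi s th) + weightD (Phiu s th)) v.

(* Feasible pairs whose objective has no finite H2 norm do not compete. *)
Definition h2_solution Phipsi Phiu : Prop :=
  h2_feasible Phipsi Phiu /\
  exists2 v, is_h2_objective Phipsi Phiu v &
    forall Phipsi' Phiu' v', h2_feasible Phipsi' Phiu' ->
      is_h2_objective Phipsi' Phiu' v' -> v <= v'.

End H2Problem.

(* Main.v *)
(* In the Fourier basis the problem decouples into scalar problems
   x' = -lam x + u with lam = alpha k^2, whose Riccati equation has the root
   p = sqrt(lam^2 + gamma^2) - lam; the optimal gain is the multiplier -p and the
   closed loop decays at the rate omega = sqrt(lam^2 + gamma^2).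
   For a feasible pair of transfer functions and an arbitrary realization, the
   response h of the mode e_k to the weighted outputs satisfies, by the affine
   constraint evaluated at s = omega,
     int_0^oo e^(-omega t) Re <z, h t> dt = p,   z = (gamma e_k, -p e_k).
   As |z|^2 = 2 omega p, the inequality |h t - e^(-omega t) z|^2 >= 0 integrates
   to int |h|^2 >= p, with equality only for h t = e^(-omega t) z, which
   determines the transfer functions; summing over k compares the traces.
   The same completion of squares for trajectories gives p |psi_k(0)|^2 as a
   lower bound of the k-th modal LQR cost, attained only by the closed loop. *)

Require Import Defs.
From HB Require Import structures.
From mathcomp Require Import all_boot all_order all_algebra.
From mathcomp Require Import all_classical all_reals all_analysis.
From mathcomp Require Import measurable_realfun.
From mathcomp Require Import complex ring lra zify.

Set Implicit Arguments.
Unset Strict Implicit.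
Unset Printing Implicit Defensive.

Import Order.TTheory GRing.Theory Num.Theory.
Import numFieldNormedType.Exports.

Local Open Scope classical_set_scope.
Local Open Scope ring_scope.
Local Open Scope complex_scope.

Local Notation Re := complex.Re.
Local Notation Im := complex.Im.

(** The realization in the H2 problem is arbitrary: its state space is an abstract Hilbert space,
    its semigroup comes with no decay or growth estimate, and its Gramian is known only as a weak
    integral. Nothing there is diagonal, so the modes can be seen only through inputs e_k and scalar
    functionals of the output. Two facts replace structure. Pairing the output with z is chosen so
    that, at s = omega, the unknown transfer functions combine into exactly the expression fixed by
    the affine constraint; a single real frequency therefore suffices. And the finite output energy
    supplied by the Gramian removes boundary terms at infinity that a growth bound would normally
    remove. A second obstacle is that the control is only weakly measurable and locally square
    integrable, so modal trajectories are not classically differentiable, and integration by parts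
    is done on increments. The optimum is finite because p behaves like gamma^2 / (2 alpha k^2),
    which is summable over the integers. Since a trace must have the same value in every orthonormal
    basis, Parseval's identity is proved for arbitrary index types. *)

Section ComplexNumbers.
Context {R : realType}.
Implicit Types (z w : R[i]) (a b : R).

Lemma sqmodE z : z * z^*%C = (sqmod z)%:C.
Proof. by case: z => a b; rewrite /sqmod /=; simpc; congr (_ +i* _); ring. Qed.

Lemma sqmodE' z : z^*%C * z = (sqmod z)%:C.
Proof. by rewrite mulrC sqmodE. Qed.

Lemma sqmodM z w : sqmod (z * w) = sqmod z * sqmod w.
Proof. by case: z w => a b [c d]; rewrite /sqmod /=; ring. Qed.

Lemma sqmod0 : sqmod (0 : R[i]) = 0.
Proof. by rewrite /sqmod /= expr0n addr0. Qed.

Lemma sqmod1 : sqmod (1 : R[i]) = 1.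
Proof. by rewrite /sqmod /= expr0n expr1n addr0. Qed.

Lemma sqmodR a : sqmod a%:C = a ^+ 2.
Proof. by rewrite /sqmod /= expr0n addr0. Qed.

Lemma sqmodN z : sqmod (- z) = sqmod z.
Proof. by case: z => a b; rewrite /sqmod /= !sqrrN. Qed.

Lemma sqmod_conj z : sqmod z^*%C = sqmod z.
Proof. by case: z => a b; rewrite /sqmod /= sqrrN. Qed.

Lemma sqmod_eq0 z : (sqmod z == 0) = (z == 0).
Proof.
case: z => a b; rewrite /sqmod /= paddr_eq0 ?sqr_ge0// !sqrf_eq0.
by rewrite eq_complex.
Qed.

Lemma sqmod_gt0 z : (0 < sqmod z) = (z != 0).
Proof. by rewrite lt_def sqmod_ge0 andbT sqmod_eq0. Qed.

Lemma sqmodV z : sqmod z^-1 = (sqmod z)^-1.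
Proof.
have [->|z0] := eqVneq z 0; first by rewrite invr0 sqmod0 invr0.
apply: (mulfI (_ : sqmod z != 0)); first by rewrite sqmod_eq0.
by rewrite -sqmodM !mulfV ?sqmod_eq0// sqmod1.
Qed.

Lemma sqmodD_le z w : sqmod (z + w) <= 2 * sqmod z + 2 * sqmod w.
Proof.
case: z w => a b [c d]; rewrite /sqmod /=.
by have := sqr_ge0 (a - c); have := sqr_ge0 (b - d); rewrite !expr2; nra.
Qed.

Lemma ReD z w : Re (z + w) = Re z + Re w. Proof. by case: z w => a b []. Qed.
Lemma ImD z w : Im (z + w) = Im z + Im w. Proof. by case: z w => a b []. Qed.
Lemma ReN z : Re (- z) = - Re z. Proof. by case: z. Qed.
Lemma ImN z : Im (- z) = - Im z. Proof. by case: z. Qed.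
Lemma ReB z w : Re (z - w) = Re z - Re w. Proof. by rewrite ReD ReN. Qed.
Lemma ImB z w : Im (z - w) = Im z - Im w. Proof. by rewrite ImD ImN. Qed.
Lemma ReZ a z : Re (a%:C * z) = a * Re z.
Proof. by case: z => c d /=; rewrite mul0r subr0. Qed.
Lemma ImZ a z : Im (a%:C * z) = a * Im z.
Proof. by case: z => c d /=; rewrite mul0r addr0. Qed.
Lemma Re_conj z : Re z^*%C = Re z. Proof. by case: z. Qed.

Lemma Re_sqr_le z : Re z ^+ 2 <= sqmod z.
Proof. by rewrite /sqmod lerDl sqr_ge0. Qed.

Lemma Im_sqr_le z : Im z ^+ 2 <= sqmod z.
Proof. by rewrite /sqmod lerDr sqr_ge0. Qed.

Lemma complexP z w : Re z = Re w -> Im z = Im w -> z = w.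
Proof. by case: z w => a b [c d] /= -> ->. Qed.

Lemma complexV a : (a%:C)^-1 = (a^-1)%:C :> R[i].
Proof. by rewrite fmorphV. Qed.

End ComplexNumbers.

(** * Inner product spaces and bounded operators *)

Section InnerProduct.
Context {R : realType} {V : innerType R}.
Implicit Types (x y z : V) (a b : R[i]).

Definition normsq x : R := Re (inner x x).

Lemma innerDl x y z : inner (x + y) z = inner x z + inner y z.
Proof. by rewrite inner_conj innerDr rmorphD /= -!inner_conj. Qed.

Lemma innerZl a x y : inner (a *: x) y = a^*%C * inner x y.
Proof. by rewrite inner_conj innerZr rmorphM /= -!inner_conj. Qed.

Lemma inner0r x : inner x 0 = 0.
Proof. by rewrite -(scale0r 0) innerZr mul0r. Qed.

Lemma inner0l x : inner 0 x = 0.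
Proof. by rewrite inner_conj inner0r rmorph0. Qed.

Lemma innerNr x y : inner x (- y) = - inner x y.
Proof. by rewrite -scaleN1r innerZr mulN1r. Qed.

Lemma innerNl x y : inner (- x) y = - inner x y.
Proof. by rewrite inner_conj innerNr rmorphN /= -inner_conj. Qed.

Lemma innerBr x y z : inner x (y - z) = inner x y - inner x z.
Proof. by rewrite innerDr innerNr. Qed.

Lemma inner_sumr (I : Type) (r : seq I) (P : pred I) (F : I -> V) x :
  inner x (\sum_(i <- r | P i) F i) = \sum_(i <- r | P i) inner x (F i).
Proof.
apply: (big_morph (inner x)); [exact: innerDr|exact: inner0r].
Qed.

Lemma Im_innerxx x : Im (inner x x) = 0.
Proof. by have := inner_ge0 x; rewrite lecE /= => /andP[/eqP -> _]. Qed.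

Lemma innerxx x : inner x x = (normsq x)%:C.
Proof. by apply: complexP => //=; rewrite Im_innerxx. Qed.

Lemma normsq_ge0 x : 0 <= normsq x.
Proof. by have := inner_ge0 x; rewrite innerxx ler0c. Qed.

Lemma hnorm_sq x : hnorm x ^+ 2 = normsq x.
Proof. by rewrite /hnorm sqr_sqrtr// normsq_ge0. Qed.

Lemma hnorm_ge0 x : 0 <= hnorm x.
Proof. exact: sqrtr_ge0. Qed.

Lemma normsq0 : normsq (0 : V) = 0.
Proof. by rewrite /normsq inner0r. Qed.

Lemma hnorm0 : hnorm (0 : V) = 0.
Proof. by rewrite /hnorm inner0r /= sqrtr0. Qed.

Lemma normsq0_eq0 x : normsq x = 0 -> x = 0.
Proof. by move=> h; apply: inner_eq0; rewrite innerxx h. Qed.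

Lemma hnorm0_eq0 x : hnorm x = 0 -> x = 0.
Proof. by move=> h; apply: normsq0_eq0; rewrite -hnorm_sq h expr0n. Qed.

Lemma normsqZ a x : normsq (a *: x) = sqmod a * normsq x.
Proof. by rewrite /normsq innerZl innerZr mulrA sqmodE' ReZ. Qed.

Lemma normsqN x : normsq (- x) = normsq x.
Proof. by rewrite /normsq innerNl innerNr opprK. Qed.

Lemma normsqD x y : normsq (x + y) = normsq x + normsq y + 2 * Re (inner x y).
Proof.
rewrite /normsq innerDl !innerDr !ReD (inner_conj x y) Re_conj.
by ring.
Qed.

Lemma normsqB x y : normsq (x - y) = normsq x + normsq y - 2 * Re (inner x y).
Proof. by rewrite normsqD normsqN innerNr ReN mulrN. Qed.

Lemma normsqD_le x y : normsq (x + y) <= 2 * normsq x + 2 * normsq y.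
Proof.
have := normsq_ge0 (x - y); rewrite normsqB normsqD.
by lra.
Qed.

Lemma CauchySchwarz x y : sqmod (inner x y) <= normsq x * normsq y.
Proof.
have [x0|x0] := eqVneq (normsq x) 0.
  by rewrite (normsq0_eq0 x0) inner0l sqmod0 normsq0 mul0r.
have xp : 0 < normsq x by rewrite lt_def x0 normsq_ge0.
(* This vector is |x|^2 times the part of y orthogonal to x; the scaling avoids a division. *)
have := normsq_ge0 ((normsq x)%:C *: y - inner x y *: x).
rewrite normsqB !normsqZ innerZl innerZr conjc_real sqmodR.
rewrite (inner_conj x y) sqmodE -rmorphM /= => h.
suff : 0 <= normsq x * (normsq x * normsq y - sqmod (inner x y)).
  by rewrite pmulr_rge0// subr_ge0.
by move: h; lra.
Qed.

Lemma Re_inner_le x y : Re (inner x y) ^+ 2 <= normsq x * normsq y.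
Proof. exact: le_trans (Re_sqr_le _) (CauchySchwarz _ _). Qed.

Lemma hnormD x y : hnorm (x + y) <= hnorm x + hnorm y.
Proof.
rewrite -(@ler_pXn2r _ 2%N)// ?nnegrE ?addr_ge0 ?hnorm_ge0//.
have h : Re (inner x y) <= hnorm x * hnorm y.
  apply: le_trans (ler_norm _) _.
  rewrite -(@ler_pXn2r _ 2%N)// ?nnegrE ?mulr_ge0 ?hnorm_ge0//.
  by rewrite real_normK ?num_real// exprMn !hnorm_sq Re_inner_le.
rewrite sqrrD !hnorm_sq normsqD.
by lra.
Qed.

Lemma hnormN x : hnorm (- x) = hnorm x.
Proof. by rewrite /hnorm innerNl innerNr opprK. Qed.

Lemma hnormB x y : hnorm (x - y) = hnorm (y - x).
Proof. by rewrite -hnormN opprB. Qed.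

Lemma hnormZ a x : hnorm (a *: x) = Num.sqrt (sqmod a) * hnorm x.
Proof. by rewrite {1}/hnorm -/(normsq _) normsqZ sqrtrM ?sqmod_ge0. Qed.

Lemma hnormZR (a : R) x : hnorm (a%:C *: x) = `|a| * hnorm x.
Proof. by rewrite hnormZ sqmodR sqrtr_sqr. Qed.

Lemma hnorm_leR x (r : R) : 0 <= r -> (hnorm x <= r) = (normsq x <= r ^+ 2).
Proof.
by move=> r0; rewrite -(@ler_pXn2r _ 2%N)// ?nnegrE ?hnorm_ge0// !hnorm_sq.
Qed.

Lemma Re_inner_le_hnorm x y : `|Re (inner x y)| <= hnorm x * hnorm y.
Proof.
rewrite -(@ler_pXn2r _ 2%N)// ?nnegrE ?mulr_ge0 ?hnorm_ge0//.
by rewrite real_normK ?num_real// exprMn !hnorm_sq Re_inner_le.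
Qed.

Lemma Im_inner_le_hnorm x y : `|Im (inner x y)| <= hnorm x * hnorm y.
Proof.
rewrite -(@ler_pXn2r _ 2%N)// ?nnegrE ?mulr_ge0 ?hnorm_ge0//.
rewrite real_normK ?num_real// exprMn !hnorm_sq.
exact: le_trans (Im_sqr_le _) (CauchySchwarz _ _).
Qed.

Lemma inner_ext x y : (forall z, inner z x = inner z y) -> x = y.
Proof.
move=> h; apply/subr0_eq/inner_eq0.
by rewrite innerBr h subrr.
Qed.

Lemma normsq_cvg0 (T : Type) (F : set_system T) {FF : Filter F} (f : T -> V) :
  (fun t => normsq (f t)) @ F --> (0 : R) -> (fun t => hnorm (f t)) @ F --> (0 : R).
Proof.
move=> h; rewrite -(sqrtr0 R).
by apply: cvg_comp h _; exact: sqrt_continuous.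
Qed.

Lemma hnorm_cvg0 (T : Type) (F : set_system T) {FF : Filter F} (f : T -> V) :
  (fun t => hnorm (f t)) @ F --> (0 : R) -> (fun t => normsq (f t)) @ F --> (0 : R).
Proof.
move=> h; rewrite (_ : 0 = 0 * 0)//; last by rewrite mulr0.
under eq_fun do rewrite -hnorm_sq expr2.
exact: cvgM.
Qed.

Lemma Re_inner_cvg (T : Type) (F : set_system T) {FF : Filter F} (f : T -> V) x y :
  (fun t => hnorm (f t - x)) @ F --> (0 : R) ->
  (fun t => Re (inner y (f t))) @ F --> Re (inner y x).
Proof.
move=> h; apply/cvgrPdist_le => e e0.
have /cvgrPdist_le : (fun t => hnorm y * hnorm (f t - x)) @ F --> (0 : R).
  by rewrite -(mulr0 (hnorm y)); apply: cvgM => //; exact: cvg_cst.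
move=> /(_ _ e0); apply: filterS => t.
rewrite sub0r normrN ger0_norm ?mulr_ge0 ?hnorm_ge0//; apply: le_trans.
by rewrite hnormB -ReB -innerBr Re_inner_le_hnorm.
Qed.

Lemma Im_inner_cvg (T : Type) (F : set_system T) {FF : Filter F} (f : T -> V) x y :
  (fun t => hnorm (f t - x)) @ F --> (0 : R) ->
  (fun t => Im (inner y (f t))) @ F --> Im (inner y x).
Proof.
move=> h; apply/cvgrPdist_le => e e0.
have /cvgrPdist_le : (fun t => hnorm y * hnorm (f t - x)) @ F --> (0 : R).
  by rewrite -(mulr0 (hnorm y)); apply: cvgM => //; exact: cvg_cst.
move=> /(_ _ e0); apply: filterS => t.
rewrite sub0r normrN ger0_norm ?mulr_ge0 ?hnorm_ge0//; apply: le_trans.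
by rewrite hnormB -ImB -innerBr Im_inner_le_hnorm.
Qed.

End InnerProduct.

Section BoundedOperators.
Context {R : realType} {U V : innerType R}.

Lemma opnorm_le (f : U -> V) (M : R) : 0 <= M ->
  (forall x, hnorm (f x) <= M * hnorm x) -> (opnorm f <= M%:E)%E.
Proof.
move=> M0 h; apply: ge_ereal_sup => _ [x /= x1 <-].
by rewrite lee_fin (le_trans (h x))// ler_piMr.
Qed.

Lemma opnorm_bound (f : {linear U -> V}) (M : R) : (opnorm f <= M%:E)%E ->
  forall x, hnorm (f x) <= M * hnorm x.
Proof.
move=> fM x; have [x0|x0] := eqVneq (hnorm x) 0.
  by rewrite x0 (hnorm0_eq0 x0) linear0 hnorm0 mulr0.
have xp : 0 < hnorm x by rewrite lt_def x0 hnorm_ge0.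
have : ((hnorm (f ((hnorm x)^-1%:C *: x)))%:E <= M%:E)%E.
  apply: le_trans fM; apply: ereal_sup_ubound; eexists; last by [].
  by rewrite /= hnormZR gtr0_norm ?invr_gt0// mulVf.
rewrite lee_fin linearZ /= hnormZR gtr0_norm ?invr_gt0//.
by rewrite ler_pdivrMl// mulrC.
Qed.

Lemma opnorm_ge0 (f : {linear U -> V}) : (0 <= opnorm f)%E.
Proof.
apply: ereal_sup_ubound; exists 0; rewrite /= ?hnorm0//.
by rewrite linear0 hnorm0.
Qed.

Lemma bounded_opP (f : {linear U -> V}) :
  bounded_op f <-> exists2 M : R, 0 <= M & forall x, hnorm (f x) <= M * hnorm x.
Proof.
split=> [|[M M0 h]]; last by apply: le_lt_trans (opnorm_le M0 h) _; rewrite ltry.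
rewrite /bounded_op; have := opnorm_ge0 f; have := @opnorm_bound f.
case: (opnorm f) => [M||]//= h; rewrite ?lee_fin => M0 _.
by exists M => //; exact: h.
Qed.

End BoundedOperators.

(** * The uniform boundedness principle *)

Section UniformBoundedness.
Context {R : realType} {V : hilbertType R} {W : innerType R}.

(** Because 2 v = (x + v) + (v - x), the two values cannot both be smaller than |T v|. Whatever
    point x has been reached, one of the two signs of the step v keeps the norm that v was chosen
    for. *)
Let hnormD_max (T : {linear V -> W}) (x v : V) :
  hnorm (T v) <= hnorm (T (x + v)) \/ hnorm (T v) <= hnorm (T (x - v)).
Proof.
have [|h1] := leP (hnorm (T v)) (hnorm (T (x + v))); first by left.
have [|h2] := leP (hnorm (T v)) (hnorm (T (x - v))); first by right.
exfalso.
have : hnorm (T (2%:R%:C *: v)) <= hnorm (T (x + v)) + hnorm (T (x - v)).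
  rewrite -(hnormN (T (x - v))) -linearN opprB.
  rewrite (_ : 2%:R%:C *: v = (x + v) + (v - x)).
    by rewrite linearD hnormD.
  by rewrite addrC addrA subrK raddfMn /= scaler_nat mulr2n.
rewrite linearZ /= hnormZR normr_nat.
by lra.
Qed.

(* Sokal's argument: a sequence of steps of sizes 3^-k, each almost norming an
   operator of norm at least 6 k 3^k, converges to a point where the family is
   unbounded. *)
Lemma uniform_boundedness (T : nat -> {linear V -> W}) :
  (forall n, bounded_op (T n)) ->
  (forall x, exists M : R, forall n, hnorm (T n x) <= M) ->
  exists M : R, forall n x, hnorm (T n x) <= M * hnorm x.
Proof.
move=> Tb Tp; apply: contrapT => hM.
have key (k : nat) : exists nv : nat * V * R, let: (n, v, N) := nv in
  [/\ hnorm v <= 1, 2 / 3 * N <= hnorm (T n v), 6 * 3 ^+ k * k%:R <= N &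
      forall x, hnorm (T n x) <= N * hnorm x].
  have [n hn] : exists n, ~ (opnorm (T n) <= (6 * 3 ^+ k * k%:R + 1)%:E)%E.
    apply: contrapT => hn; apply: hM; exists (6 * 3 ^+ k * k%:R + 1) => n x.
    by apply: opnorm_bound; apply: contrapT => h; apply: hn; exists n.
  have := Tb n; rewrite /bounded_op.
  have := @opnorm_bound R V W (T n); have := opnorm_ge0 (T n).
  case E : (opnorm (T n)) hn => [N||]//= /negP; rewrite -ltNge lte_fin => hN _ hb _.
  have Np : 0 < N.
    apply: le_lt_trans hN.
    by rewrite addr_ge0// mulr_ge0// mulr_ge0// exprn_ge0.
  have : ((2 / 3 * N)%:E < opnorm (T n))%E by rewrite E lte_fin; lra.
  move=> /ereal_sup_gt[_ [v /= v1 <-]]; rewrite lte_fin => hv.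
  exists (n, v, N); split => //; [exact: ltW|by lra|exact: hb].
have [f hf] := choice key.
pose n k := (f k).1.1; pose v k := (f k).1.2; pose N k := (f k).2.
have {}hf k : [/\ hnorm (v k) <= 1, 2 / 3 * N k <= hnorm (T (n k) (v k)),
    6 * 3 ^+ k * k%:R <= N k & forall x, hnorm (T (n k) x) <= N k * hnorm x].
  by have := hf k; rewrite /n /v /N; case: (f k) => -[].
pose r k : R := (3 ^+ k)^-1.
have r0 k : 0 < r k by rewrite invr_gt0 exprn_gt0.
have rS k : r k.+1 = r k / 3 by rewrite /r exprSr invfM.
pose step k x := if hnorm (T (n k) ((r k)%:C *: v k)) <= hnorm (T (n k) (x + (r k)%:C *: v k))
  then x + (r k)%:C *: v k else x - (r k)%:C *: v k.
pose x := fix x k := if k is k'.+1 then step k' (x k') else (0 : V).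
have stepT k y : r k * (2 / 3 * N k) <= hnorm (T (n k) (step k y)).
  have [_ h _ _] := hf k.
  have e1 : r k * (2 / 3 * N k) <= hnorm (T (n k) ((r k)%:C *: v k)).
    by rewrite linearZ /= hnormZR gtr0_norm// ler_pM2l.
  apply: (le_trans e1); rewrite /step; case: ifPn => //.
  by case: (hnormD_max (T (n k)) y ((r k)%:C *: v k)) => // ->.
have stepx k y : hnorm (step k y - y) <= r k.
  have [h _ _ _] := hf k.
  have e1 : hnorm ((r k)%:C *: v k) <= r k.
    by rewrite hnormZR gtr0_norm// ler_piMr// ltW.
  rewrite /step; case: ifP => _; first by rewrite addrC addKr.
  by rewrite addrAC subrr add0r hnormN.
(* Steps of ratio 1/3 add up to (r k - r (k + m)) / (1 - 1/3), hence the constant 3/2. *)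
have xd k m : hnorm (x (k + m)%N - x k) <= 3 / 2 * (r k - r (k + m)%N).
  elim: m => [|m ih]; first by rewrite addn0 !subrr hnorm0 mulr0.
  rewrite addnS -[_ - _](subrKA (x (k + m)%N)).
  apply: le_trans (hnormD _ _) _.
  have := stepx (k + m)%N (x (k + m)%N); rewrite -/(x (k + m).+1).
  have := rS (k + m)%N; rewrite {}/x/= in ih *.
  by move: ih; lra.
have xd' k m : hnorm (x (k + m)%N - x k) <= 3 / 2 * r k.
  by apply: le_trans (xd k m) _; have := r0 (k + m)%N; lra.
have r_cvg : r @ \oo --> 0.
  have := @cvg_geometric R 1 3^-1; rewrite ger0_norm ?invr_ge0// => h.
  apply: cvg_trans (h _); last by lra.
  by apply: near_eq_cvg; near=> k; rewrite /geometric /= mul1r exprVn.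
have [l xl] : exists l, (fun k => hnorm (x k - l)) @ \oo --> (0 : R).
  apply: hilbert_complete => eps eps0.
  have /cvgrPdist_lt/(_ (eps / 3))[] := r_cvg; first by lra.
  move=> K _ hK; exists K => a b Ka Kb.
  have := hK K (leqnn K); rewrite /= sub0r normrN gtr0_norm// => hr.
  have ha := xd' K (a - K)%N; have hb := xd' K (b - K)%N.
  rewrite !subnKC// in ha hb.
  rewrite -[_ - _](subrKA (x K)); apply: le_lt_trans (hnormD _ _) _.
  by rewrite (hnormB (x K)); lra.
have xl' k : hnorm (l - x k.+1) <= r k / 2.
  rewrite -(addr0 (_ / _)).
  have hc : (fun m => r k / 2 + hnorm (x m - l)) @ \oo --> r k / 2 + 0.
    by apply: cvgD => //; exact: cvg_cst.
  rewrite -(cvg_lim _ hc)//; apply: limr_ge; first by apply/cvg_ex; eexists; exact: hc.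
  near=> m; have km : (k.+1 <= m)%N by near: m; exists k.+1.
  rewrite -[l - _](subrKA (x m)) addrC.
  apply: le_trans (hnormD _ _) _; rewrite (hnormB l) lerD2r.
  by have := xd' k.+1 (m - k.+1)%N; rewrite subnKC// rS; lra.
have [M hMl] := Tp l.
have [k hk] : exists k : nat, M < k%:R.
  by exists (Num.truncn M).+1; exact: truncnS_gt.
have [_ _ h2 h3] := hf k.
have := hMl (n k); apply/negP; rewrite -ltNge; apply: lt_le_trans hk _.
have h4 := stepT k (x k); rewrite -/(x k.+1) in h4.
(* All later steps together move the point by at most r k / 2. Of the 2/3 r k N k reached at step k
   at least (2/3 - 1/2) r k N k survives at the limit, and the factor 6 in [key] makes this at least
   k. *)
have h5 : hnorm (T (n k) (x k.+1)) <= hnorm (T (n k) l) + N k * (r k / 2).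
  rewrite -[x k.+1](subrK l) addrC linearD; apply: le_trans (hnormD _ _) _.
  rewrite lerD2l; apply: le_trans (h3 _) _; rewrite hnormB.
  rewrite ler_wpM2l//; apply: le_trans h2.
  by rewrite !mulr_ge0// exprn_ge0.
have h6 : k%:R <= r k * N k / 6.
  have -> : (k%:R : R) = r k * (6 * 3 ^+ k * k%:R) / 6.
    by rewrite /r; field; rewrite expf_neq0.
  by rewrite ler_pM2r// ler_pM2l.
by lra.
Unshelve. all: by end_near. Qed.

End UniformBoundedness.

(** * Orthonormal bases and diagonal operators *)

Section Bessel.
Context {R : realType} {V : innerType R} {I : choiceType}.
Variable e : I -> V.
Hypothesis orthoe : forall i j, inner (e i) (e j) = (i == j)%:R.
Implicit Types (r : seq I) (x : V).

Definition fproj r x : V := \sum_(i <- r) inner (e i) x *: e i.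

Lemma inner_comb r (c : I -> R[i]) j : uniq r ->
  inner (e j) (\sum_(i <- r) c i *: e i) = if j \in r then c j else 0.
Proof.
move=> ur; rewrite inner_sumr.
rewrite (eq_bigr (fun i => if i == j then c i else 0)); last first.
  by move=> i _; rewrite innerZr orthoe eq_sym; case: eqP; rewrite ?mulr1 ?mulr0.
case: ifPn => jr.
  rewrite (bigD1_seq j)//= eqxx big1 ?addr0// => i /negPf ->.
  by [].
rewrite big_seq big1// => i ir; case: eqP => // ij.
by rewrite -ij ir in jr.
Qed.

Lemma normsq_comb r (c : I -> R[i]) : uniq r ->
  normsq (\sum_(i <- r) c i *: e i) = \sum_(i <- r) sqmod (c i).
Proof.
move=> ur; set x := \sum_(i <- r) _; rewrite /normsq {2}/x inner_sumr big_seq.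
rewrite (eq_bigr (fun i => (sqmod (c i))%:C)) => [|i ir].
  by rewrite -big_seq -rmorph_sum.
by rewrite innerZr inner_conj inner_comb// ir sqmodE.
Qed.

Lemma inner_fproj r j x : uniq r ->
  inner (e j) (fproj r x) = if j \in r then inner (e j) x else 0.
Proof. exact: inner_comb. Qed.

Lemma normsq_fproj r x : uniq r ->
  normsq (fproj r x) = \sum_(i <- r) sqmod (inner (e i) x).
Proof. exact: normsq_comb. Qed.

Lemma normsqB_fproj r x : uniq r ->
  normsq (x - fproj r x) = normsq x - \sum_(i <- r) sqmod (inner (e i) x).
Proof.
move=> ur; rewrite normsqB normsq_fproj//.
suff -> : inner x (fproj r x) = (\sum_(i <- r) sqmod (inner (e i) x))%:C.
  by rewrite /=; ring.
rewrite inner_sumr rmorph_sum; apply: eq_bigr => i _.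
by rewrite innerZr (inner_conj (e i)) sqmodE.
Qed.

Lemma bessel r x : uniq r -> \sum_(i <- r) sqmod (inner (e i) x) <= normsq x.
Proof. by move=> /(normsqB_fproj x) h; rewrite -subr_ge0 -h normsq_ge0. Qed.

Lemma fproj_sub r u x : uniq r -> uniq u -> {subset r <= u} ->
  fproj r (fproj u x) = fproj r x.
Proof.
move=> ur uu ru; rewrite /fproj big_seq [RHS]big_seq; apply: eq_bigr => i ir.
by rewrite inner_fproj// ru.
Qed.

End Bessel.

Section Parseval.
Context {R : realType} {V : hilbertType R} {I : choiceType}.
Variable e : I -> V.
Hypothesis basise : orthonormal_basis e.

Let orthoe : forall i j, inner (e i) (e j) = (i == j)%:R := basise.1.

(** Bases are given by maximality, so the expansion has to be constructed: projections whose
    coefficient sums approach the supremum of the Bessel sums form a Cauchy sequence, and its limit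
    has the coefficients of x, hence equals x. *)
Theorem parseval (x : V) :
  (\esum_(i in [set: I]) (sqmod (inner (e i) x))%:E = (normsq x)%:E)%E.
Proof.
pose S r := \sum_(i <- r) sqmod (inner (e i) x).
pose A : set R := [set S r | r in [set r | uniq r]].
have A0 : A !=set0 by exists (S [::]), [::].
have Aub : ubound A (normsq x) by move=> _ [r /= ur <-]; exact: bessel.
have supA : has_sup A by split => //; exists (normsq x).
have le_sup r : uniq r -> S r <= sup A.
  by move=> ur; apply: sup_ubound; [exact: supA.2|exists r].
have -> : (\esum_(i in [set: I]) (sqmod (inner (e i) x))%:E = (sup A)%:E)%E.
  apply/eqP; rewrite eq_le; apply/andP; split.
    apply: ge_ereal_sup => _ [F [finF _] <-].
    by rewrite fsbig_finite//= sumEFin lee_fin; exact: le_sup.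
  rewrite -ereal_sup_EFin//; last by exists (normsq x).
  apply: ge_ereal_sup => _ [_ [r /= ur <-] <-].
  apply: esum_ge; exists [set` r]; first by split => //; exact: finite_seq.
  by rewrite -fsbig_seq// sumEFin.
congr EFin; apply/eqP; rewrite eq_le; apply/andP; split.
  exact: ge_sup.
have key n : exists r, uniq r /\ sup A - n.+1%:R^-1 < S r.
  have /sup_adherent /(_ supA) : 0 < n.+1%:R^-1 :> R by rewrite invr_gt0.
  by move=> [_ [r ur <-] h]; exists r.
have [r hr] := choice key.
have ur n : uniq (r n) by case: (hr n).
have rS n : sup A - S (r n) < n.+1%:R^-1 by rewrite ltrBlDr -ltrBlDl; case: (hr n).
pose y n := fproj e (r n) x.
(* The squared distance is the coefficient sum over u minus that over [r n], hence at most the gap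
   to the supremum. *)
have near_y u n : uniq u -> {subset r n <= u} ->
    normsq (fproj e u x - y n) <= n.+1%:R^-1.
  move=> uu sub; rewrite /y -(fproj_sub orthoe x (ur n) uu sub).
  rewrite normsqB_fproj// normsq_fproj//.
  rewrite (_ : \sum_(i <- r n) _ = S (r n)); last first.
    rewrite /S big_seq [RHS]big_seq; apply: eq_bigr => i ir.
    by rewrite inner_fproj// sub.
  by apply: le_trans (ltW (rS n)); rewrite lerD2r; exact: le_sup.
have inv0 : (fun n => n.+1%:R^-1 : R) @ \oo --> (0 : R) by exact: cvg_harmonic.
have [l yl] : exists l, (fun n => hnorm (y n - l)) @ \oo --> (0 : R).
  apply: hilbert_complete => eps eps0.
  have : 0 < eps ^+ 2 / 4 by rewrite divr_gt0// exprn_gt0.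
  move/cvgrPdist_lt : inv0 => /[apply] -[N _ hN].
  exists N => m n Nm Nn.
  have := hN m Nm; have := hN n Nn; rewrite /= !sub0r !normrN !gtr0_norm ?invr_gt0//.
  move=> hn hm; rewrite -(@ltr_pXn2r _ 2%N)// ?nnegrE ?hnorm_ge0//; last exact: ltW.
  pose u := undup (r m ++ r n).
  rewrite hnorm_sq -[_ - _](subrKA (fproj e u x)).
  apply: le_lt_trans (normsqD_le _ _) _.
  have h1 : normsq (y m - fproj e u x) <= m.+1%:R^-1.
    rewrite -normsqN opprB; apply: near_y; first exact: undup_uniq.
    by move=> i ir; rewrite mem_undup mem_cat ir.
  have h2 : normsq (fproj e u x - y n) <= n.+1%:R^-1.
    apply: near_y; first exact: undup_uniq.
    by move=> i ir; rewrite mem_undup mem_cat ir orbT.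
  by have := le_lt_trans h1 hm; have := le_lt_trans h2 hn; clear; lra.
have xl : x = l.
  apply/subr0_eq; apply: basise.2 => i.
  apply/eqP; rewrite -sqmod_eq0 eq_le sqmod_ge0 andbT.
  have step n : sqmod (inner (e i) (x - l)) <=
      2 * n.+1%:R^-1 + 2 * normsq (y n - l).
    rewrite -(subrKA (y n)) innerDr; apply: le_trans (sqmodD_le _ _) _.
    apply: lerD; rewrite ler_pM2l//; last first.
      by apply: le_trans (CauchySchwarz _ _) _; rewrite /normsq orthoe eqxx mul1r.
    rewrite innerBr inner_fproj//; case: ifPn => ir; first by rewrite subrr sqmod0.
    (* An index outside [r n] has a small coefficient, because adding it still leaves the sum below
       the supremum. *)
    rewrite subr0; have : S (i :: r n) <= sup A by apply: le_sup; rewrite /= ir ur.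
    rewrite {1}/S big_cons -/(S _) => h; have := rS n; move: (_^-1) h => ?; lra.
  have lim0 : (fun n => 2 * n.+1%:R^-1 + 2 * normsq (y n - l)) @ \oo --> (0 : R).
    rewrite (_ : 0 = 2 * 0 + 2 * 0)//; last by rewrite mulr0 addr0.
    apply: cvgD; apply: cvgM => //; try exact: cvg_cst.
    exact: hnorm_cvg0.
  rewrite -(cvg_lim _ lim0)//; apply: limr_ge; first by apply/cvg_ex; eexists; exact: lim0.
  by near=> n; exact: step.
have lim2 : (fun n => sup A + normsq (x - y n)) @ \oo --> sup A + 0.
  apply: (cvgD (cvg_cst _)); rewrite xl.
  apply: (cvg_trans _ (hnorm_cvg0 yl)); apply: near_eq_cvg.
  by near=> n; rewrite -normsqN opprB.
rewrite -[leRHS]addr0 -(cvg_lim _ lim2)//; apply: limr_ge; first by apply/cvg_ex; eexists; exact: lim2.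
near=> n; have := normsqB_fproj orthoe x (ur n); rewrite -/(y n) -/(S _) => ->.
by have := le_sup _ (ur n); lra.
Unshelve. all: by end_near. Qed.

End Parseval.

Lemma exchange_esum {R : realType} {I J : choiceType} (a : I -> J -> \bar R) :
  (forall i j, 0 <= a i j)%E ->
  (\esum_(i in [set: I]) \esum_(j in [set: J]) a i j =
   \esum_(j in [set: J]) \esum_(i in [set: I]) a i j)%E.
Proof.
move=> a0; rewrite !esum_esum//.
rewrite (reindex_esum ([set: J] `*`` fun=> [set: I]) _ (fun x => (x.2, x.1)))//.
split=> //=.
  by move=> [i1 i2] [j1 j2] /= _ _ [] -> ->.
by move=> [i1 i2] _ /=; exists (i2, i1).
Qed.

Section CountableBasis.
Context {R : realType} {V : hilbertType R}.
Variable e : nat -> V.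
Hypothesis basise : orthonormal_basis e.
Implicit Types x y : V.

Let orthoe : forall i j, inner (e i) (e j) = (i == j)%:R := basise.1.

Lemma normsq_basis n : normsq (e n) = 1.
Proof. by rewrite /normsq orthoe eqxx. Qed.

Lemma basis_ext x y : (forall n, inner (e n) x = inner (e n) y) -> x = y.
Proof.
by move=> h; apply/subr0_eq/basise.2 => n; rewrite innerBr h subrr.
Qed.

Lemma parseval_series x :
  (\sum_(0 <= n <oo) (sqmod (inner (e n) x))%:E = (normsq x)%:E)%E.
Proof.
rewrite -(parseval basise) nneseries_esumT// => n.
by rewrite lee_fin sqmod_ge0.
Qed.

Definition fpart n x := fproj e (index_iota 0 n) x.

Lemma cvg_parseval x :
  (fun n => \sum_(0 <= i < n) sqmod (inner (e i) x)) @ \oo --> normsq x.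
Proof.
have h : (fun n => \sum_(0 <= i < n) (sqmod (inner (e i) x))%:E)%E @ \oo --> (normsq x)%:E.
  rewrite -parseval_series; apply: is_cvg_nneseries => n _ _.
  by rewrite lee_fin sqmod_ge0.
apply: cvg_trans (fine_cvg h); apply: near_eq_cvg.
by near=> n; rewrite /= sumEFin.
Unshelve. all: by end_near. Qed.

Lemma cvg_fpart x : (fun n => normsq (x - fpart n x)) @ \oo --> (0 : R).
Proof.
under eq_fun do rewrite normsqB_fproj ?iota_uniq//.
apply: (@cvg_trans _ (nbhs (normsq x - normsq x))); last by rewrite subrr.
by apply: cvgB; [exact: cvg_cst|exact: cvg_parseval].
Qed.

Lemma normsq_le_coef x (B : R) :
  (forall n, \sum_(0 <= i < n) sqmod (inner (e i) x) <= B) -> normsq x <= B.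
Proof.
move=> h; have hc := @cvg_parseval x.
rewrite -(cvg_lim _ hc)//; apply: limr_le; first by apply/cvg_ex; eexists; exact: hc.
by apply: nearW.
Qed.

(** Riesz-Fischer: squared distances between partial sums are differences of a bounded nondecreasing
    sequence. *)
Lemma synthesis (c : nat -> R[i]) (B : R) :
  (forall n, \sum_(0 <= i < n) sqmod (c i) <= B) ->
  exists x, forall n, inner (e n) x = c n.
Proof.
move=> hB; pose S n := \sum_(0 <= i < n) sqmod (c i).
have Scvg : cvgn S.
  apply: nondecreasing_is_cvgn; last by exists B => _ [n _ <-]; exact: hB.
  apply/nondecreasing_seqP => n.
  by rewrite /S big_nat_recr//= lerDl sqmod_ge0.
pose y n := \sum_(i <- index_iota 0 n) c i *: e i.
have yd (m n : nat) : (n <= m)%N -> normsq (y m - y n) = S m - S n.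
  move=> nm; rewrite /y /S !(big_cat_nat (leq0n n) nm)/= addrAC subrr add0r addrAC subrr add0r.
  by rewrite normsq_comb// iota_uniq.
have [l yl] : exists l, (fun n => hnorm (y n - l)) @ \oo --> (0 : R).
  apply: hilbert_complete => eps eps0.
  have e2 : 0 < eps ^+ 2 / 2 by rewrite divr_gt0// exprn_gt0.
  move/cvgrPdist_lt : Scvg => /(_ _ e2)[N _ hN].
  exists N => m n Nm Nn.
  have := hN m Nm; have := hN n Nn; rewrite /= !ltr_norml => /andP[h1 h2] /andP[h3 h4].
  rewrite -(@ltr_pXn2r _ 2%N)// ?nnegrE ?hnorm_ge0//; last exact: ltW.
  rewrite hnorm_sq; have [nm|/ltnW mn] := leqP n m.
    by rewrite yd//; lra.
  by rewrite -normsqN opprB yd//; lra.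
exists l => n; apply/subr0_eq/eqP.
rewrite -sqmod_eq0 eq_le sqmod_ge0 andbT.
have hc : (fun m => normsq (y m - l)) @ \oo --> (0 : R) by exact: hnorm_cvg0.
rewrite -(cvg_lim _ hc)//; apply: limr_ge; first by apply/cvg_ex; eexists; exact: hc.
near=> m; have nm : (n < m)%N by near: m; exists n.+1.
have := CauchySchwarz (e n) (y m - l).
rewrite normsq_basis mul1r innerBr inner_comb ?iota_uniq//.
by rewrite mem_index_iota nm -sqmodN opprB.
Unshelve. all: by end_near. Qed.

(** By continuity it suffices to evaluate on the finite sums [fpart]. This carries identities known
    on basis vectors, such as adjoint formulas or the values of a bounded operator, to the whole
    space. *)
Lemma bounded_functional_eq0 (phi : V -> R[i]) (M : R) :
  (forall x y, phi (x + y) = phi x + phi y) ->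
  (forall a x, phi (a *: x) = a * phi x) ->
  (forall x, sqmod (phi x) <= M * normsq x) ->
  (forall n, phi (e n) = 0) -> forall x, phi x = 0.
Proof.
move=> phiD phiZ phiM phi0 x.
have phi00 : phi 0 = 0 by rewrite -(scale0r 0) phiZ mul0r.
have hp n : phi (fpart n x) = 0.
  rewrite /fpart /fproj (big_morph phi phiD phi00) big1// => i _.
  by rewrite phiZ phi0 mulr0.
apply/eqP; rewrite -sqmod_eq0 eq_le sqmod_ge0 andbT.
have hc : (fun n => M * normsq (x - fpart n x)) @ \oo --> M * 0.
  by apply: cvgM; [exact: cvg_cst|exact: cvg_fpart].
rewrite -(mulr0 M) -(cvg_lim _ hc)//; apply: limr_ge; first by apply/cvg_ex; eexists; exact: hc.
apply: nearW => n; apply: le_trans (phiM _).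
by rewrite phiD -scaleN1r phiZ hp mulr0 addr0.
Qed.

Definition bounded_seq (m : nat -> R[i]) := exists M : R, forall n, sqmod (m n) <= M.

Let clip (m : nat -> R[i]) n : R[i] := if `[< bounded_seq m >] then m n else 0.

Let clip_bounded m : exists2 M : R, 0 <= M & forall n, sqmod (clip m n) <= M.
Proof.
rewrite /clip; case: asboolP => [[M hM]|_]; last by exists 0 => // n; rewrite sqmod0.
by exists M => //; apply: le_trans (hM 0%N); exact: sqmod_ge0.
Qed.

Let diag_exists m :
  exists f : V -> V, forall x n, inner (e n) (f x) = clip m n * inner (e n) x.
Proof.
suff /choice[f hf] : forall x, exists y, forall n, inner (e n) y = clip m n * inner (e n) x.
  by exists f.
move=> x; have [M M0 hM] := clip_bounded m.
apply: (@synthesis _ (M * normsq x)) => n.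
apply: (@le_trans _ _ (M * \sum_(0 <= i < n) sqmod (inner (e i) x))).
  rewrite mulr_sumr; apply: ler_sum => i _.
  by rewrite sqmodM ler_wpM2r// sqmod_ge0.
by rewrite ler_wpM2l//; apply: bessel => //; exact: iota_uniq.
Qed.

(* The junk value for an unbounded m is the zero operator. *)
Definition diag m : V -> V := sval (cid (diag_exists m)).

Let diagE m x n : inner (e n) (diag m x) = clip m n * inner (e n) x.
Proof. exact: (svalP (cid (diag_exists m))). Qed.

Let diag_linear m : linear (diag m).
Proof.
move=> a x y; apply: basis_ext => n.
by rewrite innerDr innerZr !diagE innerDr innerZr mulrDr mulrCA.
Qed.

HB.instance Definition _ m := GRing.isLinear.Build R[i] V V _ (diag m) (diag_linear m).

Lemma inner_diag m x n : bounded_seq m ->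
  inner (e n) (diag m x) = m n * inner (e n) x.
Proof. by move=> bm; rewrite diagE /clip asboolT. Qed.

Lemma diag_basis m n : bounded_seq m -> diag m (e n) = m n *: e n.
Proof.
move=> bm; apply: basis_ext => k; rewrite inner_diag// innerZr orthoe.
by case: eqP => [->//|_]; rewrite !mulr0.
Qed.

Lemma normsq_diag_le m (M : R) x : (forall n, sqmod (m n) <= M) ->
  normsq (diag m x) <= M * normsq x.
Proof.
move=> hM; have M0 : 0 <= M by apply: le_trans (hM 0%N); exact: sqmod_ge0.
apply: normsq_le_coef => n.
apply: (@le_trans _ _ (M * \sum_(0 <= i < n) sqmod (inner (e i) x))).
  rewrite mulr_sumr; apply: ler_sum => i _.
  by rewrite inner_diag; [rewrite sqmodM ler_wpM2r// sqmod_ge0|exists M].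
by rewrite ler_wpM2l//; apply: bessel => //; exact: iota_uniq.
Qed.

Lemma hnorm_diag_le m (M : R) x : 0 <= M -> (forall n, sqmod (m n) <= M ^+ 2) ->
  hnorm (diag m x) <= M * hnorm x.
Proof.
move=> M0 hM; rewrite hnorm_leR ?mulr_ge0 ?hnorm_ge0//.
by rewrite exprMn hnorm_sq normsq_diag_le.
Qed.

Lemma diag_bounded m : bounded_op (diag m).
Proof.
apply/bounded_opP; have [M M0 hM] := clip_bounded m.
exists (Num.sqrt M) => [|x]; first exact: sqrtr_ge0.
rewrite hnorm_leR ?mulr_ge0 ?sqrtr_ge0 ?hnorm_ge0//.
rewrite exprMn hnorm_sq sqr_sqrtr//.
apply: normsq_le_coef => n.
apply: (@le_trans _ _ (M * \sum_(0 <= i < n) sqmod (inner (e i) x))).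
  rewrite mulr_sumr; apply: ler_sum => i _.
  by rewrite diagE sqmodM ler_wpM2r// sqmod_ge0.
by rewrite ler_wpM2l//; apply: bessel => //; exact: iota_uniq.
Qed.

Lemma bounded_seqM m m' : bounded_seq m -> bounded_seq m' ->
  bounded_seq (fun n => m n * m' n).
Proof.
move=> [M hM] [M' hM']; exists (M * M') => n.
by rewrite sqmodM ler_pM ?sqmod_ge0.
Qed.

Lemma bounded_seqD m m' : bounded_seq m -> bounded_seq m' ->
  bounded_seq (fun n => m n + m' n).
Proof.
move=> [M hM] [M' hM']; exists (2 * M + 2 * M') => n.
apply: le_trans (sqmodD_le _ _) _.
by have := hM n; have := hM' n; lra.
Qed.

Lemma bounded_seq_conj m : bounded_seq m -> bounded_seq (fun n => (m n)^*%C).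
Proof. by move=> [M hM]; exists M => n; rewrite sqmod_conj. Qed.

Lemma diag_comp m m' x : bounded_seq m -> bounded_seq m' ->
  diag m (diag m' x) = diag (fun n => m n * m' n) x.
Proof.
move=> bm bm'; apply: basis_ext => n; rewrite !inner_diag ?mulrA//.
exact: bounded_seqM.
Qed.

Lemma diag_adjoint m x y : bounded_seq m ->
  inner y (diag m x) = inner (diag (fun n => (m n)^*%C) y) x.
Proof.
move=> bm; apply/subr0_eq; have bm' := bounded_seq_conj bm.
have [M M0 hM] := (bounded_opP (diag m)).1 (diag_bounded m).
set y' := diag _ y.
apply: (@bounded_functional_eq0 (fun x => inner y (diag m x) - inner y' x)
  (2 * normsq y * M ^+ 2 + 2 * normsq y')).
- by move=> u v; rewrite linearD !innerDr; ring.
- by move=> a u; rewrite linearZ !innerZr mulrBr.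
- move=> u; apply: le_trans (sqmodD_le _ _) _; rewrite sqmodN [leRHS]mulrDl.
  apply: lerD; rewrite -?mulrA ler_pM2l//; last exact: CauchySchwarz.
  apply: le_trans (CauchySchwarz _ _) _; rewrite ler_wpM2l ?normsq_ge0//.
  rewrite -!hnorm_sq mulrA -expr2 -exprMn.
  rewrite (@ler_pXn2r _ 2%N)// ?nnegrE ?mulr_ge0 ?hnorm_ge0//; exact: hM.
- move=> n; rewrite diag_basis// innerZr (inner_conj (e n)) (inner_conj (e n) y').
  by rewrite inner_diag// rmorphM /= conjcK subrr.
Qed.

(** Multipliers such as those of a semigroup do not converge uniformly in the mode. The vector is
    therefore split: finitely many modes converge one by one, and the common bound M controls the
    remainder, whose norm is small. Strong continuity and generators of diagonal semigroups come
    from here. *)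
Lemma cvg_diag0 (T : Type) (F : set_system T) {FF : Filter F}
    (m : T -> nat -> R[i]) (M : R) x :
  (\forall t \near F, forall n, sqmod (m t n) <= M) ->
  (forall n, (fun t => sqmod (m t n)) @ F --> (0 : R)) ->
  (fun t => hnorm (diag (m t) x)) @ F --> (0 : R).
Proof.
move=> mM m0; apply: normsq_cvg0; apply/cvgrPdist_le => eps eps0.
have M1 : 0 < `|M| + 1 by rewrite ltr_wpDl.
have e4 : 0 < eps / (4 * (`|M| + 1)) by rewrite divr_gt0// mulr_gt0.
have /cvgrPdist_le/(_ _ e4)[N _ /(_ N (leqnn _))] := @cvg_fpart x.
rewrite sub0r normrN ger0_norm ?normsq_ge0// => hN.
have : (fun t => \sum_(0 <= i < N) sqmod (m t i) * sqmod (inner (e i) x)) @ F --> (0 : R).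
  have hs : \sum_(0 <= i < N) 0 * sqmod (inner (e i) x) = 0.
    by rewrite big1// => i _; rewrite mul0r.
  apply: (@cvg_trans _ (nbhs (\sum_(0 <= i < N) 0 * sqmod (inner (e i) x)))).
    2: by rewrite hs.
  apply: (@cvg_big R nat +%R 0 xpredT _ T F _ (fun i t => sqmod (m t i) *
    sqmod (inner (e i) x)) (fun i => 0 * sqmod (inner (e i) x))) => [|i _].
    exact: add_continuous.
  apply: cvgM; first exact: m0.
  exact: cvg_cst.
have e2 : 0 < eps / 4 by rewrite divr_gt0.
move=> /cvgrPdist_le/(_ _ e2); apply: filterS2 mM => t mM.
rewrite !sub0r !normrN !ger0_norm ?normsq_ge0//; last first.
  by apply: sumr_ge0 => i _; rewrite mulr_ge0 ?sqmod_ge0.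
move=> ht; rewrite -[x](subrK (fpart N x)) addrC linearD.
apply: le_trans (normsqD_le _ _) _.
have h1 : normsq (diag (m t) (fpart N x)) <= eps / 4.
  apply: le_trans ht; rewrite le_eqVlt; apply/orP; left; apply/eqP.
  rewrite /fpart /fproj linear_sum.
  rewrite (eq_bigr (fun i => (m t i * inner (e i) x) *: e i)).
    by rewrite normsq_comb ?iota_uniq//; apply: eq_bigr => i _; rewrite sqmodM.
  move=> i _; rewrite linearZ /= diag_basis; last by exists M.
  by rewrite scalerA mulrC.
have h2 : normsq (diag (m t) (x - fpart N x)) <= eps / 4.
  apply: le_trans (@normsq_diag_le _ M _ mM) _.
  apply: (@le_trans _ _ ((`|M| + 1) * normsq (x - fpart N x))).
    rewrite ler_wpM2r ?normsq_ge0//.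
    by have := ler_norm M; lra.
  move: hN; rewrite -(ler_pM2l M1) => /le_trans; apply.
  rewrite le_eqVlt; apply/orP; left; apply/eqP; field.
  by rewrite gt_eqF.
by move: h1 h2; lra.
Qed.

(** The multiplier by the square root of m is self-adjoint, so the quadratic form is the squared
    norm of its value at x, and Parseval applies. *)
Lemma diag_energy (m : nat -> R) x : (forall n, 0 <= m n) ->
  bounded_seq (fun n => (m n)%:C) ->
  (\sum_(0 <= n <oo) (m n * sqmod (inner (e n) x))%:E =
   (Re (inner x (diag (fun n => (m n)%:C) x)))%:E)%E.
Proof.
move=> m0 bm; pose r n := (Num.sqrt (m n))%:C.
have br : bounded_seq r.
  (* The bound rests on m <= m^2 + 1. *)
  case: bm => M hM; exists (M + 1) => n; have := hM n; rewrite !sqmodR sqr_sqrtr//.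
  by have := sqr_ge0 (m n - 1); rewrite !expr2; have := m0 n; nra.
have -> : diag (fun n => (m n)%:C) x = diag r (diag r x).
  rewrite diag_comp//; congr (diag _ x); apply/funext => n.
  by rewrite /r -rmorphM /= -expr2 sqr_sqrtr.
rewrite diag_adjoint//.
rewrite (_ : (fun n => (r n)^*%C) = r); last by apply/funext => n; rewrite conjc_real.
rewrite -/(normsq _) -parseval_series; apply: eq_eseriesr => n _.
by rewrite inner_diag// sqmodM sqmodR sqr_sqrtr.
Qed.

(** Independence of the basis f: after expansion in e the two nonnegative sums are exchanged, and
    Parseval for f applied to sqrt (m n) e_n leaves m n. *)
Lemma trace_diag (m : nat -> R) : (forall n, 0 <= m n) ->
  bounded_seq (fun n => (m n)%:C) ->
  is_trace (diag (fun n => (m n)%:C)) (\sum_(0 <= n <oo) (m n)%:E)%E.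
Proof.
move=> m0 bm I f basisf.
have a0 i n : (0 <= (m n * sqmod (inner (e n) (f i)))%:E)%E.
  by rewrite lee_fin mulr_ge0 ?sqmod_ge0.
rewrite (eq_esum (b := fun i => \esum_(n in [set: nat])
    (m n * sqmod (inner (e n) (f i)))%:E)%E); last first.
  by move=> i _; rewrite -diag_energy// nneseries_esumT.
rewrite exchange_esum// nneseries_esumT; last by move=> n; rewrite lee_fin.
apply: eq_esum => n _.
have := parseval basisf ((Num.sqrt (m n))%:C *: e n).
rewrite normsqZ normsq_basis mulr1 sqmodR sqr_sqrtr// => <-.
apply: eq_esum => i _; congr EFin.
by rewrite innerZr sqmodM sqmodR sqr_sqrtr// (inner_conj (e n)) sqmod_conj.
Qed.

End CountableBasis.

(** * Completeness of the space of square integrable functions *)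

Section IntegralComplements.
Context {d : measure_display} {T : measurableType d} {R : realType}.
Variable mu : {measure set T -> \bar R}.

(* The integral of a nonnegative function is a supremum over the simple
   functions below it, so monotonicity needs no measurability. *)
Lemma le_lower_integral (D : set T) (f g : T -> \bar R) :
  (forall x, D x -> 0 <= f x)%E -> (forall x, D x -> f x <= g x)%E ->
  (\int[mu]_(x in D) f x <= \int[mu]_(x in D) g x)%E.
Proof.
move=> f0 fg; rewrite !(integral_mkcond D).
have f0' x : (0 <= (f \_ D) x)%E by apply: erestrict_ge0.
have fg' x : ((f \_ D) x <= (g \_ D) x)%E by apply: lee_restrict.
rewrite !ge0_integralTE//; last by move=> x; apply: le_trans (fg' x).
apply: le_ereal_sup => _ [h /= hf <-]; exists h => //= x.
exact: le_trans (hf x) (fg' x).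
Qed.

End IntegralComplements.

Section SquareIntegrable.
Context {R : realType}.
Local Notation L2 := (L2T R).
Local Notation arc := (@Defs.arc R).
Local Notation mu := (@lebesgue_measure R).
Implicit Types (x y z : L2).

Lemma measurable_arcR : measurable (arc : set (measurableTypeR R)).
Proof. exact: measurable_itv. Qed.
#[local] Hint Resolve measurable_arcR : core.

Lemma cmeasurable_sqint (f : R -> R[i]) D : sqint f -> cmeasurable D f.
Proof. by move=> [_ [m1 m2] _]; split; exact: measurable_funTS. Qed.

Lemma cmeasurable_L2 x D : cmeasurable D x.
Proof. exact/cmeasurable_sqint/sqint_L2. Qed.

Lemma cmeasurableB D (f g : R -> R[i]) :
  cmeasurable D f -> cmeasurable D g -> cmeasurable D (fun t => f t - g t).
Proof.
move=> mf mg; have := cmeasurableD mf (cmeasurableM (cmeasurable_cst D (-1)) mg).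
by congr cmeasurable; apply/funext => t; rewrite mulN1r.
Qed.

Lemma normsqL2E x : ((normsq x)%:E = \int[mu]_(t in arc) (sqmod (x t))%:E)%E.
Proof.
rewrite /normsq [inner x x]innerL2E /= /Rintegral fineK//.
by apply: integrable_fin_num => //; case: (sqint_L2 x).
Qed.

Lemma normsqL2_ae x (f : R -> R[i]) : cmeasurable arc f -> aeq x f ->
  ((normsq x)%:E = \int[mu]_(t in arc) (sqmod (f t))%:E)%E.
Proof.
move=> mf xf; rewrite normsqL2E; apply: ge0_ae_eq_integral => //.
- by apply/measurable_EFinP; apply: measurable_sqmod; exact: cmeasurable_L2.
- by apply/measurable_EFinP; exact: measurable_sqmod.
- by move=> t _; rewrite lee_fin sqmod_ge0.
- by move=> t _; rewrite lee_fin sqmod_ge0.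
- by apply: filterS xf => t h At; rewrite h.
Qed.

Lemma L2oppE x : aeq (- x : L2) (fun t => - x t).
Proof.
rewrite -scaleN1r; apply: aeq_trans (L2scaleE _ _) _.
by apply: aeW => t _; rewrite mulN1r.
Qed.

Lemma L2subE x y : aeq (x - y : L2) (fun t => x t - y t).
Proof.
apply: aeq_trans (L2addE _ _) _.
by apply: filterS (L2oppE y) => t h At; rewrite h.
Qed.

(** Adding 2 C / 2^k, a bound on all steps from k on, makes the sequence nonincreasing and bounded
    below, so that monotone convergence applies. *)
Lemma geometric_steps_cvg (w : nat -> R) (C : R) :
  (forall k, `|w k.+1 - w k| <= C * (2 ^+ k)^-1) -> cvgn w.
Proof.
move=> hw; pose r k : R := (2 ^+ k)^-1.
have rS k : r k.+1 = r k / 2 by rewrite /r exprSr invfM.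
have r0 k : 0 < r k by rewrite invr_gt0 exprn_gt0.
have r_cvg : r @ \oo --> 0.
  have := @cvg_geometric R 1 2^-1; rewrite ger0_norm ?invr_ge0// => h.
  apply: cvg_trans (h _); last by lra.
  by apply: near_eq_cvg; near=> k; rewrite /geometric /= mul1r exprVn.
have step k : - (C * r k) <= w k.+1 - w k <= C * r k.
  by rewrite -ler_norml; exact: hw.
have h1 : cvgn (fun k => w k + 2 * C * r k).
  apply: nonincreasing_is_cvgn.
    apply/nonincreasing_seqP => k; rewrite rS.
    by have /andP[] := step k; lra.
  exists (w 0%N - 2 * C * r 0%N) => _ [n _ <-].
  have C0 : 0 <= C * r n by apply: le_trans (hw n).
  suff h2 : w 0%N - 2 * C * r 0%N <= w n - 2 * C * r n by lra.
  elim: n {C0} => // n; rewrite rS.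
  by have /andP[] := step n; lra.
have h2 : cvgn (fun k => 2 * C * r k) by apply: is_cvgMr; apply/cvg_ex; exists 0.
have -> : w = (fun k => (w k + 2 * C * r k) - 2 * C * r k).
  by apply/funext => k; rewrite addrK.
exact: is_cvgB h1 h2.
Unshelve. all: by end_near. Qed.

(** A subsequence with steps of norm at most 4^-k leaves room for a weight: the sum G of 4^k |v
    (k+1) - v k|^2 is integrable, hence finite almost everywhere, and there the steps are at most
    sqrt G / 2^k. This yields a pointwise limit; Fatou's lemma then turns it into a limit in
    norm. *)
Theorem L2_complete (u : nat -> L2) :
  (forall eps : R, 0 < eps -> exists N, forall m n, (N <= m)%N -> (N <= n)%N ->
     hnorm (u m - u n) < eps) ->
  exists l, (fun n => hnorm (u n - l)) @ \oo --> (0 : R).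
Proof.
move=> uC.
have /choice[N hN] : forall k, exists N, forall m n, (N <= m)%N -> (N <= n)%N ->
    hnorm (u m - u n) < (4 ^+ k)^-1.
  by move=> k; apply: uC; rewrite invr_gt0 exprn_gt0.
pose phi k := (\sum_(0 <= j < k.+1) N j)%N.
have phiN j k : (j <= k)%N -> (N j <= phi k)%N.
  move=> jk; rewrite /phi (bigD1_seq j) ?iota_uniq ?mem_index_iota//=.
  exact: leq_addr.
pose v k := u (phi k).
have vd k : normsq (v k.+1 - v k) <= (16 ^+ k)^-1.
  rewrite -hnorm_sq; apply: (@le_trans _ _ ((4 ^+ k)^-1 ^+ 2)).
    rewrite ler_pXn2r// ?nnegrE ?hnorm_ge0 ?invr_ge0 ?exprn_ge0//.
    by apply/ltW/hN; apply: phiN.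
  by rewrite exprVn -exprM mulnC exprM (_ : 4 ^+ 2 = 16 :> R)//; lra.
pose a k t := v k.+1 t - v k t.
have ma k : cmeasurable arc (a k) by apply: cmeasurableB; exact: cmeasurable_L2.
pose F k t : \bar R := (4 ^+ k * sqmod (a k t))%:E.
have mF k : measurable_fun (arc : set (measurableTypeR R)) (F k).
  by apply/measurable_EFinP/measurable_funM => //; exact: measurable_sqmod.
have F0 k t : (0 <= F k t)%E by rewrite lee_fin mulr_ge0 ?sqmod_ge0 ?exprn_ge0.
have intF k : (\int[mu]_(t in arc) F k t <= ((4 ^+ k)^-1)%:E)%E.
  under eq_integral do rewrite /F EFinM.
  rewrite ge0_integralZl_EFin ?exprn_ge0//; last 2 first.
  - by move=> t _; rewrite lee_fin sqmod_ge0.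
  - by apply/measurable_EFinP; exact: measurable_sqmod.
  rewrite -(normsqL2_ae (ma k) (L2subE _ _)) -EFinM lee_fin.
  apply: le_trans (ler_wpM2l (exprn_ge0 _ _) (vd k)) _ => //.
  rewrite (_ : 16 ^+ k = 4 ^+ k * 4 ^+ k); last first.
    by rewrite -exprMn; congr (_ ^+ k); lra.
  by rewrite invfM mulrA mulfV ?mul1r// expf_neq0.
pose G t := (\sum_(0 <= k <oo) F k t)%E.
have mG : measurable_fun (arc : set (measurableTypeR R)) G.
  by apply: ge0_emeasurable_sum => // k t _ _; exact: F0.
have G0 t : (0 <= G t)%E by apply: nneseries_ge0 => k _ _; exact: F0.
have intG : mu.-integrable arc G.
  apply/integrableP; split => //.
  under eq_integral do rewrite gee0_abs//.
  rewrite integral_nneseries//.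
  apply: (@le_lt_trans _ _ (\sum_(0 <= k <oo) ((4 ^+ k)^-1)%:E)%E).
    apply: lee_nneseries => k _; last exact: intF.
    by move=> _; exact: integral_ge0.
  apply: (@le_lt_trans _ _ (1 * (1 - 4^-1)^-1 : R)%:E); last exact: ltry.
  apply: lime_le; first by apply: is_cvg_nneseries => n _ _; rewrite lee_fin invr_ge0 exprn_ge0.
  apply: nearW => n; rewrite sumEFin lee_fin.
  apply: le_trans (@geometric_le_lim R n 1 4^-1 _ _ _) => //; last first.
    by rewrite ger0_norm ?invr_ge0//; lra.
  by rewrite /series /= ler_sum// => k _; rewrite /geometric /= mul1r exprVn.
pose re k t := Re (v k t); pose im k t := Im (v k t).
have conv : {ae mu, forall t, arc t -> cvgn (re ^~ t) /\ cvgn (im ^~ t)}.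
  apply: filterS (integrable_ae measurable_arcR intG) => t h At.
  have {h} := h At; have := G0 t; case E : (G t) => [g||]//; rewrite lee_fin => g0 _.
  have sq k : 4 ^+ k * sqmod (a k t) <= g.
    rewrite -lee_fin -E; apply: le_trans (@nneseries_lim_ge R (F ^~ t) xpredT 0%N k.+1 _) => //.
    by rewrite big_nat_recr//= leeDr// sume_ge0.
  have step (b : R) k : b ^+ 2 <= sqmod (a k t) -> `|b| <= Num.sqrt g * (2 ^+ k)^-1.
    move=> hb; rewrite -(@ler_pXn2r _ 2%N)// ?nnegrE ?mulr_ge0 ?sqrtr_ge0 ?invr_ge0 ?exprn_ge0//.
    rewrite real_normK ?num_real// exprMn sqr_sqrtr// exprVn -exprM mulnC exprM.
    rewrite (_ : 2 ^+ 2 = 4 :> R); last by lra.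
    rewrite ler_pdivlMr ?exprn_gt0// mulrC; apply: le_trans (sq k).
    by rewrite ler_wpM2l// exprn_ge0.
  split; apply: (@geometric_steps_cvg _ (Num.sqrt g)) => k; apply: step.
    by rewrite /re -ReB; exact: Re_sqr_le.
  by rewrite /im -ImB; exact: Im_sqr_le.
(* The upper limit is measurable and periodic everywhere, whether or not the subsequence converges
   at t; [fine] sends infinite values to 0. *)
pose gre t := fine (limn_esup (fun k => (re k t)%:E)).
pose gim t := fine (limn_esup (fun k => (im k t)%:E)).
pose g t := gre t +i* gim t.
have mg : cmeasurable setT g.
  have mlim (w : nat -> R -> R) :
      (forall k, measurable_fun (setT : set (measurableTypeR R)) (w k)) ->
      measurable_fun (setT : set (measurableTypeR R))
        (fun t => fine (limn_esup (fun k => (w k t)%:E))).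
    move=> mw; apply: (measurableT_comp (fine_measurable measurableT)).
    apply: (measurable_fun_limn_esup (f := fun k t => (w k t)%:E)) => k.
    by apply/measurable_EFinP; exact: mw.
  by split; apply: mlim => k; case: (cmeasurable_L2 (v k) setT).
have pg t : g (t + 2 * pi) = g t.
  have pv k : v k (t + 2 * pi) = v k t by case: (sqint_L2 (v k)).
  by rewrite /g /gre /gim /re /im; congr (fine (limn_esup _) +i* fine (limn_esup _));
    apply/funext => k; rewrite pv.
have limE (w : nat -> R) : cvgn w -> w @ \oo --> fine (limn_esup (fun k => (w k)%:E)).
  move=> cw; have h : (fun k => (w k)%:E) @ \oo --> (limn w)%:E.
    by apply: cvg_EFin => //; exact: nearW.
  by rewrite (cvg_limn_einf_sup h).2.
have gm m : exists hs : sqint (fun t => g t - v m t),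
    normsq (mkL2 hs) <= (4 ^+ m)^-1 ^+ 2.
  pose H k t := (sqmod (v k t - v m t))%:E.
  have mH k : measurable_fun (arc : set (measurableTypeR R)) (H k).
    apply/measurable_EFinP; apply: measurable_sqmod; apply: cmeasurableB; exact: cmeasurable_L2.
  have mgv : cmeasurable setT (fun t => g t - v m t).
    by apply: cmeasurableB => //; exact: cmeasurable_L2.
  have mgv' : cmeasurable arc (fun t => g t - v m t).
    by case: mgv => h1 h2; split; exact: measurable_funTS.
  have le1 : (\int[mu]_(t in arc) (sqmod (g t - v m t))%:E <= ((4 ^+ m)^-1 ^+ 2)%:E)%E.
    have -> : (\int[mu]_(t in arc) (sqmod (g t - v m t))%:E =
        \int[mu]_(t in arc) limn_einf (H ^~ t))%E.
      apply: ge0_ae_eq_integral => //.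
      - by apply/measurable_EFinP; exact: measurable_sqmod.
      - apply: (measurableT_comp (f := -%E)) => //.
        apply: (measurable_fun_limn_esup (f := fun k t => (- H k t)%E)) => k.
        by apply: (measurableT_comp (f := -%E)) => //; exact: mH.
      - by move=> t _; rewrite lee_fin sqmod_ge0.
      - move=> t _; rewrite limn_einf_lim; apply: lime_ge; first exact: is_cvg_einfs.
        apply: nearW => n; apply: le_ereal_inf_tmp => _ [j _ <-].
        by rewrite lee_fin sqmod_ge0.
      - apply: (@filterS _ (almost_everywhere mu) (ae_filter_ringOfSetsType mu) _ _ _ conv) => t h At; have [/limE hre /limE him] := h At.
        apply/esym/(cvg_limn_einf_sup _).1; apply: cvg_EFin; first by near=> k.
        rewrite (_ : _ \o _ = fun k => (re k t - re m t) * (re k t - re m t) +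
            (im k t - im m t) * (im k t - im m t)); last first.
          by apply/funext => k; rewrite /H /= /sqmod ReB ImB !expr2.
        rewrite /sqmod ReB ImB !expr2.
        have h1 : (fun k => re k t - re m t) @ \oo --> Re (g t) - Re (v m t).
          by apply: cvgB => //; exact: cvg_cst.
        have h2 : (fun k => im k t - im m t) @ \oo --> Im (g t) - Im (v m t).
          by apply: cvgB => //; exact: cvg_cst.
        by apply: cvgD; apply: cvgM.
    apply: le_trans (fatou _ _ _ _) _ => //.
      by move=> k t _; rewrite lee_fin sqmod_ge0.
    rewrite limn_einf_lim; apply: lime_le; first exact: is_cvg_einfs.
    apply: nearW => n.
    (* The infimum over the tail from n on is bounded by one member that also lies beyond m, where
       the Cauchy estimate of index m holds. *)
    apply: (@le_trans _ _ (\int[mu]_(t in arc) H (maxn n m) t)%E).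
      by apply: ereal_inf_lbound; exists (maxn n m) => //=; exact: leq_maxl.
    have mavm : cmeasurable arc (fun t => v (maxn n m) t - v m t).
      by apply: cmeasurableB; exact: cmeasurable_L2.
    rewrite -(normsqL2_ae mavm (L2subE _ _)) lee_fin -hnorm_sq.
    rewrite ler_pXn2r// ?nnegrE ?hnorm_ge0 ?invr_ge0 ?exprn_ge0//.
    by apply/ltW/hN; apply: phiN => //; exact: leq_maxr.
  have hs : sqint (fun t => g t - v m t).
    split => //.
      by move=> t; rewrite pg; case: (sqint_L2 (v m)) => ->.
    apply/integrableP; split.
      by apply/measurable_EFinP; exact: measurable_sqmod.
    under eq_integral do rewrite gee0_abs ?lee_fin ?sqmod_ge0//.
    exact: le_lt_trans le1 (ltry _).
  exists hs; rewrite -lee_fin; apply: le_trans le1.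
  by rewrite (normsqL2_ae mgv' (mkL2E hs)).
have [hs0 _] := gm 0%N.
have hg : sqint g.
  have := sqintD hs0 (sqint_L2 (v 0%N)); congr sqint.
  by apply/funext => t; rewrite subrK.
pose l := mkL2 hg.
have vl m : hnorm (v m - l) <= (4 ^+ m)^-1.
  have [hs hm] := gm m.
  rewrite hnormB hnorm_leR ?invr_ge0 ?exprn_ge0//.
  suff -> : l - v m = mkL2 hs by [].
  apply: L2P; apply: aeq_trans (L2subE _ _) _; apply: aeq_sym.
  apply: aeq_trans (mkL2E hs) _.
  by apply: filterS (mkL2E hg) => t h At; rewrite h.
exists l; apply/cvgrPdist_lt => eps eps0.
have := @cvg_geometric R 1 4^-1; rewrite ger0_norm ?invr_ge0// => /(_ _).
have h4 : (4^-1 : R) < 1 by lra.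
have e2 : 0 < eps / 2 by rewrite divr_gt0.
move=> /(_ h4)/cvgrPdist_lt/(_ _ e2)[K _ /(_ K (leqnn K))].
rewrite /geometric /= mul1r sub0r normrN ger0_norm ?exprn_ge0 ?invr_ge0// exprVn => hK.
exists (phi K) => // n /= Kn.
rewrite sub0r normrN ger0_norm ?hnorm_ge0//.
rewrite -[_ - _](subrKA (v K)); apply: le_lt_trans (hnormD _ _) _.
have h1 : hnorm (u n - v K) < (4 ^+ K)^-1.
  apply: hN; last exact: phiN.
  exact: leq_trans (phiN _ _ (leqnn K)) Kn.
by have := vl K; move: (_^-1) h1 hK => ????; lra.
Unshelve. all: by end_near. Qed.

End SquareIntegrable.

(** * The Fourier basis *)

Section Calculus.
Context {R : realType}.
Local Notation mu := (@lebesgue_measure R).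
Implicit Types (F f g : R -> R) (a b x : R).

Lemma is_derive_conv f g x a b : is_derive x 1 f a -> f =1 g -> a = b ->
  is_derive x 1 g b.
Proof. by move=> h /funext <- <-. Qed.

Lemma is_deriveM' f g x a b : is_derive x 1 f a -> is_derive x 1 g b ->
  is_derive x 1 (fun t => f t * g t) (a * g x + f x * b).
Proof.
move=> hf hg; apply: (is_derive_conv (is_deriveM hf hg)) => //.
by rewrite addrC /GRing.scale /= [g x * a]mulrC.
Qed.

Lemma is_derive_lin (m x : R) : is_derive x 1 (fun t => m * t) m.
Proof.
apply: (is_derive_conv (is_deriveM' (is_derive_cst m x 1) (is_derive_id x 1))) => //.
by rewrite /= mul0r add0r mulr1.
Qed.

Lemma is_derive_coslin (m x : R) :
  is_derive x 1 (fun t => cos (m * t)) (- m * sin (m * x)).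
Proof.
apply: (is_derive_conv (is_derive1_comp (is_derive_cos (m * x)) (is_derive_lin m x))) => //.
by rewrite mulrC mulNr mulrN.
Qed.

Lemma is_derive_sinlin (m x : R) :
  is_derive x 1 (fun t => sin (m * t)) (m * cos (m * x)).
Proof.
apply: (is_derive_conv (is_derive1_comp (is_derive_sin (m * x)) (is_derive_lin m x))) => //.
by rewrite mulrC.
Qed.

Lemma is_derive_expRlin (m x : R) :
  is_derive x 1 (fun t => expR (m * t)) (m * expR (m * x)).
Proof.
apply: (is_derive_conv (is_derive1_comp (is_derive_expR (m * x)) (is_derive_lin m x))) => //.
by rewrite mulrC.
Qed.

Lemma is_derive_cont F x a : is_derive x 1 F a -> {for x, continuous F}.
Proof.
by move=> [h _]; apply: differentiable_continuous; apply/derivable1_diffP.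
Qed.

Lemma Rintegral_FTC2 F f a b : a <= b ->
  (forall x, a < x < b -> is_derive x 1 F (f x)) ->
  {within `[a, b], continuous F} -> {within `[a, b], continuous f} ->
  \int[mu]_(x in `[a, b]) f x = F b - F a.
Proof.
rewrite le_eqVlt => /predU1P[<- _ _ _|ab dF cF cf].
  by rewrite set_itv1 Rintegral_set1 subrr.
rewrite /Rintegral (@continuous_FTC2 _ f F)//.
  have [_ h1 h2] := (continuous_within_itvP F ab).1 cF.
  by split => // x; rewrite in_itv /= => /dF[].
by move=> x; rewrite in_itv /= => /dF h; rewrite derive1E derive_val.
Qed.

Lemma continuous_integrable_itv f a b : {within `[a, b], continuous f} ->
  mu.-integrable `[a, b] (EFin \o f).
Proof. by apply: continuous_compact_integrable; exact: segment_compact. Qed.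

End Calculus.

Section Arc.
Context {R : realType}.
Local Notation L2 := (L2T R).
Local Notation arc := (@Defs.arc R).
Local Notation mu := (@lebesgue_measure R).

Lemma integrable_arc (f : R -> R) : continuous f -> mu.-integrable arc (EFin \o f).
Proof.
move=> cf; apply: (@integrableS _ _ _ mu `[0, 2 * pi]) => //.
- exact: measurable_arcR.
- by move=> x; rewrite /Defs.arc /= !in_itv /= => /andP[-> /ltW ->].
- by apply: continuous_integrable_itv; exact: continuous_subspaceT.
Qed.

Lemma Rintegral_arc (F f : R -> R) : (forall x : R, is_derive x 1 F (f x)) ->
  continuous f -> \int[mu]_(x in arc) f x = F (2 * pi) - F 0.
Proof.
move=> dF cf; rewrite /Defs.arc Rintegral_itv_bndo_bndc; last exact: integrable_arc.
apply: Rintegral_FTC2 => //; last exact: continuous_subspaceT.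
  by rewrite mulr_ge0// pi_ge0.
by apply: continuous_subspaceT => x; apply: is_derive_cont.
Qed.

Lemma trig_periodic (k : int) (t : R) :
  cos (k%:~R * (t + 2 * pi)) = cos (k%:~R * t) /\
  sin (k%:~R * (t + 2 * pi)) = sin (k%:~R * t).
Proof.
have h (n : nat) (a : R) : cos (a + n%:R * (2 * pi)) = cos a /\ sin (a + n%:R * (2 * pi)) = sin a.
  have -> : n%:R * (2 * pi) = (pi *+ 2) *+ n :> R by rewrite -[pi *+ 2]mulr_natl mulr_natl.
  by rewrite (periodicn (@cosD2pi R)) (periodicn (@sinD2pi R)).
case: k => n; rewrite mulrDr; first by rewrite -pmulrn.
rewrite NegzE mulrNz -pmulrn !mulNr.
have [h1 h2] := h n.+1 (- (n.+1%:R * t) - n.+1%:R * (2 * pi)).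
by rewrite subrK in h1 h2.
Qed.

Lemma Rintegral_arc_cos (k : int) :
  \int[mu]_(t in arc) cos (k%:~R * t) = if k == 0 then 2 * pi else 0.
Proof.
have [->|k0] := eqVneq k 0.
  transitivity (1 * (2 * pi) - 1 * 0 : R); last by rewrite mulr0 subr0 mul1r.
  apply: (@Rintegral_arc (fun t => 1 * t)).
    move=> x; apply: (is_derive_conv (is_derive_lin 1 x)) => //.
    by rewrite mul0r cos0.
  by move=> x; apply: is_derive_cont; exact: is_derive_coslin.
have k0' : k%:~R != 0 :> R by rewrite intr_eq0.
have [_ h] := trig_periodic k 0; rewrite add0r mulr0 ?cos0 ?sin0 in h.
pose F t : R := k%:~R^-1 * sin (k%:~R * t).
transitivity (F (2 * pi) - F 0); last by rewrite /F h !mulr0 ?cos0 ?sin0 ?mulr0 subrr.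
apply: Rintegral_arc.
- move=> x; apply: (is_derive_conv (is_deriveM' (is_derive_cst (k%:~R^-1 : R) x 1)
    (is_derive_sinlin k%:~R x))) => //.
  by rewrite /= mul0r add0r mulrA mulVf// mul1r.
- by move=> x; apply: is_derive_cont; exact: is_derive_coslin.
Qed.

Lemma Rintegral_arc_sin (k : int) : \int[mu]_(t in arc) sin (k%:~R * t) = 0.
Proof.
have [->|k0] := eqVneq k 0.
  under eq_Rintegral do rewrite mul0r sin0.
  by rewrite Rintegral_cst ?mul0r//; exact: measurable_arcR.
have k0' : k%:~R != 0 :> R by rewrite intr_eq0.
have [h _] := trig_periodic k 0; rewrite add0r mulr0 ?cos0 ?sin0 in h.
pose F t : R := - k%:~R^-1 * cos (k%:~R * t).
transitivity (F (2 * pi) - F 0); last by rewrite /F h !mulr0 ?cos0 ?sin0 ?mulr0 subrr.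
apply: Rintegral_arc.
- move=> x; apply: (is_derive_conv (is_deriveM' (is_derive_cst (- k%:~R^-1 : R) x 1)
    (is_derive_coslin k%:~R x))) => //.
  by rewrite /= mul0r add0r mulrA mulrNN mulVf// mul1r.
- by move=> x; apply: is_derive_cont; exact: is_derive_sinlin.
Qed.

Lemma sqint_continuous (f : R -> R[i]) : (forall t, f (t + 2 * pi) = f t) ->
  continuous (fun t => Re (f t)) -> continuous (fun t => Im (f t)) -> sqint f.
Proof.
move=> pf cr ci; split => //.
  by split; apply: continuous_measurable_fun.
apply: integrable_arc.
rewrite (_ : (fun t => sqmod (f t)) =
    (fun t => Re (f t) * Re (f t) + Im (f t) * Im (f t))); last first.
  by apply/funext => t; rewrite /sqmod !expr2.
by move=> t; apply: cvgD; apply: cvgM; [exact: cr..|exact: ci|exact: ci].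
Qed.

Lemma inner_aeq (x y : L2) (f g : R -> R[i]) : cmeasurable arc f -> cmeasurable arc g ->
  aeq x f -> aeq y g -> inner x y = cintegral arc (fun t => (f t)^*%C * g t).
Proof.
move=> mf mg xf yg; apply: cintegral_aeq.
- by apply: cmeasurableM; [apply: cmeasurable_conj|]; exact: cmeasurable_L2.
- by apply: cmeasurableM => //; exact: cmeasurable_conj.
- by apply: filterS2 xf yg => t h1 h2 At; rewrite h1// h2.
Qed.

Lemma sqint_expi (k : int) : sqint (fun t : R => expi (k%:~R * t)).
Proof.
apply: sqint_continuous => [t|t|t]; last 2 first.
- by apply: is_derive_cont; exact: is_derive_coslin.
- by apply: is_derive_cont; exact: is_derive_sinlin.
by rewrite /expi; have [-> ->] := trig_periodic k t.
Qed.

Definition cexp (k : int) : L2 := mkL2 (sqint_expi k).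

Lemma inner_cexp (k : int) (x : L2) : inner (cexp k) x =
  cintegral arc (fun t => (expi (k%:~R * t))^*%C * x t).
Proof.
apply: inner_aeq; [exact/cmeasurable_sqint/sqint_expi|exact: cmeasurable_L2|
  exact: mkL2E|exact: aeq_refl].
Qed.

Lemma fourierE (x : L2) (k : int) :
  inner (cexp k) x = (2 * pi)%:C * fourier x k.
Proof.
rewrite inner_cexp /fourier mulrA -rmorphM /= mulfV ?mul1r; last first.
  by rewrite mulf_neq0// gt_eqF// pi_gt0.
congr (cintegral _ _); apply/funext => t.
by rewrite /expi cosN sinN mulrC.
Qed.

Lemma inner_cexpE (k l : int) : inner (cexp k) (cexp l) = ((2 * pi) *+ (k == l))%:C.
Proof.
rewrite (@inner_aeq _ _ (fun t => expi (k%:~R * t)) (fun t => expi (l%:~R * t)));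
  [|exact/cmeasurable_sqint/sqint_expi..|exact: mkL2E|exact: mkL2E].
transitivity ((\int[mu]_(t in arc) cos ((l - k)%:~R * t)) +i*
  (\int[mu]_(t in arc) sin ((l - k)%:~R * t))).
  by congr (_ +i* _); apply: eq_Rintegral => t _; rewrite /expi rmorphB mulrBl ?cosB ?sinB /=; ring.
rewrite Rintegral_arc_cos Rintegral_arc_sin subr_eq0 eq_sym.
by case: eqP => _.
Qed.

End Arc.

(** * Completeness of the trigonometric system *)

Section Multipliers.
Context {R : realType}.
Local Notation arc := (@Defs.arc R).
Local Notation mu := (@lebesgue_measure R).

Lemma Rintegral_eq0_cvg (D : set (measurableTypeR R)) (f_ : nat -> R -> R) (f G : R -> R) :
  measurable D -> (forall n, measurable_fun D (f_ n)) ->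
  (forall t, D t -> f_ ^~ t @ \oo --> f t) -> mu.-integrable D (EFin \o G) ->
  (forall n t, D t -> `|f_ n t| <= G t) ->
  (forall n, \int[mu]_(t in D) f_ n t = 0) -> \int[mu]_(t in D) f t = 0.
Proof.
move=> mD mf cf iG fG f0.
have f_f t : D t -> (fun n => (f_ n t)%:E) @ \oo --> (f t)%:E.
  by move=> Dt; apply: cvg_EFin; [exact: nearW|exact: cf].
have mf' n : measurable_fun D (EFin \o f_ n) by exact/measurable_EFinP.
have mfE : measurable_fun D (EFin \o f) by apply: (emeasurable_fun_cvg _ _ mf' f_f).
have fG' t n : D t -> (`|(EFin \o f_ n) t| <= (EFin \o G) t)%E.
  by move=> Dt; rewrite /= lee_fin; exact: fG.
have [_ _] := @dominated_convergence _ _ R mu D mD (fun n => EFin \o f_ n)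
  (EFin \o f) (EFin \o G) mf' mfE (aeW _ f_f) iG
  (aeW _ fG').
have i0 n : (\int[mu]_(t in D) (EFin \o f_ n) t = 0)%E.
  have ifn : mu.-integrable D (EFin \o f_ n).
    apply: le_integrable iG => // t Dt /=; rewrite lee_fin.
    by apply: le_trans (fG n t Dt) _; exact: ler_norm.
  by rewrite -[LHS]fineK ?integrable_fin_num//; congr EFin; exact: f0.
rewrite (_ : [sequence _]_n = fun=> 0%E); last by apply/funext => n; exact: i0.
by move=> /cvg_lim h; rewrite /Rintegral -h// lim_cst.
Qed.

Section RealFunction.
Variable g : R -> R.
Hypothesis ig : mu.-integrable arc (EFin \o g).

Let mg : measurable_fun (arc : set (measurableTypeR R)) g.
Proof. by apply/measurable_EFinP; exact: (measurable_int mu). Qed.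

Definition bounded_measurable (h : R -> R) :=
  measurable_fun (setT : set (measurableTypeR R)) h /\ exists M, forall t, `|h t| <= M.

Lemma bounded_measurableM h h' : bounded_measurable h -> bounded_measurable h' ->
  bounded_measurable (fun t => h t * h' t).
Proof.
move=> [mh [M hM]] [mh' [M' hM']]; split; first exact: measurable_funM.
by exists (M * M') => t; rewrite normrM ler_pM.
Qed.

Lemma bounded_measurableD h h' : bounded_measurable h -> bounded_measurable h' ->
  bounded_measurable (fun t => h t + h' t).
Proof.
move=> [mh [M hM]] [mh' [M' hM']]; split; first exact: measurable_funD.
by exists (M + M') => t; apply: le_trans (ler_normD _ _) _; rewrite lerD.
Qed.

Lemma bounded_measurable_cst c : bounded_measurable (fun=> c).
Proof. by split; [exact: measurable_cst|exists `|c|]. Qed.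

Lemma bounded_measurable_cos (m : R) : bounded_measurable (fun t => cos (m * t)).
Proof.
split; last by exists 1 => t; exact: cos_max.
by apply: continuous_measurable_fun => t; apply: is_derive_cont; exact: is_derive_coslin.
Qed.

Lemma bounded_measurable_sin (m : R) : bounded_measurable (fun t => sin (m * t)).
Proof.
split; last by exists 1 => t; exact: sin_max.
by apply: continuous_measurable_fun => t; apply: is_derive_cont; exact: is_derive_sinlin.
Qed.

Lemma integrable_bounded h : bounded_measurable h ->
  mu.-integrable arc (EFin \o (fun t => g t * h t)).
Proof.
move=> [mh [M hM]].
have := integrableZl measurable_arcR M (integrable_abse ig).
apply: le_integrable; first exact: measurable_arcR.
  by apply/measurable_EFinP/measurable_funM => //; exact: measurable_funTS.
move=> t _ /=; rewrite lee_fin normrM mulrC.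
apply: le_trans (ler_wpM2r _ (hM t)) _ => //.
by rewrite normrM normr_id ler_wpM2r// ler_norm.
Qed.

(* Completeness of the trigonometric system: the bounded functions h such that
   g * h is again orthogonal to all cos (k t) and sin (k t) form an algebra
   closed under bounded pointwise limits; it contains sin (t - x), hence its
   sign, hence indicators of intervals. *)
Definition annihilated q := bounded_measurable q /\ forall k : int,
  \int[mu]_(t in arc) (g t * (q t * cos (k%:~R * t))) = 0 /\
  \int[mu]_(t in arc) (g t * (q t * sin (k%:~R * t))) = 0.

Definition multiplier h := bounded_measurable h /\
  forall q, annihilated q -> annihilated (fun t => q t * h t).

Let int2 (a b : R) (h h1 h2 : R -> R) :
  bounded_measurable h1 -> bounded_measurable h2 ->
  (forall t, h t = a * h1 t + b * h2 t) ->
  \int[mu]_(t in arc) (g t * h1 t) = 0 -> \int[mu]_(t in arc) (g t * h2 t) = 0 ->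
  \int[mu]_(t in arc) (g t * h t) = 0.
Proof.
move=> b1 b2 hE i1 i2.
rewrite (@eq_Rintegral _ _ _ mu _ (fun t => a * (g t * h1 t) + b * (g t * h2 t))); last first.
  by move=> t _; rewrite hE; ring.
have mA := measurable_arcR (R := R).
rewrite RintegralD//; last 2 first.
- exact: (integrableZl mA a (integrable_bounded b1)).
- exact: (integrableZl mA b (integrable_bounded b2)).
rewrite !RintegralZl//; [|exact: integrable_bounded..].
by rewrite i1 i2 !mulr0 addr0.
Qed.

Lemma multiplier_cst c : multiplier (fun=> c).
Proof.
split=> [|q [bq hq]]; first exact: bounded_measurable_cst.
split=> [|k]; first by apply: bounded_measurableM => //; exact: bounded_measurable_cst.
have [h1 h2] := hq k; split.
  apply: (@int2 c 0 _ (fun t => q t * cos (k%:~R * t)) (fun t => q t * cos (k%:~R * t))) => //.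
  1,2: by apply: bounded_measurableM => //; exact: bounded_measurable_cos.
  by move=> t; ring.
apply: (@int2 c 0 _ (fun t => q t * sin (k%:~R * t)) (fun t => q t * sin (k%:~R * t))) => //.
1,2: by apply: bounded_measurableM => //; exact: bounded_measurable_sin.
by move=> t; ring.
Qed.

Lemma multiplierM h h' : multiplier h -> multiplier h' -> multiplier (fun t => h t * h' t).
Proof.
move=> [bh mh] [bh' mh']; split=> [|q hq]; first exact: bounded_measurableM.
have := mh' _ (mh _ hq); congr annihilated.
by apply/funext => t; rewrite mulrA.
Qed.

Lemma multiplierD h h' : multiplier h -> multiplier h' -> multiplier (fun t => h t + h' t).
Proof.
move=> [bh mh] [bh' mh']; split=> [|q hq]; first exact: bounded_measurableD.
have [b1 h1] := mh _ hq; have [b2 h2] := mh' _ hq; case: hq => bq hq.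
split=> [|k]; first by apply: bounded_measurableM => //; exact: bounded_measurableD.
have [c1 s1] := h1 k; have [c2 s2] := h2 k; split.
  apply: (int2 (a := 1) (b := 1) _ _ _ c1 c2).
  1,2: by apply: bounded_measurableM => //; exact: bounded_measurable_cos.
  by move=> t; ring.
apply: (int2 (a := 1) (b := 1) _ _ _ s1 s2).
1,2: by apply: bounded_measurableM => //; exact: bounded_measurable_sin.
by move=> t; ring.
Qed.

Lemma multiplier_cvg (h_ : nat -> R -> R) h (M : R) :
  (forall n, multiplier (h_ n)) -> (forall n t, `|h_ n t| <= M) ->
  (forall t, h_ ^~ t @ \oo --> h t) -> multiplier h.
Proof.
move=> mh hM hh.
have bh : bounded_measurable h.
  split.
    apply: (measurable_fun_cvg (h := h_)) => [n|t _]; last exact: hh.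
    by case: (mh n) => -[].
  exists M => t; have /cvg_norm h1 := hh t.
  rewrite -(cvg_lim _ h1)//; apply: limr_le; first by apply/cvg_ex; eexists; exact: h1.
  by apply: nearW => n; exact: hM.
split=> // q hq; have [bq _] := hq.
split=> [|k]; first exact: bounded_measurableM.
have [mq [Q hQ]] := bq.
have key (w : R -> R) : bounded_measurable w -> (forall t, `|w t| <= 1) ->
    (forall n, \int[mu]_(t in arc) (g t * (q t * h_ n t * w t)) = 0) ->
    \int[mu]_(t in arc) (g t * (q t * h t * w t)) = 0.
  move=> bw w1 hw.
  have mA := measurable_arcR (R := R).
  apply: (@Rintegral_eq0_cvg arc (fun n t => g t * (q t * h_ n t * w t)) _
    (fun t => (Q * M) * `|g t|)) => //.
  - move=> n; apply: measurable_funM => //; apply: measurable_funTS.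
    case: (mh n) => -[mhn _] _; case: bw => mw _.
    by apply: measurable_funM => //; exact: measurable_funM.
  - move=> t _; apply: cvgM; first exact: cvg_cst.
    apply: cvgM; last exact: cvg_cst.
    by apply: cvgM; [exact: cvg_cst|exact: hh].
  - exact: (integrableZl mA (Q * M) (integrable_abse ig)).
  - move=> n t _; rewrite normrM mulrC ler_wpM2r// !normrM -[leRHS]mulr1.
    by rewrite ler_pM ?mulr_ge0// ler_pM.
split; apply: key => [|t|n].
- exact: bounded_measurable_cos.
- exact: cos_max.
- by have [_ /(_ k)[]] := (mh n).2 _ hq.
- exact: bounded_measurable_sin.
- exact: sin_max.
- by have [_ /(_ k)[]] := (mh n).2 _ hq.
Qed.

(** Product-to-sum formulas express the integrals at k by those at k + 1 and k - 1; this is why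
    [annihilated] ranges over all integers. *)
Lemma multiplier_cos : multiplier (@cos R).
Proof.
have bc : bounded_measurable (@cos R).
  by have := bounded_measurable_cos 1; under eq_fun do rewrite mul1r.
split=> // q [bq hq]; split=> [|k]; first exact: bounded_measurableM.
have [c1 s1] := hq (k + 1); have [c2 s2] := hq (k - 1).
split.
  apply: (int2 (a := 2^-1) (b := 2^-1) _ _ _ c1 c2).
  1,2: by apply: bounded_measurableM => //; exact: bounded_measurable_cos.
  by move=> t; rewrite rmorphD rmorphB /= mulrDl mulrBl mul1r cosD cosB; field.
apply: (int2 (a := 2^-1) (b := 2^-1) _ _ _ s1 s2).
1,2: by apply: bounded_measurableM => //; exact: bounded_measurable_sin.
by move=> t; rewrite rmorphD rmorphB /= mulrDl mulrBl mul1r sinD sinB; field.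
Qed.

Lemma multiplier_sin : multiplier (@sin R).
Proof.
have bc : bounded_measurable (@sin R).
  by have := bounded_measurable_sin 1; under eq_fun do rewrite mul1r.
split=> // q [bq hq]; split=> [|k]; first exact: bounded_measurableM.
have [c1 s1] := hq (k + 1); have [c2 s2] := hq (k - 1).
split.
  apply: (int2 (a := 2^-1) (b := - 2^-1) _ _ _ s1 s2).
  1,2: by apply: bounded_measurableM => //; exact: bounded_measurable_sin.
  by move=> t; rewrite rmorphD rmorphB /= mulrDl mulrBl mul1r sinD sinB; field.
apply: (int2 (a := - 2^-1) (b := 2^-1) _ _ _ c1 c2).
1,2: by apply: bounded_measurableM => //; exact: bounded_measurable_cos.
by move=> t; rewrite rmorphD rmorphB /= mulrDl mulrBl mul1r cosD cosB; field.
Qed.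

End RealFunction.

End Multipliers.

Section SignApproximation.
Context {R : realType}.
Local Notation mu := (@lebesgue_measure R).

(* Its iterates converge to the sign function on [-1, 1]. *)
Definition sharpen (y : R) := (3 * y - y ^+ 3) / 2.

Lemma sharpenN y : sharpen (- y) = - sharpen y.
Proof. by rewrite /sharpen; field. Qed.

Lemma sharpen_le1 y : `|y| <= 1 -> `|sharpen y| <= 1.
Proof.
rewrite !ler_norml => /andP[h1 h2]; rewrite /sharpen; apply/andP; split.
  suff : 0 <= (1 + y) ^+ 2 * (2 - y) by rewrite !exprS expr0; lra.
  by rewrite mulr_ge0 ?sqr_ge0//; lra.
suff : 0 <= (1 - y) ^+ 2 * (2 + y) by rewrite !exprS expr0; lra.
by rewrite mulr_ge0 ?sqr_ge0//; lra.
Qed.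

Lemma iter_sharpen_le1 y n : `|y| <= 1 -> `|iter n sharpen y| <= 1.
Proof. by move=> hy; elim: n => //= n; exact: sharpen_le1. Qed.

Lemma iter_sharpen_cvg y : `|y| <= 1 -> (fun n => iter n sharpen y) @ \oo --> Num.sg y.
Proof.
have pos (z : R) : 0 < z -> z <= 1 -> (fun n => iter n sharpen z) @ \oo --> (1 : R).
  move=> z0 z1.
  have key n : z <= iter n sharpen z <= 1 /\ 1 - iter n sharpen z <= (1 - z / 2) ^+ n.
    elim: n => [|n [/andP[h1 h2] h3]]; first by rewrite /= lexx z1 expr0; split => //; lra.
    rewrite iterS; set w := iter n sharpen z in h1 h2 h3 *.
    (* As w >= z, the second factor is at most 1 - z / 2, so the distance to 1 shrinks
       geometrically. *)
    have hw : 1 - sharpen w = (1 - w) * (1 - w / 2 - w ^+ 2 / 2) by rewrite /sharpen; field.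
    split.
      apply/andP; split.
        suff : 0 <= w * ((1 - w) * (1 + w)) by rewrite /sharpen !exprS expr0; lra.
        by rewrite !mulr_ge0//; lra.
      apply: le_trans (ler_norm _) (sharpen_le1 _).
      by rewrite ger0_norm//; lra.
    have z2 : 0 <= 1 - z / 2 by lra.
    rewrite hw [leRHS]exprSr; apply: le_trans (ler_wpM2r z2 h3).
    have w2 := sqr_ge0 w.
    by rewrite ler_wpM2l//; lra.
  apply/cvgrPdist_le => eps eps0.
  have z2 : `|1 - z / 2| < 1 by rewrite ltr_norml; lra.
  have /cvgrPdist_le/(_ _ eps0) := @cvg_geometric R 1 _ z2.
  apply: filterS => n; rewrite /geometric /= mul1r sub0r normrN => h.
  have [/andP[_ h1] h2] := key n.
  rewrite ger0_norm; last by lra.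
  by apply: le_trans h2 _; apply: le_trans (ler_norm _) h.
move=> y1; have [y0|y0|->] := ltrgtP y 0.
- rewrite ltr0_sg// (_ : (fun n => _) = fun n => - iter n sharpen (- y)).
    by apply: cvgN; apply: pos; [lra|move: y1; rewrite ler_norml; lra].
  apply/funext; elim=> [|n ih]; rewrite ?opprK//.
  by rewrite iterS [in RHS]iterS -sharpenN -ih.
- rewrite gtr0_sg//; apply: pos => //.
  by rewrite ler_norml in y1; case/andP: y1.
- rewrite sgr0 (_ : (fun n => _) = fun=> 0); first exact: cvg_cst.
  by apply/funext; elim=> [//|n /= ->]; rewrite /sharpen mulr0 expr0n subr0 mul0r.
Qed.

(** At every Lebesgue point f is the derivative of its primitive, which vanishes on the whole
    interval; almost every point is a Lebesgue point. *)
Lemma ae_eq0_primitive (f : R -> R) (a b : R) : mu.-integrable setT (EFin \o f) ->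
  (forall y, a < y < b -> \int[mu]_(t in `[a, y]) f t = 0) ->
  {ae mu, forall t, a < t < b -> f t = 0}.
Proof.
move=> intf F0.
have locf : locally_integrable [set: R] f.
  by have := integrable_locally_restrict measurableT intf; rewrite patch_setT.
have key (x : R) : lebesgue_pt f x -> a < x < b -> f x = 0.
  move=> lx /andP[ax xb].
  have xu : x < x + 1 by rewrite ltrDl.
  have iax : mu.-integrable [set` Interval (BLeft a) (BRight (x + 1))] (EFin \o f).
    by apply: integrableS intf.
  have [|_ <-] := FTC1_lebesgue_pt xu iax _ lx; first by rewrite lte_fin.
  rewrite derive1E (@near_eq_derive _ _ _ _ (cst 0)) ?derive_cst//.
  have xab : x \in `]a, b[ by rewrite in_itv /= ax xb.
  by apply: filterS (near_in_itvoo xab) => y; rewrite in_itv => /F0.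
apply: (@filterS _ (almost_everywhere mu) (ae_filter_ringOfSetsType mu) _ _ _
  (lebesgue_differentiation locf)) => x; exact: key.
Qed.

End SignApproximation.

Section TrigonometricCompleteness.
Context {R : realType}.
Local Notation arc := (@Defs.arc R).
Local Notation mu := (@lebesgue_measure R).
Local Notation L2 := (L2T R).

Lemma ae_neq3 (a b c : R) : {ae mu, forall t : R, [/\ t != a, t != b & t != c]}.
Proof.
exists [set a; b; c]; split.
- by apply: measurableU => //; apply: measurableU.
- by apply/countable_lebesgue_measure0/finite_set_countable; rewrite !finite_setU.
- move=> t /= h; apply: contrapT => ht; apply: h; split; apply/eqP => E; apply: ht.
  + by left; left.
  + by left; right.
  + by right.
Qed.

Lemma trig_complete_real (g : R -> R) : mu.-integrable arc (EFin \o g) ->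
  (forall k : int, \int[mu]_(t in arc) (g t * cos (k%:~R * t)) = 0 /\
                   \int[mu]_(t in arc) (g t * sin (k%:~R * t)) = 0) ->
  {ae mu, forall t, arc t -> g t = 0}.
Proof.
move=> ig g0.
have ann1 : annihilated g (fun=> 1).
  split=> [|k]; first exact: bounded_measurable_cst.
  by have [h1 h2] := g0 k; split; under eq_Rintegral do rewrite mul1r.
have msin x : multiplier g (fun t => sin (t - x)).
  have := multiplierD ig (multiplierM (multiplier_sin ig) (multiplier_cst ig (cos x)))
    (multiplierM (multiplier_cst ig (- sin x)) (multiplier_cos ig)).
  by congr multiplier; apply/funext => t; rewrite sinB; ring.
have msg x : multiplier g (fun t => Num.sg (sin (t - x))).
  apply: (@multiplier_cvg R g ig (fun n t => iter n sharpen (sin (t - x))) _ 1) => //.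
  - elim=> [|n ih] /=; first exact: msin.
    have := multiplierD ig (multiplierM (multiplier_cst ig (3 / 2)) ih)
      (multiplierM (multiplier_cst ig (- 2^-1)) (multiplierM ih (multiplierM ih ih))).
    by congr multiplier; apply/funext => t; rewrite /sharpen; field.
  - by move=> n t; apply: iter_sharpen_le1; exact: sin_max.
  - by move=> t; apply: iter_sharpen_cvg; exact: sin_max.
have intP P : multiplier g P -> \int[mu]_(t in arc) (g t * P t) = 0.
  move=> mP; have [_ /(_ 0)[h _]] := mP.2 _ ann1.
  by rewrite -[RHS]h; apply: eq_Rintegral => t _; rewrite mul1r mul0r cos0 mulr1.
pose f0 := g \_ arc.
have mA := measurable_arcR (R := R).
have if0 : mu.-integrable setT (EFin \o f0).
  have /integrable_mkcond := ig; move=> /(_ mA); congr (_.-integrable _ _).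
  by apply/funext => t; rewrite /f0 /= !patchE; case: ifP.
(* The products of signs used below agree with the indicator of [lo, x] on the arc except possibly
   at 0, x and pi, a null set. *)
have key P (lo x : R) : multiplier g P ->
    (forall t, arc t -> t != 0 -> t != x -> t != pi -> P t = (lo <= t <= x)%R%:R) ->
    \int[mu]_(t in `[lo, x]) f0 t = 0.
  move=> mP hP; rewrite -[RHS](intP P mP) /Rintegral; congr fine.
  rewrite integral_mkcond [RHS]integral_mkcond.
  have iP := integrable_bounded ig mP.1.
  apply: ae_eq_integral => //.
  - apply/(measurable_restrictT _ _).1 => //; apply: measurable_funTS.
    by case/integrableP : if0.
  - by apply/(measurable_restrictT _ _).1 => //; case/integrableP : iP.
  - apply: (@filterS _ (almost_everywhere mu) (ae_filter_ringOfSetsType mu) _ _ _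
      (ae_neq3 0 x pi)) => t [t0 tx tp] _.
    rewrite !patchE /f0 patchE.
    have hin : (t \in [set` `[lo, x]]) = (lo <= t <= x)%R.
      by apply/idP/idP => [/set_mem|h]; [|apply/mem_set]; rewrite /= in_itv.
    rewrite hin; have [At|At] := boolP (t \in arc).
      rewrite (hP t (set_mem At))//.
      by case: (lo <= t <= x)%R; rewrite ?mulr1 ?mulr0.
    by case: ifPn.
have sgpos (t x : R) : 0 < t - x < pi -> Num.sg (sin (t - x)) = 1.
  by move=> h; rewrite gtr0_sg// sin_gt0_pi.
have sgneg (t x : R) : - pi < t - x < 0 -> Num.sg (sin (t - x)) = -1.
  move=> h; rewrite ltr0_sg// -oppr_gt0 -sinN sin_gt0_pi//.
  by move: h; lra.
pose up x t := 2^-1 * (1 + Num.sg (sin (t - x))) : R.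
pose dn x t := 2^-1 * (1 - Num.sg (sin (t - x))) : R.
have mup x : multiplier g (up x).
  exact (multiplierM (multiplier_cst ig 2^-1) (multiplierD ig (multiplier_cst ig 1) (msg x))).
have mdn x : multiplier g (dn x).
  have := multiplierM (multiplier_cst ig 2^-1) (multiplierD ig (multiplier_cst ig 1)
    (multiplierM (multiplier_cst ig (-1)) (msg x))).
  by congr multiplier; apply/funext => t; rewrite /dn mulN1r.
have half : 2^-1 * (1 + 1) = 1 :> R by field.
have arcE t : arc t -> 0 <= t < 2 * pi by rewrite /Defs.arc /= in_itv.
(* On the arc [up 0] selects ]0, pi[, and there [dn x] selects t < x because t - x stays in ]-pi,
   pi[. The sign of sin (t - x) orders points only within half a circle, so the two halves of the
   arc are treated separately. *)
have low : {ae mu, forall t, 0 < t < pi -> f0 t = 0}.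
  apply: ae_eq0_primitive => // x /andP[x0 xp].
  apply: (key (fun t => up 0 t * dn x t)) => //.
    exact: multiplierM.
  move=> t /arcE At t0 tx tp; rewrite /up /dn.
  have {t0} t0 : 0 < t by rewrite lt_def t0; lra.
  have [tlp|tgp|E] := ltrgtP t pi; last by rewrite E eqxx in tp.
    rewrite (sgpos t 0); last by lra.
    have [tlx|tgx|E] := ltrgtP t x; last by rewrite E eqxx in tx.
      rewrite (sgneg t x); last by lra.
      by rewrite (ltW t0)/=; field.
    rewrite (sgpos t x); last by lra.
    by rewrite andbF subrr !mulr0.
  have -> : Num.sg (sin (t - 0)) = -1.
    have := @sinDpi R (t - pi); rewrite subrK subr0 => ->.
    by rewrite sgrN gtr0_sg// sin_gt0_pi//; lra.
  by rewrite subrr mulr0 mul0r (_ : (t <= x) = false) ?andbF//; lra.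
(* Here [dn 0] selects the other half ]pi, 2 pi[, and [dn x] again cuts it at x. *)
have high : {ae mu, forall t, pi < t < 2 * pi -> f0 t = 0}.
  apply: ae_eq0_primitive => // x /andP[x0 xp].
  apply: (key (fun t => dn 0 t * dn x t)) => //.
    exact: multiplierM.
  move=> t /arcE At t0 tx tp; rewrite /dn.
  have {t0} t0 : 0 < t by rewrite lt_def t0; lra.
  have [tlp|tgp|E] := ltrgtP t pi; last by rewrite E eqxx in tp.
    rewrite (sgpos t 0); last by lra.
    by rewrite subrr mulr0 mul0r.
  have -> : Num.sg (sin (t - 0)) = -1.
    have := @sinDpi R (t - pi); rewrite subrK subr0 => ->.
    by rewrite sgrN gtr0_sg// sin_gt0_pi//; lra.
  rewrite /=; have [tlx|tgx|E] := ltrgtP t x; last by rewrite E eqxx in tx.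
    by rewrite (sgneg t x) ?(ltW tgp)/=; [field|lra].
  by rewrite (sgpos t x); [rewrite ?andbF subrr !mulr0|lra].
have FF := ae_filter_ringOfSetsType mu.
apply: (@filterS _ (almost_everywhere mu) FF _ _ _ (@filterI _ _ FF _ _ low
  (@filterI _ _ FF _ _ high (ae_neq3 0 pi 0)))) => t [l [h [t0 tp _]]] At.
have -> : g t = f0 t by rewrite /f0 patchE mem_set.
have := arcE _ At; have {}t0 := t0.
have [tlp|tgp|E] := ltrgtP t pi; last by rewrite E eqxx in tp.
  by move=> /andP[t1 _]; apply: l; rewrite lt_def t0 t1.
by move=> /andP[_ t1]; apply: h; rewrite tgp t1.
Qed.

Theorem cexp_complete (x : L2) : (forall k : int, inner (cexp k) x = 0) -> x = 0.
Proof.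
move=> x0.
have [_ mx _] := sqint_L2 x.
have sq1 : sqint (fun=> 1 : R[i]).
  by apply: sqint_continuous => //= t; exact: cvg_cst.
have [ire0 iim0] := cintegrable_conjM sq1 (sqint_L2 x).
have ire : mu.-integrable arc (EFin \o (fun t => Re (x t))).
  by move: ire0; congr (_.-integrable _ _); apply/funext => t; rewrite /comp conjc1 mul1r.
have iim : mu.-integrable arc (EFin \o (fun t => Im (x t))).
  by move: iim0; congr (_.-integrable _ _); apply/funext => t; rewrite /comp conjc1 mul1r.
have ic (k : int) := integrable_bounded ire (bounded_measurable_cos k%:~R).
have isn (k : int) := integrable_bounded ire (bounded_measurable_sin k%:~R).
have jc (k : int) := integrable_bounded iim (bounded_measurable_cos k%:~R).
have js (k : int) := integrable_bounded iim (bounded_measurable_sin k%:~R).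
pose A k := \int[mu]_(t in arc) (Re (x t) * cos (k%:~R * t)).
pose B k := \int[mu]_(t in arc) (Re (x t) * sin (k%:~R * t)).
pose C k := \int[mu]_(t in arc) (Im (x t) * cos (k%:~R * t)).
pose D k := \int[mu]_(t in arc) (Im (x t) * sin (k%:~R * t)).
have mA := measurable_arcR (R := R).
have eqs (k : int) : A k + D k = 0 /\ C k - B k = 0.
  have := x0 k; rewrite inner_cexp /cintegral => -[h1 h2].
  rewrite -[in X in X /\ _]h1 -[in X in _ /\ X]h2 -RintegralD// -RintegralB//.
  by split; apply: eq_Rintegral => t _; rewrite /expi; case: (x t) => a b /=; ring.
(* Orthogonality at k gives only A k + D k = 0 and C k - B k = 0. Parity turns the relations at -k
   into A k - D k = 0 and C k + B k = 0, so all four vanish. *)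
have sym (k : int) : [/\ A (- k) = A k, B (- k) = - B k, C (- k) = C k & D (- k) = - D k].
  have hN (t : R) : (- k)%:~R * t = - (k%:~R * t) by rewrite mulrNz mulNr.
  split.
  - by apply: eq_Rintegral => t _; rewrite hN cosN.
  - rewrite /B -[RHS]mulN1r -(RintegralZl (-1) mA (isn k)).
    by apply: eq_Rintegral => t _; rewrite hN sinN mulrN mulN1r.
  - by apply: eq_Rintegral => t _; rewrite hN cosN.
  - rewrite /D -[RHS]mulN1r -(RintegralZl (-1) mA (js k)).
    by apply: eq_Rintegral => t _; rewrite hN sinN mulrN mulN1r.
have zero (k : int) : [/\ A k = 0, B k = 0, C k = 0 & D k = 0].
  have [h1 h2] := eqs k; have [h3 h4] := eqs (- k).
  have [s1 s2 s3 s4] := sym k; rewrite s1 s4 in h3; rewrite s2 s3 in h4.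
  by split; lra.
have zre := trig_complete_real ire (fun k => conj (let: And4 a _ _ _ := zero k in a)
  (let: And4 _ b _ _ := zero k in b)).
have zim := trig_complete_real iim (fun k => conj (let: And4 _ _ c _ := zero k in c)
  (let: And4 _ _ _ d := zero k in d)).
apply: L2P; apply: aeq_trans (aeq_sym (L20E R)).
apply: (@filterS2 _ (almost_everywhere mu) (ae_filter_ringOfSetsType mu) _ _ _ _ zre zim) => t.
by move=> h1 h2 At; apply: complexP; [exact: h1|exact: h2].
Qed.

End TrigonometricCompleteness.

(** * Translations of the circle and spatial invariance *)

Section Translation.
Context {R : realType}.
Local Notation arc := (@Defs.arc R).
Local Notation mu := (@lebesgue_measure R).
Local Notation L2 := (L2T R).

Let shift (a : R) (t : measurableTypeR R) : measurableTypeR R := t - a.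

Let measurable_shift a : measurable_fun setT (shift a).
Proof. by apply: measurable_funB => //; exact: measurable_cst. Qed.

(** The pushforward under a translation agrees with Lebesgue measure on half-open intervals, which
    determine it. *)
Lemma lebesgue_measure_shift (a : R) (A : set (measurableTypeR R)) : measurable A ->
  mu A = mu [set t | A (t - a)].
Proof.
move=> mA; pose nu : {measure set (measurableTypeR R) -> \bar R} := pushforward mu (shift a).
rewrite -[RHS]/(nu (measurable_shift a) A).
apply: lebesgue_measure_unique mA => X [[x y] _ <-].
rewrite /nu /= /pushforward.
have -> : shift a @^-1` `]x, y] = `]x + a, y + a]%classic.
  by apply/seteqP; split => t /=; rewrite !in_itv /= /shift ltrBrDr lerBlDr.
rewrite !lebesgue_measure_itv /= !lte_fin ltrD2r.
by case: ifP => // _; rewrite -!EFinB; congr EFin; ring.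
Qed.

Lemma ge0_integral_shift (a : R) (D : set (measurableTypeR R)) (f : R -> \bar R) :
  measurable D -> measurable_fun (setT : set (measurableTypeR R)) f ->
  (forall t, 0 <= f t)%E ->
  (\int[mu]_(t in D) f t = \int[mu]_(t in [set t | D (t - a)%R]) f (t - a)%R)%E.
Proof.
move=> mD mf f0.
rewrite -(@ge0_integral_pushforward _ _ _ _ R _ (measurable_shift a) mu D f)//; last first.
  exact: measurable_funTS.
by apply: eq_measure_integral => A mA _; exact: lebesgue_measure_shift.
Qed.

Let per := 2 * @pi R.

Let per_gt0 : 0 < per. Proof. by rewrite mulr_gt0// pi_gt0. Qed.

Let periodic_int (T : Type) (f : R -> T) : (forall t, f (t + per) = f t) ->
  forall (k : int) t, f (t + k%:~R * per) = f t.
Proof.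
move=> fp; have nat_case (n : nat) t : f (t + n%:R * per) = f t.
  elim: n t => [|n ih] t; first by rewrite mul0r addr0.
  by rewrite -addn1 natrD mulrDl mul1r addrA fp.
case=> n t; first exact: nat_case.
rewrite NegzE mulrNz mulNr.
have := nat_case n.+1 (t - n.+1%:R * per).
by rewrite subrK => <-.
Qed.

(** Periodicity reduces the shift to some b in [0, 2 pi[. The translations by b and by b - 2 pi then
    carry [0, 2 pi - b[ and [2 pi - b, 2 pi[ onto [b, 2 pi[ and [0, b[. *)
Lemma ge0_integral_arc_shift (a : R) (f : R -> \bar R) :
  measurable_fun (setT : set (measurableTypeR R)) f ->
  (forall t, 0 <= f t)%E -> (forall t, f (t + 2 * pi) = f t) ->
  (\int[mu]_(t in arc) f (t - a)%R = \int[mu]_(t in arc) f t)%E.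
Proof.
move=> mf f0 fp.
have msf b : measurable_fun (setT : set (measurableTypeR R)) (fun t => f (t - b)).
  exact: (measurableT_comp mf (measurable_shift b)).
have main b : 0 <= b < per ->
    (\int[mu]_(t in arc) f (t - b)%R = \int[mu]_(t in arc) f t)%E.
  move=> /andP[b0 bp].
  have -> : arc = `[0, b[%classic `|` `[b, per[%classic.
    by rewrite /Defs.arc (@itv_bndbnd_setU _ _ _ (BLeft b))// bnd_simp// ltW.
  rewrite ge0_integral_setU//; last 2 first.
  - exact: measurable_funTS.
  - by apply/disj_setPS => t [] /=; rewrite !in_itv /= => /andP[_ h1] /andP[h2 _]; lra.
  rewrite (_ : `[0, b[%classic `|` `[b, per[%classic =
      `[0, per - b[%classic `|` `[per - b, per[%classic); last first.
    by rewrite -!itv_bndbnd_setU// ?bnd_simp//; lra.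
  rewrite ge0_integral_setU//; last 2 first.
  - exact: measurable_funTS.
  - by apply/disj_setPS => t [] /=; rewrite !in_itv /= => /andP[_ h1] /andP[h2 _]; lra.
  rewrite addeC; congr (_ + _)%E.
    rewrite [RHS](ge0_integral_shift b)//.
    by congr (integral mu _ _); apply/seteqP; split => t /=; rewrite !in_itv /=; lra.
  rewrite [RHS](ge0_integral_shift (b - per))//.
  rewrite (_ : [set t | _] = `[0, b[%classic); last first.
    by apply/seteqP; split => t /=; rewrite !in_itv /=; lra.
  by apply: eq_integral => t _; rewrite opprB addrA -[t + per - b]addrAC fp.
pose k := Num.floor (a / per).
have <- := main (a - k%:~R * per).
  by apply: eq_integral => t _; rewrite opprB addrA -addrAC periodic_int.
have := floor_itv (a / per); rewrite -/k intrD1 => /andP[].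
rewrite ler_pdivlMr// ltr_pdivrMr// mulrDl mul1r.
by lra.
Qed.

Lemma integral_arc_shift (a : R) (f : R -> \bar R) :
  measurable_fun (setT : set (measurableTypeR R)) f ->
  (forall t, f (t + 2 * pi) = f t) ->
  (\int[mu]_(t in arc) f (t - a)%R = \int[mu]_(t in arc) f t)%E.
Proof.
move=> mf fp; rewrite integralE [RHS]integralE.
have h1 := ge0_integral_arc_shift a (measurable_funepos mf) (funepos_ge0 f).
have h2 := ge0_integral_arc_shift a (measurable_funeneg mf) (funeneg_ge0 f).
have p1 t : (f^\+ (t + 2 * pi)%R = f^\+ t)%E by rewrite !funeposE fp.
have p2 t : (f^\- (t + 2 * pi)%R = f^\- t)%E by rewrite !funenegE fp.
rewrite -(h1 p1) -(h2 p2); congr (_ - _)%E; apply: eq_integral => t _.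
  by rewrite !funeposE.
by rewrite !funenegE.
Qed.

Lemma cmeasurable_shift (a : R) (f : R -> R[i]) :
  cmeasurable setT f -> cmeasurable setT (fun t => f (t - a)).
Proof.
move=> [m1 m2]; split.
- exact: (measurableT_comp m1 (measurable_shift a)).
- exact: (measurableT_comp m2 (measurable_shift a)).
Qed.

Lemma sqint_shift (a : R) (f : R -> R[i]) : sqint f -> sqint (fun t => f (t - a)).
Proof.
move=> [fp mf /integrableP[_ fi]]; have mfa := cmeasurable_shift a mf; split => //.
  by move=> t; rewrite addrAC fp.
apply/integrableP; split.
  by apply/measurable_EFinP/measurable_funTS; exact: measurable_sqmod.
apply: le_lt_trans fi; rewrite le_eqVlt; apply/orP; left; apply/eqP.
rewrite -[RHS](integral_arc_shift a)//.
  apply/measurableT_comp => //.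
  by apply/measurable_EFinP; exact: measurable_sqmod.
by move=> t /=; rewrite fp.
Qed.

Lemma cexp_translate (a : R) (f g : L2) (k : int) : is_translate a f g ->
  inner (cexp k) g = (expi (k%:~R * a))^*%C * inner (cexp k) f.
Proof.
move=> fg; have sk := sqint_expi (R := R) k.
have mk : cmeasurable setT (fun t : R => expi (k%:~R * t)) by case: sk.
have [fp mf _] := sqint_L2 f.
pose h t := (expi (k%:~R * t))^*%C * f t.
have mh : cmeasurable setT h by apply: cmeasurableM => //; exact: cmeasurable_conj.
have hp t : h (t + 2 * pi) = h t.
  by rewrite /h fp; case: sk => ->.
suff E : inner (cexp k) f = expi (k%:~R * a) * inner (cexp k) g.
  rewrite E mulrA sqmodE' (_ : sqmod _ = 1) ?mul1r//.
  by rewrite /sqmod /expi /= cos2Dsin2.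
rewrite inner_cexp -/h.
have -> : cintegral arc h = cintegral arc (fun t => h (t - a)).
  case: mh => m1 m2; rewrite /cintegral /Rintegral; congr (fine _ +i* fine _); apply/esym.
  - apply: (@integral_arc_shift a (fun t => (Re (h t))%:E)).
      by apply/measurable_EFinP.
    by move=> t; rewrite hp.
  - apply: (@integral_arc_shift a (fun t => (Im (h t))%:E)).
      by apply/measurable_EFinP.
    by move=> t; rewrite hp.
have mfa := cmeasurable_sqint arc (sqint_shift a (sqint_L2 f)).
rewrite -innerZr (@inner_aeq R _ _ (fun t => expi (k%:~R * t))
  (fun t => expi (k%:~R * a) * f (t - a))) //; last 4 first.
- exact: cmeasurable_sqint.
- by apply: cmeasurableM => //; exact: cmeasurable_cst.
- exact: mkL2E.
- apply: aeq_trans (L2scaleE _ _) _.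
  apply: (@filterS _ (almost_everywhere mu) (ae_filter_ringOfSetsType mu) _ _ _ fg).
  by move=> t h1 At; rewrite h1.
congr cintegral; apply/funext => t; rewrite /h mulrBr mulrA; congr (_ * _).
rewrite /expi cosB sinB; simpc; congr (_ +i* _); ring.
Qed.

(** A translation multiplies the k-th coefficient by a phase, which commutes with multiplication by
    the symbol; completeness of the exponentials turns equal coefficients into equal functions. *)
Lemma symbol_spatially_invariant (B : L2 -> L2) (b : int -> R[i]) :
  is_symbol B b -> spatially_invariant B.
Proof.
move=> Bb a f g fg.
have pi0 : (2 * pi)%:C != 0 :> R[i].
  by apply/negP => /eqP[] /eqP; rewrite gt_eqF// mulr_gt0// pi_gt0.
have Bc k h : inner (cexp k) (B h) = b k * inner (cexp k) h.
  by rewrite !fourierE Bb mulrCA.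
pose h := mkL2 (sqint_shift a (sqint_L2 (B f))).
have -> : B g = h.
  apply/subr0_eq/cexp_complete => k.
  rewrite innerBr Bc (cexp_translate k fg).
  rewrite (@cexp_translate a (B f) h k); last exact: mkL2E.
  by rewrite Bc mulrCA subrr.
exact: mkL2E.
Qed.

End Translation.

HB.instance Definition _ (R : realType) := isHilbert.Build R (L2T R) (@L2_complete R).

(** * The Fourier orthonormal basis and weak derivatives *)

Section FourierBasis.
Context {R : realType}.
Local Notation L2 := (L2T R).
Local Notation arc := (@Defs.arc R).
Local Notation mu := (@lebesgue_measure R).

(** Runs through 0, -1, 1, -2, 2, ..., as [Negz m] is -(m + 1). It links integer frequencies to the
    diagonal calculus, which is indexed by natural numbers. *)
Definition freq (n : nat) : int := if odd n then Negz n./2 else Posz n./2.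

Lemma freq_inj : injective freq.
Proof.
move=> m n; rewrite /freq.
case: ifP => om; case: ifP => on // -[h]; rewrite -(odd_double_half m) -(odd_double_half n).
  by rewrite om on h.
by rewrite om on h.
Qed.

Lemma freq_surj (k : int) : exists n, freq n = k.
Proof.
case: k => m; first by exists m.*2; rewrite /freq odd_double doubleK.
by exists m.*2.+1; rewrite /freq /= odd_double /= uphalf_double.
Qed.

Let r : R := (Num.sqrt (2 * pi))^-1.

Let twopi_gt0 : 0 < 2 * pi :> R. Proof. by rewrite mulr_gt0// pi_gt0. Qed.

Let r_neq0 : r%:C != 0 :> R[i].
Proof. by apply/negP => /eqP[] /eqP; rewrite invr_eq0 gt_eqF// sqrtr_gt0. Qed.

Definition efun (n : nat) : L2 := r%:C *: cexp (freq n).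

Lemma inner_efun n (x : L2) : inner (efun n) x = r%:C * inner (cexp (freq n)) x.
Proof. by rewrite innerZl conjc_real. Qed.

Lemma efun_basis : orthonormal_basis efun.
Proof.
split=> [i j|x hx].
  rewrite inner_efun innerZr inner_cexpE (inj_eq freq_inj).
  have [_|_] := eqVneq i j; last by rewrite !mulr0.
  rewrite -!rmorphM /= mulrA -expr2 exprVn sqr_sqrtr ?mulVf// ?gt_eqF//.
  exact: ltW.
apply: cexp_complete => k; have [n <-] := freq_surj k.
by have /eqP := hx n; rewrite inner_efun mulf_eq0 (negPf r_neq0) => /eqP.
Qed.

Lemma fourier_efun n (x : L2) :
  inner (efun n) x = (r * (2 * pi))%:C * fourier x (freq n).
Proof. by rewrite inner_efun fourierE mulrA -rmorphM. Qed.

Lemma diag_symbol (b : int -> R[i]) : bounded_seq (fun n => b (freq n)) ->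
  is_symbol (diag efun_basis (fun n => b (freq n))) b.
Proof.
move=> bb f k; have [n <-] := freq_surj k.
have c0 : (r * (2 * pi))%:C != 0 :> R[i].
  by rewrite fmorph_eq0 /r mulf_neq0 ?invr_eq0// gt_eqF// sqrtr_gt0.
by apply: (mulfI c0); rewrite [RHS]mulrCA -!fourier_efun inner_diag.
Qed.

Section RealFunctions.
Implicit Types phi : R -> R.

Lemma sqint_real phi : (forall t, phi (t + 2 * pi) = phi t) -> continuous phi ->
  sqint (fun t => (phi t)%:C).
Proof.
move=> pp cp; apply: sqint_continuous => [t|//|t]; first by rewrite pp.
exact: cvg_cst.
Qed.

Lemma inner_real phi (hs : sqint (fun t => (phi t)%:C)) (f : L2) :
  inner (mkL2 hs) f = cintegral arc (fun t => f t * (phi t)%:C).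
Proof.
rewrite (@inner_aeq R _ _ (fun t => (phi t)%:C) f); last 4 first.
- exact: cmeasurable_sqint.
- exact: cmeasurable_L2.
- exact: mkL2E.
- exact: aeq_refl.
by congr cintegral; apply/funext => t; rewrite conjc_real mulrC.
Qed.

Lemma cos_cont (k : int) : continuous (fun t : R => cos (k%:~R * t)).
Proof. by move=> t; apply: is_derive_cont; exact: is_derive_coslin. Qed.

Lemma sin_cont (k : int) : continuous (fun t : R => sin (k%:~R * t)).
Proof. by move=> t; apply: is_derive_cont; exact: is_derive_sinlin. Qed.

Let sqcos (k : int) := sqint_real (fun t => (trig_periodic k t).1) (@cos_cont k).
Let sqsin (k : int) := sqint_real (fun t => (trig_periodic k t).2) (@sin_cont k).

Let cexpE (k : int) : cexp k = mkL2 (sqcos k) + 'i%C *: mkL2 (sqsin k).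
Proof.
apply: L2P; apply: aeq_trans (mkL2E _) _; apply: aeq_sym.
apply: aeq_trans (L2addE _ _) _.
have FF := ae_filter_ringOfSetsType mu.
apply: (@filterS _ (almost_everywhere mu) FF _ _ _ (@filterI _ _ FF _ _ (mkL2E (sqcos k))
  (@filterI _ _ FF _ _ (mkL2E (sqsin k)) (L2scaleE 'i%C (mkL2 (sqsin k)))))).
move=> t [h1 [h2 h3]] At; rewrite h1// h3// h2// /expi.
by simpc.
Qed.

Let is_derive_trig (a b m t : R) :
  is_derive t 1 (fun t => a * cos (m * t) + b * sin (m * t))
    (m * b * cos (m * t) + - (m * a) * sin (m * t)).
Proof.
have h1 := is_deriveM' (is_derive_cst (a : R) t 1) (is_derive_coslin m t).
have h2 := is_deriveM' (is_derive_cst (b : R) t 1) (is_derive_sinlin m t).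
apply: (is_derive_conv (is_deriveD h1 h2)) => //.
by rewrite /cst; ring.
Qed.

Let derive1_trig (a b m t : R) :
  derive1 (fun t => a * cos (m * t) + b * sin (m * t)) t =
  m * b * cos (m * t) + - (m * a) * sin (m * t).
Proof. by rewrite derive1E; case: (is_derive_trig a b m t). Qed.

Let test_trig (a b : R) (k : int) :
  test_function (fun t => a * cos (k%:~R * t) + b * sin (k%:~R * t)).
Proof.
split=> [t|n]; first by have [-> ->] := trig_periodic k t.
suff [a' [b' ->]] : exists a' b', derive1n n (fun t => a * cos (k%:~R * t) + b * sin (k%:~R * t)) =
    (fun t => a' * cos (k%:~R * t) + b' * sin (k%:~R * t)).
  by move=> t; case: (is_derive_trig a' b' k%:~R t).
elim: n => [|n [a' [b' ih]]]; first by exists a, b.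
exists (k%:~R * b'), (- (k%:~R * a')); rewrite derive1nS ih.
by apply/funext => t; exact: derive1_trig.
Qed.

(** Test functions are real, so the exponential is reached by testing with cosine and sine
    separately and recombining. *)
Lemma weak_derivative_cexp (f g : L2) (k : int) : weak_derivative f g ->
  inner (cexp k) g = 'i%C * k%:~R * inner (cexp k) f.
Proof.
move=> fg.
pose C (x : L2) := inner (mkL2 (sqcos k)) x; pose S (x : L2) := inner (mkL2 (sqsin k)) x.
have wd (a b : R) : a%:C * C g + b%:C * S g =
    - (k%:~R * b)%:C * C f + (k%:~R * a)%:C * S f.
  have := fg _ (test_trig a b k).
  have tp := (test_trig a b k).1.
  have cont (c d : R) : continuous (fun t : R => c * cos (k%:~R * t) + d * sin (k%:~R * t)).
    move=> t; apply: cvgD; apply: cvgM; try exact: cvg_cst.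
      exact: cos_cont.
    exact: sin_cont.
  have lin (c d : R) (x : L2) : cintegral arc (fun t => x t * (c * cos (k%:~R * t) +
      d * sin (k%:~R * t))%:C) = c%:C * C x + d%:C * S x.
    rewrite -(inner_real (sqint_real (test_trig c d k).1 (cont c d))) /C /S.
    rewrite -[c%:C]conjc_real -[d%:C]conjc_real -!innerZl -innerDl; congr inner.
    apply: L2P; apply: aeq_trans (mkL2E _) _; apply: aeq_sym.
    apply: aeq_trans (L2addE _ _) _.
    have FF := ae_filter_ringOfSetsType mu.
    apply: (@filterS _ (almost_everywhere mu) FF _ _ _
      (@filterI _ _ FF _ _ (@filterI _ _ FF _ _ (mkL2E (sqcos k)) (mkL2E (sqsin k)))
      (@filterI _ _ FF _ _ (L2scaleE c%:C (mkL2 (sqcos k)))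
        (L2scaleE d%:C (mkL2 (sqsin k)))))).
    move=> t [[h1 h2] [h3 h4]] At; rewrite h3// h4// h1// h2//.
    by rewrite -!rmorphM -rmorphD.
  rewrite lin; under eq_fun do rewrite derive1_trig.
  rewrite lin => h; rewrite -[LHS]opprK -h rmorphN rmorphM /= rmorphM /=.
  by ring.
have kC : (k%:~R : R)%:C = k%:~R :> R[i] by rewrite rmorph_int.
have h1 := wd 1 0; have h2 := wd 0 1.
rewrite !mul1r !mul0r !mulr0 !mulr1 !oppr0 ?add0r ?addr0 mul0r add0r ?addr0 in h1.
rewrite !mul1r !mul0r !mulr0 !mulr1 mul0r ?add0r ?addr0 in h2.
rewrite cexpE !innerDl !innerZl -/(C g) -/(C f) -/(S g) -/(S f) h1 h2 kC.
have -> : ('i%C : R[i])^*%C = - 'i%C by simpc.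
have i2 : 'i%C * 'i%C = -1 :> R[i] by simpc.
transitivity (k%:~R * ('i%C * C f) - k%:~R * ('i%C * 'i%C) * S f); last by ring.
by rewrite i2; ring.
Qed.

(** Integration by parts over one period; the boundary terms cancel by periodicity. *)
Lemma cexp_derivative phi (k : int) (hs : sqint (fun t => (phi t)%:C))
    (hd : sqint (fun t => (derive1 phi t)%:C)) : test_function phi ->
  inner (cexp k) (mkL2 hd) = 'i%C * k%:~R * inner (cexp k) (mkL2 hs).
Proof.
move=> [pp dp].
have dphi (t : R) : is_derive t 1 phi (derive1 phi t).
  by apply: DeriveDef; [exact: (dp 0%N)|rewrite derive1E].
have cphi : continuous phi by move=> t; exact: is_derive_cont (dphi t).
have cdphi : continuous (derive1 phi).
  move=> t; apply: differentiable_continuous; apply/derivable1_diffP.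
  exact: (dp 1%N).
have conjE x : inner (cexp k) x = (inner x (cexp k))^*%C by rewrite inner_conj.
have val (h : R -> R) (hh : sqint (fun t => (h t)%:C)) : inner (cexp k) (mkL2 hh) =
    (\int[mu]_(t in arc) (cos (k%:~R * t) * h t)) +i*
    (\int[mu]_(t in arc) (- sin (k%:~R * t) * h t)).
  rewrite (@inner_aeq R _ _ (fun t => expi (k%:~R * t)) (fun t => (h t)%:C)); last 4 first.
  - by apply: cmeasurable_sqint; exact: sqint_expi.
  - exact: cmeasurable_sqint.
  - exact: mkL2E.
  - exact: mkL2E.
  by congr (_ +i* _); apply: eq_Rintegral => t _; rewrite /expi /=; ring.
have contM (u v : R -> R) : continuous u -> continuous v -> continuous (fun t => u t * v t).
  by move=> cu cv t; apply: cvgM; [exact: cu|exact: cv].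
have mA := measurable_arcR (R := R).
have ic h : continuous h -> mu.-integrable arc (EFin \o (fun t => cos (k%:~R * t) * h t)).
  by move=> ch; apply: integrable_arc; apply: contM => //; exact: cos_cont.
have is' h : continuous h -> mu.-integrable arc (EFin \o (fun t => sin (k%:~R * t) * h t)).
  by move=> ch; apply: integrable_arc; apply: contM => //; exact: sin_cont.
have ends (c : R -> R) : c (0 + 2 * pi) = c 0 -> c (2 * pi) * phi (2 * pi) - c 0 * phi 0 = 0.
  by move=> c0; rewrite -{1 2}[2 * pi]add0r c0 pp subrr.
have e1 : \int[mu]_(t in arc) (cos (k%:~R * t) * derive1 phi t) =
    k%:~R * \int[mu]_(t in arc) (sin (k%:~R * t) * phi t).
  apply/eqP; rewrite -subr_eq0 -RintegralZl//; last exact: is'.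
  rewrite -RintegralB//; [|exact: ic|exact: (integrableZl mA _ (is' _ cphi))].
  apply/eqP; rewrite -[RHS](ends (fun t => cos (k%:~R * t)) (trig_periodic k 0).1).
  apply: (@Rintegral_arc R (fun t => cos (k%:~R * t) * phi t)).
    move=> t; apply: (is_derive_conv (is_deriveM' (is_derive_coslin k%:~R t) (dphi t))) => //.
    by ring.
  move=> t; apply: cvgB; first by apply: cvgM; [exact: cos_cont|exact: cdphi].
  apply: cvgM; first exact: cvg_cst.
  by apply: cvgM; [exact: sin_cont|exact: cphi].
have e2 : \int[mu]_(t in arc) (- sin (k%:~R * t) * derive1 phi t) =
    k%:~R * \int[mu]_(t in arc) (cos (k%:~R * t) * phi t).
  apply/eqP; rewrite eq_sym -subr_eq0 -RintegralZl//; last exact: ic.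
  rewrite -RintegralB//; last 2 first.
  - exact: (integrableZl mA _ (ic _ cphi)).
  - have := integrableZl mA (-1) (is' _ cdphi); congr (_.-integrable _ _).
    by apply/funext => t /=; rewrite -EFinM mulrA mulN1r.
  apply/eqP; rewrite -[RHS](ends (fun t => sin (k%:~R * t)) (trig_periodic k 0).2).
  apply: (@Rintegral_arc R (fun t => sin (k%:~R * t) * phi t)).
    move=> t; apply: (is_derive_conv (is_deriveM' (is_derive_sinlin k%:~R t) (dphi t))) => //.
    by ring.
  move=> t; apply: cvgB.
    apply: cvgM; first exact: cvg_cst.
    by apply: cvgM; [exact: cos_cont|exact: cphi].
  apply: cvgM; last exact: cdphi.
  by apply: cvgN; exact: sin_cont.
have e3 : \int[mu]_(t in arc) (- sin (k%:~R * t) * phi t) =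
    - \int[mu]_(t in arc) (sin (k%:~R * t) * phi t).
  rewrite -mulN1r -RintegralZl//; last exact: is'.
  by apply: eq_Rintegral => t _; rewrite mulrA mulN1r.
have kC : k%:~R = (k%:~R : R)%:C :> R[i] by rewrite rmorph_int.
rewrite !val e1 e2 e3 kC; simpc.
by congr (_ +i* _); ring.
Qed.

(** The multipliers are moved by their adjoints onto the test function, whose derivative is
    classical. Boundedness of i k m expresses that the multiplier m maps into the domain of the
    derivative. *)
Lemma weak_derivative_diag (m : nat -> R[i]) (x : L2) : bounded_seq m ->
  bounded_seq (fun n => 'i%C * (freq n)%:~R * m n) ->
  weak_derivative (diag efun_basis m x)
    (diag efun_basis (fun n => 'i%C * (freq n)%:~R * m n) x).
Proof.
move=> bm bkm phi tphi; have [pp dp] := tphi.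
have dphi (t : R) : is_derive t 1 phi (derive1 phi t).
  by apply: DeriveDef; [exact: (dp 0%N)|rewrite derive1E].
have cphi : continuous phi by move=> t; exact: is_derive_cont (dphi t).
have cdphi : continuous (derive1 phi).
  move=> t; apply: differentiable_continuous; apply/derivable1_diffP.
  exact: (dp 1%N).
have pdphi (t : R) : derive1 phi (t + 2 * pi) = derive1 phi t.
  rewrite !derive1E -[in RHS](_ : (fun t => phi (t + 2 * pi)) = phi); last exact/funext.
  apply/esym/derive_val.
  apply: (is_derive_conv (is_derive1_comp (g := fun t => t + 2 * pi) (dphi (t + 2 * pi))
    (is_deriveD (is_derive_id t 1) (is_derive_cst (2 * pi) t 1)))) => //.
  by rewrite addr0 mulr1 derive1E.
have hs := sqint_real pp cphi; have hd := sqint_real pdphi cdphi.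
rewrite -(inner_real hd) -(inner_real hs) !diag_adjoint// -innerNl; congr inner.
apply: (basis_ext efun_basis) => n.
rewrite innerNr !inner_diag//; try exact: bounded_seq_conj.
rewrite !inner_efun (cexp_derivative (freq n) hs hd tphi).
rewrite (_ : ('i%C * (freq n)%:~R * m n)^*%C = - ('i%C * (freq n)%:~R) * (m n)^*%C).
  by ring.
rewrite rmorphM rmorphM -mulNr; congr (_ * _ * _); last exact: rmorph_int.
by rewrite /=; simpc.
Qed.

End RealFunctions.

End FourierBasis.

(** * Semigroups *)

Lemma is_derive_cvg {R : realType} (f : R -> R) (t v : R) :
  (fun h => h^-1 * (f (h + t) - f t)) @ 0^' --> v -> is_derive t 1 f v.
Proof.
move=> h; have E : (fun h : R => h^-1 *: ((f \o shift t) (h *: (1 : R)) - f t)) @ 0^' --> v.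
  rewrite (_ : (fun h : R => _) = (fun h => h^-1 * (f (h + t) - f t)))//.
  by apply/funext => k; rewrite /= /GRing.scale /= mulr1.
by apply: DeriveDef; [apply/cvg_ex; exists v|apply/cvg_lim].
Qed.

Section Semigroup.
Context {R : realType} {X : hilbertType R}.
Variable T : R -> {linear X -> X}.
Hypothesis T_c0 : c0_semigroup T.

Let T_bounded t : 0 <= t -> bounded_op (T t). Proof. by case: T_c0 => h _ _ _; exact: h. Qed.
Let T0 x : T 0 x = x. Proof. by case: T_c0. Qed.
Let TD s t x : 0 <= s -> 0 <= t -> T (s + t) x = T s (T t x).
Proof. by case: T_c0 => _ _ h _; exact: h. Qed.
Let T_right x : (fun t => hnorm (T t x - x)) @ 0^'+ --> (0 : R).
Proof. by case: T_c0. Qed.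

Lemma semigroup_right0 x (eps : R) : 0 < eps ->
  exists2 d : R, 0 < d & forall t, 0 <= t < d -> hnorm (T t x - x) < eps.
Proof.
move=> eps0; have /cvgrPdist_lt/(_ _ eps0) := @T_right x.
move=> -[d /= d0 hd]; exists d => // t /andP[t0 td].
move: t0; rewrite le_eqVlt => /predU1P[<-|t0]; first by rewrite T0 subrr hnorm0.
have := hd t; rewrite /ball_ /= sub0r normrN gtr0_norm// => /(_ td t0).
by rewrite sub0r normrN ger0_norm ?hnorm_ge0.
Qed.

(** Strong continuity at 0 bounds each orbit, not the operators. If no bound held near 0, there
    would be times t n -> 0 with unbounded operator norms although every orbit is bounded along
    them, against uniform boundedness. *)
Let locally_bounded : exists d M : R, [/\ 0 < d, 1 <= M &
  forall t, 0 <= t <= d -> forall x, hnorm (T t x) <= M * hnorm x].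
Proof.
apply: contrapT => hno.
have key (n : nat) : exists t, 0 <= t <= n.+1%:R^-1 /\
    ~ (forall x, hnorm (T t x) <= n.+1%:R * hnorm x).
  apply: contrapT => hn; apply: hno; exists n.+1%:R^-1, n.+1%:R; split => //.
  - by rewrite ler1n.
  - by move=> t ht; apply: contrapT => h; apply: hn; exists t.
have [t ht] := choice key.
have t_small (d : R) : 0 < d -> exists N, forall n, (N <= n)%N -> 0 <= t n < d.
  move=> d0; have /cvgrPdist_lt/(_ _ d0)[N _ hN] := @cvg_harmonic R.
  exists N => n Nn; have [/andP[h1 h2] _] := ht n; rewrite h1/=.
  apply: le_lt_trans h2 _; have := hN n Nn.
  by rewrite /= sub0r normrN gtr0_norm ?invr_gt0.
have [M hM] : exists M : R, forall n x, hnorm (T (t n) x) <= M * hnorm x.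
  apply: (@uniform_boundedness R X X (fun n => T (t n))).
    by move=> n; apply: T_bounded; have [/andP[]] := ht n.
  move=> x; have [d d0 hd] := semigroup_right0 x (ltr01 : 0 < (1 : R)).
  have [N hN] := t_small d d0.
  (* The sum takes care of the finitely many early times; from N on, [T (t n) x] is within 1 of
     x. *)
  exists (hnorm x + 1 + \sum_(i < N) hnorm (T (t i) x)) => n.
  have [nN|Nn] := ltnP n N.
    rewrite (bigD1 (Ordinal nN))//= addrA [X in _ <= X + _]addrC -addrA.
    rewrite lerDl !addr_ge0 ?hnorm_ge0//.
    by apply: sumr_ge0 => i _; exact: hnorm_ge0.
  have := hd _ (hN _ Nn) => /ltW h1.
  apply: (@le_trans _ _ (hnorm x + 1)).
    rewrite -[T (t n) x](subrK x) addrC; apply: le_trans (hnormD _ _) _.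
    by rewrite lerD2l.
  by rewrite lerDl; apply: sumr_ge0 => i _; exact: hnorm_ge0.
have [n hn] : exists n : nat, M < n.+1%:R.
  by exists (Num.truncn M); exact: truncnS_gt.
have [_ []] := ht n => x; apply: le_trans (hM n x) _.
by rewrite ler_wpM2r ?hnorm_ge0// ltW.
Qed.

Lemma semigroup_bounded_on (tau : R) : exists2 M : R, 0 <= M &
  forall t, 0 <= t <= tau -> forall x, hnorm (T t x) <= M * hnorm x.
Proof.
have [d [M [d0 M1 hM]]] := locally_bounded.
have M0 : 0 <= M by apply: le_trans M1.
have key n t : 0 <= t <= n%:R * d -> forall x, hnorm (T t x) <= M ^+ n * hnorm x.
  elim: n t => [|n ih] t /andP[t0 tn] x.
    rewrite mul0r in tn; have -> : t = 0 by apply/eqP; rewrite eq_le tn.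
    by rewrite T0 expr0 mul1r.
  have [td|dt] := leP t d.
    have h1 : hnorm (T t x) <= M * hnorm x by apply: hM; rewrite t0 td.
    apply: le_trans h1 _; rewrite ler_wpM2r ?hnorm_ge0// exprS ler_peMr//.
    by rewrite exprn_ege1.
  rewrite -[t](subrK d) addrC TD ?(ltW d0)//; last by rewrite subr_ge0 ltW.
  have h1 : hnorm (T d (T (t - d) x)) <= M * hnorm (T (t - d) x).
    by apply: hM; rewrite lexx ltW.
  apply: le_trans h1 _; rewrite exprS -mulrA ler_wpM2l//; apply: ih.
  move: tn; rewrite -natr1 mulrDl mul1r.
  by move=> ?; apply/andP; split; lra.
pose n := Num.truncn (tau / d).
exists (M ^+ n.+1) => [|t /andP[t0 tt] x]; first exact: exprn_ge0.
apply: key; rewrite t0 /=; apply: le_trans tt _.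
by rewrite -ler_pdivrMr// ltW// truncnS_gt.
Qed.

(* Extending the orbits evenly to negative times makes them continuous on the
   whole line. *)
Lemma semigroup_continuous x (t : R) :
  (fun s => hnorm (T `|s| x - T `|t| x)) @ t --> (0 : R).
Proof.
have [M M0 hM] := semigroup_bounded_on (`|t| + 1).
have bound (a b : R) : 0 <= a <= `|t| + 1 -> 0 <= b <= `|t| + 1 ->
    hnorm (T a x - T b x) <= M * hnorm (T `|a - b| x - x).
  wlog ba : a b / b <= a => [wl|].
    have [ba|/ltW ab] := leP b a; first exact: wl.
    by move=> ha hb; rewrite hnormB distrC; exact: wl.
  move=> /andP[a0 ha] /andP[b0 hb]; rewrite ger0_norm ?subr_ge0//.
  rewrite -{1}(subrK b a) (addrC (a - b)) TD ?subr_ge0// -linearB; apply: hM.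
  by rewrite b0.
apply/cvgrPdist_lt => eps eps0.
have M1 : 0 < M + 1 by rewrite ltr_wpDl.
have e1 : 0 < eps / (M + 1) by rewrite divr_gt0.
have [d d0 hd] := semigroup_right0 x e1.
have /cvgrPdist_lt hid : (fun s : R => s) @ t --> t by exact: cvg_id.
near=> s; rewrite sub0r normrN ger0_norm ?hnorm_ge0//.
have h1 : `|s - t| < 1 by rewrite distrC; near: s; exact: hid.
have h2 : `|s - t| < d by rewrite distrC; near: s; exact: hid.
have h3 := lerB_dist s t; have h4 := ler_dist_dist s t.
apply: le_lt_trans (bound _ _ _ _) _; [rewrite normr_ge0; lra|rewrite normr_ge0; lra|].
have := hd `| `|s| - `|t| |; rewrite normr_ge0/= => /(_ (le_lt_trans h4 h2)) h5.
have [->|Mn] := eqVneq M 0; first by rewrite mul0r.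
have Mp : 0 < M by rewrite lt_def Mn.
apply: (@lt_le_trans _ _ (M * (eps / (M + 1)))); first by rewrite ltr_pM2l.
by rewrite mulrCA ler_piMr ?(ltW eps0)// ler_pdivrMr// mul1r lerDl.
Unshelve. all: by end_near. Qed.

Section Functional.
Variables (l : X -> R) (L : R).
Hypothesis lB : forall x y, l (x - y) = l x - l y.
Hypothesis lZ : forall a x, l (a%:C *: x) = a * l x.
Hypothesis lL : forall x, `|l x| <= L * hnorm x.

(** Orbits are observed through bounded real-linear functionals, in practice the real and imaginary
    parts of an inner product. Vector-valued calculus thereby becomes calculus on the real line. *)
Lemma functional_semigroup_continuous x : continuous (fun t : R => l (T `|t| x)).
Proof.
move=> t; apply/cvgrPdist_le => eps eps0.
have L1 : 0 < `|L| + 1 by rewrite ltr_wpDl.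
have e1 : 0 < eps / (`|L| + 1) by rewrite divr_gt0.
have /cvgrPdist_le/(_ _ e1) := @semigroup_continuous x t.
apply: filterS => s; rewrite sub0r normrN ger0_norm ?hnorm_ge0// => hs.
rewrite -lB; apply: le_trans (lL _) _; rewrite hnormB.
apply: (@le_trans _ _ ((`|L| + 1) * hnorm (T `|s| x - T `|t| x))).
  by rewrite ler_wpM2r ?hnorm_ge0//; have := ler_norm L; lra.
by rewrite mulrC -ler_pdivlMr.
Qed.

(** The generator is only a right limit at 0. To the right of t, [T t] is applied to the difference
    quotient at 0. To the left, T t = T (t - h) T h puts T (t - h) in its place, so the uniform
    bound near t and the continuity of the orbit of z enter. *)
Lemma functional_semigroup_derive x z (t : R) : generator T x z -> 0 < t ->
  is_derive t 1 (fun s => l (T `|s| x)) (l (T t z)).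
Proof.
move=> gxz t0; apply: is_derive_cvg.
have [M M0 hM] := semigroup_bounded_on (t + 1).
have LL : 0 <= `|L| by [].
have lL' x' : `|l x'| <= `|L| * hnorm x'.
  by apply: le_trans (lL x') _; rewrite ler_wpM2r ?hnorm_ge0// ler_norm.
pose D h : X := (h^-1)%:C *: (T h x - x) - z.
have pos (h : R) : 0 < h -> h < 1 ->
    `|h^-1 * (l (T (h + t) x) - l (T t x)) - l (T t z)| <= `|L| * (M * hnorm (D h)).
  move=> h0 h1; rewrite -lB -lZ -lB; apply: le_trans (lL' _) _.
  rewrite ler_wpM2l// (addrC h t) TD ?(ltW t0) ?(ltW h0)//.
  by rewrite -linearB -linearZ -linearB; apply: hM; lra.
have neg (h : R) : 0 < h -> h < t -> h < 1 ->
    `|(- h)^-1 * (l (T (- h + t) x) - l (T t x)) - l (T t z)| <=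
    `|L| * (M * hnorm (D h) + hnorm (T `|t - h| z - T `|t| z)).
  move=> h0 ht h1; rewrite -lB -lZ -lB; apply: le_trans (lL' _) _.
  rewrite ler_wpM2l// (ger0_norm (ltW t0)) ger0_norm ?subr_ge0 ?(ltW ht)//.
  have -> : (- h)^-1%:C *: (T (- h + t) x - T t x) - T t z =
      T (t - h) (D h) + (T (t - h) z - T t z).
    have e : T (t - h) (T h x - x) = T t x - T (t - h) x.
      by rewrite linearB -TD ?subrK ?subr_ge0 ?ltW.
    rewrite addrA -linearD /D subrK linearZ e.
    by rewrite invrN rmorphN scaleNr -scalerN opprB [- h + t]addrC.
  apply: le_trans (hnormD _ _) _; rewrite lerD2r; apply: hM; lra.
apply/cvgrPdist_le => eps eps0.
have c0 : 0 < `|L| * M + `|L| + 1 by rewrite ltr_wpDl// addr_ge0// mulr_ge0.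
have e1 : 0 < eps / (`|L| * M + `|L| + 1) by rewrite divr_gt0.
have [d d0 hd] : exists2 d : R, 0 < d & forall h, 0 < h < d ->
    hnorm (D h) <= eps / (`|L| * M + `|L| + 1).
  have /cvgrPdist_le/(_ _ e1) := gxz.
  move=> -[d /= d0 hd]; exists d => // h /andP[h0 h1].
  have := hd h; rewrite /ball_ /= sub0r normrN gtr0_norm// => /(_ h1 h0).
  by rewrite sub0r normrN ger0_norm ?hnorm_ge0.
have /cvgrPdist_le/(_ _ e1) := @semigroup_continuous z t.
move=> -[d' /= d'0 hd'].
have hz (h : R) : 0 < h < d' -> hnorm (T `|t - h| z - T `|t| z) <= eps / (`|L| * M + `|L| + 1).
  move=> /andP[h0 h1]; have := hd' (t - h); rewrite /ball_ /= opprB addrCA subrr addr0.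
  rewrite gtr0_norm// => /(_ h1).
  by rewrite sub0r normrN ger0_norm ?hnorm_ge0.
have fin a b : 0 <= a <= eps / (`|L| * M + `|L| + 1) -> 0 <= b <= eps / (`|L| * M + `|L| + 1) ->
    `|L| * (M * a + b) <= eps.
  set q := eps / _ => /andP[a0 aq] /andP[b0 bq].
  have qE : eps = q * (`|L| * M + `|L| + 1) by rewrite /q mulfVK// gt_eqF.
  rewrite qE.
  have h1 : M * a <= M * q by rewrite ler_wpM2l.
  have h2 : `|L| * (M * a + b) <= `|L| * (M * q + q) by rewrite ler_wpM2l// lerD.
  apply: le_trans h2 _; have : 0 <= q by apply: le_trans aq.
  by nra.
have dn : \forall h \near (0 : R)^', h != 0 by exact: nbhs_dnbhs_neq.
have n1 : \forall h \near (0 : R)^', `|h| < d by exact: dnbhs0_lt.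
have n2 : \forall h \near (0 : R)^', `|h| < d' by exact: dnbhs0_lt.
have n3 : \forall h \near (0 : R)^', `|h| < t by exact: dnbhs0_lt.
have n4 : \forall h \near (0 : R)^', `|h| < 1 by exact: dnbhs0_lt.
near=> h.
have h_neq0 : h != 0 by near: h.
have h1 : `|h| < d by near: h.
have h2 : `|h| < d' by near: h.
have h3 : `|h| < t by near: h.
have h4 : `|h| < 1 by near: h.
rewrite distrC (ger0_norm (ltW t0)).
have [hp|hn|h0] := ltrgtP 0 h; last by rewrite -h0 eqxx in h_neq0.
  rewrite gtr0_norm// in h1 h2 h3 h4.
  rewrite [`|h + t|]ger0_norm; last by lra.
  apply: le_trans (pos _ hp h4) _.
  apply: (@le_trans _ _ (`|L| * (M * hnorm (D h) + 0))); first by rewrite addr0.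
  by apply: fin; rewrite ?lexx ?hnorm_ge0 ?hd ?hp ?(ltW e1).
rewrite ltr0_norm// in h1 h2 h3 h4.
have hp : 0 < - h by rewrite oppr_gt0.
rewrite [`|h + t|]ger0_norm; last by lra.
have := neg (- h) hp h3 h4; rewrite !opprK => h5.
apply: le_trans h5 _; apply: fin; rewrite ?hnorm_ge0 ?hd ?hp//.
by have := hz (- h); rewrite opprK hp h2; apply.
Unshelve. all: by end_near. Qed.

End Functional.

End Semigroup.

(** * Scalar energy estimates *)

Section HalfLine.
Context {R : realType}.
Local Notation mu := (@lebesgue_measure R).
Local Notation ray := (`[0%R, +oo[%classic : set (measurableTypeR R)).
Implicit Types (f g : R -> R).

Lemma rayE (t : R) : ray t <-> 0 <= t.
Proof. by rewrite /= in_itv /= andbT. Qed.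

Lemma measurable_ray : measurable ray. Proof. exact: measurable_itv. Qed.
#[local] Hint Resolve measurable_ray : core.

Lemma cvg_expRN (c : R) : 0 < c -> (fun t : R => expR (- c * t)) @ +oo --> (0 : R).
Proof.
move=> c0; apply/cvgrPdist_lt => eps eps0.
have /cvgrPdist_lt/(_ _ eps0)[M [Mr hM]] := @cvgr_expR R.
exists (M / c); split=> [|t ht]; first exact: num_real.
rewrite mulNr; apply: hM; move: ht.
by rewrite ltr_pdivrMr// mulrC.
Qed.

Lemma continuous_expRlin (c : R) : continuous (fun t : R => expR (c * t)).
Proof. by move=> t; apply: is_derive_cont; exact: is_derive_expRlin. Qed.

Lemma integral_expRN (c : R) : 0 < c ->
  (\int[mu]_(t in ray) (expR (- c * t))%:E = (c^-1)%:E)%E.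
Proof.
move=> c0; have cN : - c^-1 * - c = 1 :> R by rewrite mulrNN mulVf// gt_eqF.
have dF (t : R) : is_derive t 1 (fun t => - c^-1 * expR (- c * t)) (expR (- c * t)).
  have h := is_deriveM' (is_derive_cst (- c^-1 : R) t 1) (is_derive_expRlin (- c) t).
  by apply: (is_derive_conv h) => //; rewrite /cst mul0r add0r mulrA cN mul1r.
rewrite (@ge0_continuous_FTC2y _ _ (fun t => - c^-1 * expR (- c * t)) 0 0).
- by rewrite mulr0 expR0 mulr1 sub0e -EFinN opprK.
- by move=> t _; exact: expR_ge0.
- by apply: continuous_subspaceT; exact: continuous_expRlin.
- rewrite -[X in _ --> X](mulr0 (- c^-1)); apply: cvgM; first exact: cvg_cst.
  exact: cvg_expRN.
- by move=> t _; case: (dF t).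
- by apply: cvg_at_right_filter; exact: is_derive_cont (dF 0).
- by move=> t _; rewrite derive1E; case: (dF t).
Qed.

Lemma integrable_expRN (c : R) : 0 < c ->
  mu.-integrable ray (EFin \o (fun t => expR (- c * t))).
Proof.
move=> c0; apply/integrableP; split.
  apply/measurable_EFinP; apply: measurable_funTS; apply: continuous_measurable_fun.
  exact: continuous_expRlin.
under eq_integral do rewrite /= ger0_norm ?expR_ge0//.
by rewrite integral_expRN// ltry.
Qed.

Lemma Rintegral_expRN (c : R) : 0 < c ->
  \int[mu]_(t in ray) expR (- c * t) = c^-1.
Proof. by move=> c0; rewrite /Rintegral integral_expRN. Qed.

Lemma Rintegral_tail f (eps : R) : mu.-integrable ray (EFin \o f) -> 0 < eps ->
  exists2 B : R, 0 <= B & forall tau, B <= tau ->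
    `|\int[mu]_(t in ray) f t - \int[mu]_(t in `[0, tau]) f t| <= eps.
Proof.
move=> intf eps0.
have mf : measurable_fun ray f by apply/measurable_EFinP; case/integrableP : intf.
pose h n t : \bar R := (`|f t| * (n%:R < t)%R%:R)%:E.
have mh n : measurable_fun ray (h n).
  apply/measurable_EFinP/measurable_funM; first exact: measurableT_comp.
  apply: (measurableT_comp (f := fun b : bool => b%:R : R)) => //.
  by apply: measurable_fun_ltr => //; exact: measurable_cst.
have h0 n t : (0 <= h n t)%E by rewrite lee_fin mulr_ge0.
have hc (t : measurableTypeR R) : ray t -> h ^~ t @ \oo --> cst 0%E t.
  move=> _; apply: cvg_near_cst; near=> n; rewrite /h.
  suff -> : (n%:R < t) = false by rewrite mulr0.
  apply/negbTE; rewrite -leNgt; apply: le_trans (ltW (truncnS_gt t)) _.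
  by rewrite ler_nat; near: n; exists (Num.truncn t).+1.
have hb (t : measurableTypeR R) (n : nat) : ray t -> (`|h n t| <= (EFin \o (fun t => `|f t|%R)) t)%E.
  by move=> _; rewrite gee0_abs// lee_fin; case: (_ < _); rewrite ?mulr1 ?mulr0//.
have m0 : measurable_fun ray (cst 0%E : R -> \bar R) by exact: measurable_cst.
have [_ _] := @dominated_convergence _ _ R mu ray measurable_ray h (cst 0%E)
  (EFin \o (fun t => `|f t|)) mh m0 (aeW _ hc) (integrable_abse intf) (aeW _ hb).
rewrite integral0.
move=> /fine_cvgP[_ /cvgrPdist_le/(_ _ eps0)[n _ /(_ n (leqnn _))]].
rewrite /= sub0r normrN => hn.
exists n%:R => // tau ntau.
have tau0 : 0 <= tau by apply: le_trans ntau.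
rewrite (@Rintegral_itvB _ f (BLeft 0) +oo%O tau) ?bnd_simp//.
have sub : `]tau, +oo[%classic `<=` ray.
  by move=> t /=; rewrite !in_itv /= !andbT => /ltW; exact: le_trans.
have intf' : mu.-integrable `]tau, +oo[ (EFin \o f) by apply: integrableS intf.
apply: le_trans (le_normr_Rintegral _ intf') _ => //.
have hfin : (\int[mu]_(t in ray) h n t)%E \is a fin_num.
  apply/integrable_fin_num => //; apply: le_integrable (integrable_abse intf) => //.
  move=> t _; rewrite gee0_abs// /= lee_fin normr_id.
  by case: (_ < _); rewrite ?mulr1 ?mulr0.
apply: le_trans _ (le_trans (ler_norm _) hn).
rewrite -lee_fin /Rintegral fineK; last first.
  by apply: integrable_fin_num => //; exact: (integrable_abse intf').
rewrite fineK//.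
apply: (@le_trans _ _ (\int[mu]_(t in `]tau, +oo[) h n t)%E).
  rewrite le_eqVlt; apply/orP; left; apply/eqP; apply: eq_integral => t.
  rewrite inE /= in_itv /= andbT => taut.
  by rewrite /h (le_lt_trans ntau taut) mulr1.
by apply: ge0_subset_integral.
Unshelve. all: by end_near. Qed.

(** Stands in for a growth bound: if the integral I differed from r, then for all large tau the
    boundary term, and with it |g tau|, would stay above |I - r| / 2, and g^2 could not be
    integrable. *)
Lemma Rintegral_limit f g (omega r : R) : 0 < omega ->
  mu.-integrable ray (EFin \o f) -> mu.-integrable ray (EFin \o (fun t => g t ^+ 2)) ->
  (forall tau, 0 < tau -> \int[mu]_(t in `[0, tau]) f t = r - expR (- omega * tau) * g tau) ->
  \int[mu]_(t in ray) f t = r.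
Proof.
move=> om0 intf intg hfg; set I := Rintegral _ _ _.
apply/eqP/negPn/negP => Ir.
have e0 : 0 < `|I - r| / 2 by rewrite divr_gt0// normr_gt0 subr_eq0.
have [B B0 hB] := Rintegral_tail intf e0.
have big tau : B + 1 <= tau -> (`|I - r| / 2) ^+ 2 <= g tau ^+ 2.
  move=> Bt; have tau0 : 0 < tau by lra.
  have := hB tau; rewrite -/I (hfg _ tau0) => /(_ _) h1.
  have {}h1 : `|I - (r - expR (- omega * tau) * g tau)| <= `|I - r| / 2 by apply: h1; lra.
  have h2 : `|I - r| / 2 <= `|expR (- omega * tau) * g tau|.
    have := ler_normB (I - (r - expR (- omega * tau) * g tau)) (expR (- omega * tau) * g tau).
    rewrite (_ : _ - _ - _ = I - r); last by ring.
    by lra.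
  have h3 : `|expR (- omega * tau) * g tau| <= `|g tau|.
    rewrite normrM ler_piMl// ger0_norm ?expR_ge0// -[leRHS]expR0 ler_expR.
    by rewrite mulNr oppr_le0 mulr_ge0// ltW.
  rewrite -[leRHS]real_normK ?num_real// ler_pXn2r// ?nnegrE ?(ltW e0)//.
  exact: le_trans h2 h3.
have [_] := integrableP _ _ _ intg; apply/negP; rewrite -leNgt leye_eq; apply/eqP.
have sub : `[B + 1, +oo[%classic `<=` ray.
  by move=> t /=; rewrite !in_itv /= !andbT => h; apply: le_trans h; lra.
have mg : measurable_fun ray (fun t => (g t ^+ 2)%:E) by case/integrableP : intg.
apply/eqP; rewrite -leye_eq.
apply: (@le_trans _ _ (\int[mu]_(t in `[(B + 1)%R, +oo[) ((`|I - r| / 2) ^+ 2)%:E)%E).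
  rewrite integral_cst//= lebesgue_measure_itv /= ltry addye//.
  by rewrite gt0_muley// lte_fin exprn_gt0.
apply: (@le_trans _ _ (\int[mu]_(t in `[(B + 1)%R, +oo[) `|(g t ^+ 2)%:E|)%E).
  apply: ge0_le_integral => //.
  - by apply: measurableT_comp => //; exact: (measurable_funS measurable_ray sub mg).
  - move=> t; rewrite /= in_itv /= andbT => /big h.
    by rewrite lee_fin [leRHS]ger0_norm ?sqr_ge0.
apply: ge0_subset_integral => //.
exact: measurableT_comp.
Qed.

End HalfLine.

Section ScalarEnergy.
Context {R : realType}.
Local Notation mu := (@lebesgue_measure R).
Local Notation ray := (`[0%R, +oo[%classic : set (measurableTypeR R)).
Implicit Types (f g : R -> R).

(** Cutting [0, tau] into n equal pieces and adding up gives |W tau - W 0| <= K (tau / n) (P tau - P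
    0), for every n. This is a substitute for a vanishing derivative when W is not known to be
    differentiable. *)
Lemma increments_eq0 (W P : R -> R) (K tau : R) : 0 <= tau ->
  (forall a b, 0 <= a -> a <= b -> b <= tau ->
    `|W b - W a| <= K * (b - a) * (P b - P a)) -> W tau = W 0.
Proof.
move=> tau0 hW.
have key (n : nat) : `|W tau - W 0| * n.+1%:R <= K * tau * (P tau - P 0).
  pose s (k : nat) : R := k%:R * (tau / n.+1%:R).
  have q0 : 0 <= tau / n.+1%:R by rewrite divr_ge0.
  have sn : s n.+1 = tau by rewrite /s mulrC mulfVK// pnatr_eq0.
  have sS k : s k.+1 - s k = tau / n.+1%:R by rewrite /s -natr1; ring.
  have step k : (k <= n.+1)%N -> `|W (s k) - W 0| <= K * (tau / n.+1%:R) * (P (s k) - P 0).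
    elim: k => [_|k ih kn]; first by rewrite /s mul0r !subrr normr0 mulr0.
    have h1 := ih (ltnW kn).
    have h2 : `|W (s k.+1) - W (s k)| <= K * (tau / n.+1%:R) * (P (s k.+1) - P (s k)).
      rewrite -(sS k); apply: hW.
      - by rewrite mulr_ge0.
      - by rewrite -subr_ge0 sS.
      - by rewrite -sn ler_wpM2r// ler_nat.
    have := ler_normD (W (s k.+1) - W (s k)) (W (s k) - W 0).
    rewrite subrKA => h3; apply: le_trans h3 _.
    by apply: le_trans (lerD h2 h1) _; rewrite -mulrDr subrKA.
  have := step n.+1 (leqnn _); rewrite sn.
  rewrite -(ler_pM2r (_ : 0 < n.+1%:R))// => h; apply: le_trans h _.
  have : n.+1%:R != 0 :> R by rewrite pnatr_eq0.
  by move: (n.+1%:R) => m m0; rewrite le_eqVlt; apply/orP; left; apply/eqP; field.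
apply/eqP; rewrite -subr_eq0 -normr_eq0; apply/negPn/negP => h.
have h0 : 0 < `|W tau - W 0| by rewrite lt_def h normr_ge0.
pose q := K * tau * (P tau - P 0) / `|W tau - W 0|.
have := key (Num.truncn q); rewrite mulrC -ler_pdivlMr// leNgt => /negP; apply.
exact: truncnS_gt.
Qed.

Lemma expRN_diff (omega s t : R) : 0 <= omega -> 0 <= s -> s <= t ->
  0 <= expR (- omega * s) - expR (- omega * t) <= omega * (t - s).
Proof.
move=> om0 s0 st.
have h1 : expR (- omega * s) <= 1.
  by rewrite -[leRHS]expR0 ler_expR mulNr oppr_le0 mulr_ge0.
have h0 := expR_ge0 (- omega * s).
have -> : - omega * t = - omega * s + - omega * (t - s) by ring.
rewrite expRD; have h2 := expR_ge1Dx (- omega * (t - s)).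
have h3 : expR (- omega * (t - s)) <= 1.
  by rewrite -[leRHS]expR0 ler_expR mulNr oppr_le0 mulr_ge0// subr_ge0.
have h4 : 0 <= omega * (t - s) by rewrite mulr_ge0// subr_ge0.
by apply/andP; split; nra.
Qed.

(** As v is merely integrable, V need not be differentiable everywhere. Instead, the defect W of the
    identity is shown to have increments of second order: over ]a, b] the exponential varies by at
    most omega (b - a), and V by at most the integral of |v|. *)
Lemma Rintegral_expRN_by_parts (v : R -> R) (omega tau : R) : 0 <= omega -> 0 < tau ->
  mu.-integrable `[0, tau] (EFin \o v) ->
  let V t := \int[mu]_(s in `[0, t]) v s in
  \int[mu]_(t in `[0, tau]) (expR (- omega * t) * v t) =
  expR (- omega * tau) * V tau + omega * \int[mu]_(t in `[0, tau]) (expR (- omega * t) * V t).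
Proof.
move=> om0 tau0 iv V.
pose E t := expR (- omega * t).
have cE : continuous E by exact: continuous_expRlin.
have E1 t : 0 <= t -> `|E t| <= 1.
  move=> t0; rewrite ger0_norm ?expR_ge0// -[leRHS]expR0 ler_expR.
  by rewrite mulNr oppr_le0 mulr_ge0.
have mtau : measurable (`[0, tau] : set (measurableTypeR R)) by exact: measurable_itv.
have bounded_mul (h w : R -> R) (M : R) : mu.-integrable `[0, tau] (EFin \o w) ->
    measurable_fun (`[0, tau] : set (measurableTypeR R)) h ->
    (forall t, 0 <= t <= tau -> `|h t| <= M) ->
    mu.-integrable `[0, tau] (EFin \o (fun t => h t * w t)).
  move=> iw mh hM; have := integrableZl mtau M (integrable_abse iw).
  apply: le_integrable => //.
    apply/measurable_EFinP/measurable_funM => //.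
    by apply/measurable_EFinP; case/integrableP : iw.
  move=> t; rewrite /= in_itv /= => /hM h1; rewrite lee_fin.
  rewrite normrM [leRHS]ger0_norm ?ler_wpM2r// mulr_ge0//.
  by apply: le_trans h1.
have mE : measurable_fun (`[0, tau] : set (measurableTypeR R)) E.
  by apply: measurable_funTS; exact: continuous_measurable_fun.
have iEv : mu.-integrable `[0, tau] (EFin \o (fun t => E t * v t)).
  by apply: (bounded_mul _ _ 1) => // t /andP[t0 _]; exact: E1.
have cV : {within `[0, tau], continuous V}.
  exact: (parameterized_integral_continuous (ltW tau0) iv).
have iV : mu.-integrable `[0, tau] (EFin \o V) by exact: continuous_integrable_itv.
have iEV : mu.-integrable `[0, tau] (EFin \o (fun t => E t * V t)).
  by apply: (bounded_mul _ _ 1) => // t /andP[t0 _]; exact: E1.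
pose prim (f : R -> R) t := \int[mu]_(s in `[0, t]) f s.
have sub (a b : R) : 0 <= a -> b <= tau -> `]a, b]%classic `<=` (`[0, tau]%classic : set R).
  move=> a0 bt t /=; rewrite !in_itv /= => /andP[/ltW h1 h2].
  by rewrite (le_trans a0 h1) (le_trans h2 bt).
have incr (f : R -> R) (a b : R) : mu.-integrable `[0, tau] (EFin \o f) -> 0 <= a -> a <= b -> b <= tau ->
    prim f b - prim f a = \int[mu]_(s in `]a, b]) f s.
  move=> iff a0 ab bt; apply: Rintegral_itvB; rewrite ?bnd_simp//.
  apply: integrableS iff => //.
  by move=> t /=; rewrite !in_itv /= => /andP[-> h]; exact: le_trans h bt.
pose W t := prim (fun t => E t * v t) t - E t * V t - omega * prim (fun t => E t * V t) t.
have iav : mu.-integrable `[0, tau] (EFin \o (fun t => `|v t|)) by exact: integrable_abse iv.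
suff : W tau = W 0.
  rewrite /W /prim /V set_itv1 !Rintegral_set1 !mulr0 !subrr => /eqP.
  by rewrite subr_eq0 subr_eq => /eqP ->; rewrite addrC.
apply: (@increments_eq0 W (prim (fun t => `|v t|)) (2 * omega) tau (ltW tau0)) => a b a0 ab bt.
have b0 := le_trans a0 ab.
pose I := (`]a, b]%classic : set (measurableTypeR R)).
have mI : measurable I by exact: measurable_itv.
have on_I f : mu.-integrable `[0, tau] (EFin \o f) -> mu.-integrable I (EFin \o f).
  by move=> iff; apply: integrableS iff => //; exact: sub.
have cst_I c : mu.-integrable I (EFin \o fun=> c).
  apply: on_I; apply: continuous_integrable_itv.
  by apply: continuous_subspaceT => t; exact: cvg_cst.
set A := \int[mu]_(s in I) `|v s|.
have A0 : 0 <= A by apply: Rintegral_ge0.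
have muI : fine (mu I) = b - a.
  rewrite /I lebesgue_measure_itv /= lte_fin; case: ltP => // h.
  by have -> : b = a; [apply/eqP; rewrite eq_le h ab|rewrite subrr].
(* Freezing E at b and V at a splits E b V b - E a V a as E b (V b - V a) + V a (E b - E a) without
   remainder; each integrand then has one small factor. *)
have WE : W b - W a = \int[mu]_(t in I) ((E t - E b) * v t) -
    omega * \int[mu]_(t in I) (E t * (V t - V a)).
  have e1 : \int[mu]_(t in I) ((E t - E b) * v t) =
      \int[mu]_(t in I) (E t * v t) - E b * \int[mu]_(t in I) v t.
    rewrite -RintegralZl//; last exact: on_I.
    rewrite -RintegralB//; last 2 first.
    - exact: on_I.
    - exact: (integrableZl mI (E b) (on_I _ iv)).
    by apply: eq_Rintegral => t _; rewrite mulrBl.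
  have e2 : \int[mu]_(t in I) (E t * (V t - V a)) =
      \int[mu]_(t in I) (E t * V t) - V a * \int[mu]_(t in I) E t.
    have iE : mu.-integrable I (EFin \o E).
      by apply: on_I; apply: continuous_integrable_itv; exact: continuous_subspaceT.
    rewrite -RintegralZl// -RintegralB//; last 2 first.
    - exact: on_I.
    - exact: (integrableZl mI (V a) iE).
    by apply: eq_Rintegral => t _; ring.
  have e3 : omega * \int[mu]_(t in I) E t = E a - E b.
    have [ab'|ab'] := eqVneq a b.
      have -> : I = set0.
        apply/seteqP; split=> t //; rewrite /I ab' /= in_itv /= => /andP[h1 h2].
        by have := lt_le_trans h1 h2; rewrite ltxx.
      by rewrite Rintegral_set0 mulr0 ab' subrr.
    have iE : mu.-integrable I (EFin \o E).
      by apply: on_I; apply: continuous_integrable_itv; exact: continuous_subspaceT.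
    rewrite Rintegral_itv_obnd_cbnd// -RintegralZl//; last first.
      by apply: continuous_integrable_itv; exact: continuous_subspaceT.
    have dE (t : R) : is_derive t 1 (fun t => -1 * E t) (omega * E t).
      have h := is_deriveM' (is_derive_cst (-1 : R) t 1) (is_derive_expRlin (- omega) t).
      by apply: (is_derive_conv h) => //; rewrite /cst /E; ring.
    rewrite (@Rintegral_FTC2 R (fun t => -1 * E t))//.
    - by ring.
    - by apply: continuous_subspaceT => t; exact: is_derive_cont (dE t).
    - apply: continuous_subspaceT => t; apply: cvgM; first exact: cvg_cst.
      exact: cE.
  rewrite e1 e2 mulrBr mulrCA e3 -(incr _ a b iEv)// -(incr _ a b iEV)// -(incr _ a b iv)//.
  by rewrite /W /V -/(prim v a) -/(prim v b); ring.
have b1 : `|\int[mu]_(t in I) ((E t - E b) * v t)| <= omega * (b - a) * A.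
  have i1 : mu.-integrable I (EFin \o (fun t => (E t - E b) * v t)).
    have := integrableB mI (on_I _ iEv) (integrableZl mI (E b) (on_I _ iv)).
    by congr (_.-integrable _ _); apply/funext => t; rewrite /= mulrBl.
  apply: le_trans (le_normr_Rintegral mI i1) _.
  rewrite -RintegralZl//; last exact: on_I.
  apply: le_Rintegral => //; first exact: integrable_abse i1.
    exact: (integrableZl mI _ (on_I _ iav)).
  move=> t; rewrite /I /= in_itv /= => /andP[at' tb].
  have t0 : 0 <= t by apply: le_trans a0 (ltW at').
  rewrite normrM ler_wpM2r//.
  have /andP[h1 h2] := expRN_diff om0 t0 tb.
  rewrite ger0_norm//; apply: le_trans h2 _; rewrite ler_wpM2l//.
  by rewrite lerD2l lerN2 ltW.
have Vincr t : I t -> `|V t - V a| <= A.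
  rewrite /I /= in_itv /= => /andP[/ltW at' tb].
  have sub2 : `]a, t]%classic `<=` I.
    by move=> s /=; rewrite /I /= !in_itv /= => /andP[-> h]; exact: le_trans h tb.
  rewrite -/(prim v t) -/(prim v a) incr//; last exact: le_trans tb bt.
  have it : mu.-integrable `]a, t] (EFin \o v) by apply: integrableS (on_I _ iv).
  apply: le_trans (le_normr_Rintegral _ it) _ => //.
  rewrite /A -lee_fin /Rintegral !fineK//; last 2 first.
  - by apply: integrable_fin_num => //; exact: on_I.
  - by apply: integrable_fin_num => //; exact: integrable_abse it.
  apply: ge0_subset_integral => //.
  by case/integrableP : (on_I _ iav).
have b2 : `|omega * \int[mu]_(t in I) (E t * (V t - V a))| <= omega * (b - a) * A.
  have i2 : mu.-integrable I (EFin \o (fun t => E t * (V t - V a))).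
    have iE : mu.-integrable I (EFin \o E).
      by apply: on_I; apply: continuous_integrable_itv; exact: continuous_subspaceT.
    have := integrableB mI (on_I _ iEV) (integrableZl mI (V a) iE).
    by congr (_.-integrable _ _); apply/funext => t; rewrite /= mulrBr [V a * _]mulrC.
  rewrite normrM ger0_norm// -mulrA ler_wpM2l//.
  apply: le_trans (le_normr_Rintegral mI i2) _.
  rewrite -muI mulrC -Rintegral_cst//.
  apply: le_Rintegral => //; first exact: integrable_abse i2.
  move=> t It; have := It; rewrite /I /= in_itv /= => /andP[at' tb].
  have t0 : 0 <= t by apply: le_trans a0 (ltW at').
  rewrite normrM -[leRHS]mul1r; apply: ler_pM => //; first exact: E1.
  exact: Vincr.
rewrite WE (incr _ a b iav)// -/A.
apply: le_trans (ler_normB _ _) _; apply: le_trans (lerD b1 b2) _.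
by rewrite le_eqVlt; apply/orP; left; apply/eqP; ring.
Qed.

End ScalarEnergy.

(** * The modal Riccati equation and completion of squares *)

Section Riccati.
Context {R : realType}.

(* -lam is an eigenvalue of A; the root p >= 0 of p^2 + 2 lam p = gamma^2 is the
   corresponding eigenvalue of the Riccati operator, and -(lam + p) that of the
   closed loop. *)
Definition closed_loop_rate (gamma lam : R) : R := Num.sqrt (lam ^+ 2 + gamma ^+ 2).

Definition riccati (gamma lam : R) : R := closed_loop_rate gamma lam - lam.

Variables (gamma lam : R).
Hypotheses (gamma0 : 0 < gamma) (lam0 : 0 <= lam).

Local Notation omega := (closed_loop_rate gamma lam).
Local Notation p := (riccati gamma lam).

Lemma rate_sqr : omega ^+ 2 = lam ^+ 2 + gamma ^+ 2.
Proof. by rewrite sqr_sqrtr// addr_ge0 ?sqr_ge0. Qed.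

Lemma rate_ge_gamma : gamma <= omega.
Proof.
rewrite -(@ler_pXn2r _ 2%N)// ?nnegrE ?sqrtr_ge0 ?(ltW gamma0)//.
by rewrite rate_sqr lerDr sqr_ge0.
Qed.

Lemma rate_gt0 : 0 < omega. Proof. exact: lt_le_trans rate_ge_gamma. Qed.

Lemma rate_ge_lam : lam <= omega.
Proof.
rewrite -(@ler_pXn2r _ 2%N)// ?nnegrE ?sqrtr_ge0//.
by rewrite rate_sqr lerDl sqr_ge0.
Qed.

Lemma riccatiM : p * (omega + lam) = gamma ^+ 2.
Proof. by have := rate_sqr; rewrite /riccati !expr2 => h; lra. Qed.

Lemma riccati_energy : gamma ^+ 2 + p ^+ 2 = 2 * omega * p.
Proof. by have := rate_sqr; rewrite /riccati !expr2 => h; lra. Qed.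

Lemma riccati_ge0 : 0 <= p. Proof. by rewrite subr_ge0 rate_ge_lam. Qed.

Lemma riccati_le_gamma : p <= gamma.
Proof.
have h1 := rate_ge_gamma; have h2 := riccatiM; have h3 := riccati_ge0.
rewrite -(@ler_pM2r _ gamma)// -expr2 -h2 ler_wpM2l//.
by rewrite -[leLHS]addr0 lerD.
Qed.

End Riccati.

Section Energy.
Context {R : realType}.
Local Notation mu := (@lebesgue_measure R).
Local Notation ray := (`[0%R, +oo[%classic : set (measurableTypeR R)).
Let mray := @measurable_ray R.

(* M is the square of |h t - x0 e^(-omega t) z| when N = |h|^2, c = Re <z, h> and
   Z = |z|^2. *)
Lemma energy_bound (omega Z x0 r : R) (N c : R -> R) : 0 < omega ->
  mu.-integrable ray (EFin \o N) ->
  mu.-integrable ray (EFin \o (fun t => expR (- omega * t) * c t)) ->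
  \int[mu]_(t in ray) (expR (- omega * t) * c t) = r ->
  let M t := N t - 2 * x0 * (expR (- omega * t) * c t) +
             x0 ^+ 2 * Z * expR (- (2 * omega) * t) in
  (forall t, 0 <= t -> 0 <= M t) ->
  2 * x0 * r - x0 ^+ 2 * Z / (2 * omega) <= \int[mu]_(t in ray) N t /\
  (2 * x0 * r - x0 ^+ 2 * Z / (2 * omega) = \int[mu]_(t in ray) N t ->
   ae_eq mu ray M (fun=> 0)).
Proof.
move=> om0 iN ic hr M M0.
have om2 : 0 < 2 * omega by rewrite mulr_gt0.
have ie := integrable_expRN om2.
have i2 := integrableZl mray (2 * x0) ic.
have i3 := integrableZl mray (x0 ^+ 2 * Z) ie.
have i1 : mu.-integrable ray (EFin \o (fun t => N t - 2 * x0 * (expR (- omega * t) * c t))).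
  exact: (integrableB mray iN i2).
have iM : mu.-integrable ray (EFin \o M) by exact: (integrableD mray i1 i3).
have IM : \int[mu]_(t in ray) M t =
    \int[mu]_(t in ray) N t - (2 * x0 * r - x0 ^+ 2 * Z / (2 * omega)).
  rewrite /M RintegralD// RintegralB// !RintegralZl// hr Rintegral_expRN//.
  by ring.
split.
  rewrite -subr_ge0 -IM; apply: Rintegral_ge0 => t; rewrite rayE; exact: M0.
move=> /eqP; rewrite eq_sym -subr_eq0 -IM => /eqP IM0.
have : (\int[mu]_(t in ray) `|(EFin \o M) t| = 0)%E.
  transitivity (\int[mu]_(t in ray) M t)%:E; last by rewrite IM0.
  rewrite /Rintegral fineK; last exact: integrable_fin_num.
  apply: eq_integral => t; rewrite inE rayE => /M0 h.
  by rewrite gee0_abs// lee_fin.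
move=> /(ae_eq_integral_abs mu mray) h.
apply: (@filterS _ (almost_everywhere mu) (ae_filter_ringOfSetsType mu) _ _ _ (h _)).
  by move=> t ht /ht [].
by case/integrableP : iM.
Qed.

(** A nonzero value would persist on an interval to the right of t, which lies in the ray and has
    positive measure; looking to the right also covers t = 0. *)
Lemma ae0_continuous_ray (f : R -> R) : {within ray, continuous f} ->
  ae_eq mu ray f (fun=> 0) -> forall t, 0 <= t -> f t = 0.
Proof.
move=> cf [A [mA A0 sub]] t t0; apply/eqP/negPn/negP => ft.
have ft0 : 0 < `|f t| by rewrite normr_gt0.
have /subspace_continuousP/(_ t) := cf; rewrite rayE => /(_ t0)/cvgrPdist_lt/(_ _ ft0).
move=> -[d /= d0 hd].
have sub2 : `]t, (t + d)[%classic `<=` A.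
  move=> s; rewrite /= in_itv /= => /andP[ts st]; apply: sub => /= h.
  have s0 : ray s by rewrite rayE (le_trans t0 (ltW ts)).
  have := hd s; rewrite /ball_ /= distrC gtr0_norm ?subr_gt0// ltrBlDl => /(_ st s0).
  by rewrite /from_subspace (h s0) subr0 ltxx.
have : (mu `]t, (t + d)%R[ <= mu A)%E by apply: le_measure; rewrite ?inE//=.
rewrite A0 lebesgue_measure_itv /= lte_fin ltrDl d0 -EFinB addrAC subrr add0r.
by rewrite lee_fin leNgt d0.
Qed.

(** With c = gamma^2 x - p u, the relation p (om + lam) = gamma^2 rewrites c as p om x - p x', where
    x' = -lam x + u. So e^(-om t) c is formally the derivative of -p e^(-om t) x and integrates to p
    x0 whatever the control is. Then [energy_bound] applies with Z = gamma^2 + p^2. *)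
Lemma lqr_scalar (gamma lam x0 : R) (x u : R -> R) : 0 < gamma -> 0 <= lam ->
  {within ray, continuous x} -> measurable_fun ray u ->
  (forall t, 0 <= t -> x t = x0 + \int[mu]_(s in `[0, t]) (- lam * x s + u s)) ->
  let N t := gamma ^+ 2 * x t ^+ 2 + u t ^+ 2 in
  mu.-integrable ray (EFin \o N) ->
  riccati gamma lam * x0 ^+ 2 <= \int[mu]_(t in ray) N t /\
  (riccati gamma lam * x0 ^+ 2 = \int[mu]_(t in ray) N t ->
   (forall t, 0 <= t -> x t = expR (- closed_loop_rate gamma lam * t) * x0) /\
   ae_eq mu ray u (fun t => - riccati gamma lam * expR (- closed_loop_rate gamma lam * t) * x0)).
Proof.
move=> g0 l0 cx mu_ ode N iN.
set om := closed_loop_rate gamma lam; set p := riccati gamma lam.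
have om0 : 0 < om := rate_gt0 lam g0.
have pM : p * (om + lam) = gamma ^+ 2 by exact: riccatiM.
have pE : gamma ^+ 2 + p ^+ 2 = 2 * om * p by exact: riccati_energy.
pose E t := expR (- om * t).
pose c t := gamma ^+ 2 * x t - p * u t.
have Z0 : 0 <= 2 * om * p by rewrite -pE addr_ge0 ?sqr_ge0.
have N0 t : 0 <= N t by rewrite /N addr_ge0 ?sqr_ge0// mulr_ge0 ?sqr_ge0.
have mx : measurable_fun ray x by exact: subspace_continuous_measurable_fun.
have g2 : 0 < gamma ^+ 2 by rewrite exprn_gt0.
have mE : measurable_fun ray E.
  by apply: measurable_funTS; apply: continuous_measurable_fun; exact: continuous_expRlin.
have mc : measurable_fun ray c.
  by apply: measurable_funB; apply: measurable_funM => //; exact: measurable_cst.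
have ctl (t : R) : c t ^+ 2 <= (2 * om * p) * N t.
  rewrite -pE /c /N; have := sqr_ge0 (p * x t + u t); have := sqr_ge0 gamma.
  by have := sqr_ge0 (gamma * (p * x t + u t)); rewrite !expr2; nra.
have E2 (t : R) : E t ^+ 2 = expR (- (2 * om) * t).
  by rewrite expr2 -expRD; congr expR; ring.
have iEc : mu.-integrable ray (EFin \o (fun t => E t * c t)).
  have ie : mu.-integrable ray (EFin \o (fun t => expR (- (2 * om) * t))).
    by apply: integrable_expRN; rewrite mulr_gt0.
  have := integrableD mray ie (integrableZl mray (2 * om * p) iN).
  apply: le_integrable => //; first by apply/measurable_EFinP; exact: measurable_funM.
  move=> t _ /=; rewrite lee_fin.
  rewrite [leRHS]ger0_norm; last first.
    by rewrite addr_ge0 ?expR_ge0// mulr_ge0 ?Z0 ?N0.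
  apply: le_trans (lerD (lexx _) (ctl t)); rewrite -E2.
  have h1 := sqr_ge0 (E t - c t); have h2 := sqr_ge0 (E t + c t).
  have h3 := sqr_ge0 (E t); have h4 := sqr_ge0 (c t).
  by rewrite ler_norml; rewrite !expr2 in h1 h2 h3 h4 *; apply/andP; split; lra.
(* Finite cost makes the factor p x of the boundary term square integrable, as [Rintegral_limit]
   requires. *)
have ipx : mu.-integrable ray (EFin \o (fun t => (p * x t) ^+ 2)).
  have := integrableZl mray (p ^+ 2 / gamma ^+ 2) iN.
  apply: le_integrable => //.
    by apply/measurable_EFinP; apply: measurable_funX; apply: measurable_funM => //; exact: measurable_cst.
  move=> t _ /=; rewrite lee_fin ger0_norm ?sqr_ge0// ger0_norm; last first.
    by rewrite mulr_ge0 ?divr_ge0 ?sqr_ge0 ?N0.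
  rewrite /N mulrDr mulrA mulfVK ?gt_eqF// exprMn lerDl.
  by rewrite mulr_ge0 ?divr_ge0 ?sqr_ge0.
have key tau : 0 < tau -> \int[mu]_(t in `[0, tau]) (E t * c t) =
    p * x0 - expR (- om * tau) * (p * x tau).
  move=> tau0; pose v t := - lam * x t + u t.
  have mtau : measurable (`[0, tau] : set (measurableTypeR R)) by exact: measurable_itv.
  have sub : `[0, tau]%classic `<=` ray.
    by move=> t; rewrite rayE /= in_itv /= => /andP[].
  have cx' : {within `[0, tau], continuous x} by exact: continuous_subspaceW cx.
  have ix : mu.-integrable `[0, tau] (EFin \o x) by exact: continuous_integrable_itv.
  have i1 (a : R) : mu.-integrable `[0, tau] (EFin \o fun=> a).
    by apply: continuous_integrable_itv; apply: continuous_subspaceT => t; exact: cvg_cst.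
  have iu : mu.-integrable `[0, tau] (EFin \o u).
    have := integrableD mtau (i1 1) (integrableS mray mtau sub iN).
    apply: le_integrable => //.
      by apply/measurable_EFinP; exact: measurable_funS mu_.
    move=> t _ /=; rewrite lee_fin.
    have Nx : 0 <= gamma ^+ 2 * x t ^+ 2 by rewrite mulr_ge0 ?sqr_ge0.
    rewrite [leRHS]ger0_norm; last by rewrite addr_ge0 ?N0.
    rewrite ler_norml /N; have h1 := sqr_ge0 (1 - u t); have h2 := sqr_ge0 (1 + u t).
    by have h3 := sqr_ge0 (u t); rewrite !expr2 in h1 h2 h3 Nx *; apply/andP; split; lra.
  have ilx := integrableZl mtau (- lam) ix.
  have iv : mu.-integrable `[0, tau] (EFin \o v) by exact: (integrableD mtau ilx iu).
  have cE' : {within `[0, tau], continuous E}.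
    by apply: continuous_subspaceT; exact: continuous_expRlin.
  have iE : mu.-integrable `[0, tau] (EFin \o E) by exact: continuous_integrable_itv.
  have cEx : {within `[0, tau], continuous (fun t => E t * x t)}.
    apply/subspace_continuousP => t ht; apply: cvgM.
      by move/subspace_continuousP : cE'; apply.
    by move/subspace_continuousP : cx'; apply.
  have iEx : mu.-integrable `[0, tau] (EFin \o (fun t => E t * x t)).
    exact: continuous_integrable_itv.
  have := @Rintegral_expRN_by_parts R v om tau (ltW om0) tau0 iv.
  rewrite /= -/(E tau) => ibp.
  have VE : \int[mu]_(t in `[0, tau]) (expR (- om * t) * \int[mu]_(s in `[0, t]) v s) =
      \int[mu]_(t in `[0, tau]) (E t * x t - x0 * E t).
    apply: eq_Rintegral => t; rewrite inE /= in_itv /= => /andP[t0 _].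
    by rewrite (ode t t0) /v /E; ring.
  rewrite VE in ibp.
  have x0E := integrableZl mtau x0 iE.
  rewrite RintegralB// RintegralZl// in ibp.
  have EI : om * \int[mu]_(t in `[0, tau]) E t = 1 - E tau.
    rewrite -RintegralZl//.
    have dE (t : R) : is_derive t 1 (fun t => -1 * E t) (om * E t).
      have h := is_deriveM' (is_derive_cst (-1 : R) t 1) (is_derive_expRlin (- om) t).
      by apply: (is_derive_conv h) => //; rewrite /cst /E; ring.
    rewrite (@Rintegral_FTC2 R (fun t => -1 * E t))//.
    - by rewrite /E mulr0 expR0; ring.
    - exact: ltW.
    - by apply: continuous_subspaceT => t; exact: is_derive_cont (dE t).
    - apply: continuous_subspaceT => t; apply: cvgM; first exact: cvg_cst.
      exact: continuous_expRlin.
  have Vtau : \int[mu]_(s in `[0, tau]) v s = x tau - x0.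
    by rewrite (ode tau (ltW tau0)) /v; ring.
  rewrite Vtau in ibp.
  have iEv : mu.-integrable `[0, tau] (EFin \o (fun t => E t * v t)).
    have := integrable_abse iv; apply: le_integrable => //.
      apply/measurable_EFinP; apply: measurable_funM.
        exact: measurable_funS mE.
      by apply/measurable_EFinP; case/integrableP : iv.
    move=> t; rewrite /= in_itv /= lee_fin normr_id normrM => /andP[t0 _].
    rewrite ler_piMl// ger0_norm ?expR_ge0// -[leRHS]expR0 ler_expR.
    by rewrite mulNr oppr_le0 mulr_ge0// ltW.
  have cEq : \int[mu]_(t in `[0, tau]) (E t * c t) =
      \int[mu]_(t in `[0, tau]) (- p * (E t * v t) + p * om * (E t * x t)).
    by apply: eq_Rintegral => t _; rewrite /c /v -pM; ring.
  rewrite cEq.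
  have j1 := integrableZl mtau (- p) iEv; have j2 := integrableZl mtau (p * om) iEx.
  rewrite RintegralD// !RintegralZl// ibp.
  rewrite -/(E tau); move: EI; set A := \int[mu]_(t in _) (E t * x t).
  set B := \int[mu]_(t in _) E t => EI.
  have -> : om * (A - x0 * B) = om * A - x0 * (om * B) by ring.
  by rewrite EI; ring.
have lim := Rintegral_limit om0 iEc ipx key.
(* The completed square separates into a state part and a control part, so equality determines
   both. *)
have Msq t : N t - 2 * x0 * (E t * c t) + x0 ^+ 2 * (2 * om * p) * expR (- (2 * om) * t) =
    gamma ^+ 2 * (x t - E t * x0) ^+ 2 + (u t - - p * E t * x0) ^+ 2.
  by rewrite -pE -E2 /N /c; ring.
have M0 t : 0 <= t -> 0 <= N t - 2 * x0 * (expR (- om * t) * c t) +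
    x0 ^+ 2 * (2 * om * p) * expR (- (2 * om) * t).
  by move=> _; rewrite Msq addr_ge0 ?sqr_ge0// mulr_ge0 ?sqr_ge0.
have [h1 h2] := energy_bound om0 iN iEc lim M0.
have e : 2 * x0 * (p * x0) - x0 ^+ 2 * (2 * om * p) / (2 * om) = p * x0 ^+ 2.
  by field; rewrite gt_eqF.
rewrite e in h1 h2; split=> // /h2 {}h2.
have FF := ae_filter_ringOfSetsType mu.
have ax : ae_eq mu ray (fun t => x t - E t * x0) (fun=> 0).
  apply: (@filterS _ (almost_everywhere mu) FF _ _ _ h2) => t ht rt; apply/eqP.
  have := ht rt; rewrite Msq => /eqP.
  rewrite paddr_eq0 ?sqr_ge0 ?(mulr_ge0 (sqr_ge0 gamma)) ?sqr_ge0// mulf_eq0 (gt_eqF g2) /= sqrf_eq0.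
  by case/andP.
split.
  move=> t t0; apply/eqP; rewrite -subr_eq0; apply/eqP.
  apply: (@ae0_continuous_ray (fun t => x t - E t * x0)) => //.
  apply/subspace_continuousP => s rs; apply: cvgB.
    by move/subspace_continuousP : cx; apply.
  apply: cvgM; last exact: cvg_cst.
  by apply: cvg_within_filter; exact: continuous_expRlin.
apply: (@filterS _ (almost_everywhere mu) FF _ _ _ h2) => t ht rt; apply/eqP.
have := ht rt; rewrite Msq => /eqP.
rewrite paddr_eq0 ?sqr_ge0 ?(mulr_ge0 (sqr_ge0 gamma)) ?sqr_ge0// mulf_eq0 !sqrf_eq0.
by move=> /andP[_]; rewrite subr_eq0.
Qed.

End Energy.

(** * Diagonal semigroups and the closed loop *)

Section DiagonalSemigroup.
Context {R : realType} {V : hilbertType R}.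
Variable e : nat -> V.
Hypothesis basise : orthonormal_basis e.
Variables (om : nat -> R) (c : R).
Hypotheses (c_gt0 : 0 < c) (om_ge : forall n, c <= om n).

Let om_gt0 n : 0 < om n. Proof. exact: lt_le_trans (om_ge n). Qed.

Definition decay (t : R) (n : nat) : R := expR (- om n * `|t|).

Lemma decay_ge0 t n : 0 <= decay t n. Proof. exact: expR_ge0. Qed.

Lemma decay_le t n : decay t n <= expR (- c * `|t|).
Proof. by rewrite ler_expR !mulNr lerN2 ler_wpM2r. Qed.

Lemma decay_le1 t n : decay t n <= 1.
Proof.
by rewrite -[leRHS]expR0 ler_expR mulNr oppr_le0 mulr_ge0// ltW.
Qed.

Lemma decayD s t n : 0 <= s -> 0 <= t -> decay (s + t) n = decay s n * decay t n.
Proof.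
move=> s0 t0; rewrite /decay -expRD !ger0_norm ?addr_ge0//.
by congr expR; ring.
Qed.

Lemma decay_bounded t : bounded_seq (fun n => (decay t n)%:C).
Proof.
exists 1 => n; rewrite sqmodR expr_le1//; [exact: decay_le1|exact: decay_ge0].
Qed.

(** The bound om n ^ 2 t gives convergence of the difference quotients mode by mode but degenerates
    for large om n. The bound om n is the one that stays uniform after division by |s + om n| >= om
    n. *)
Lemma decay_slope t n : 0 < t ->
  0 <= t^-1 * (decay t n - 1) + om n <= om n ^+ 2 * t /\
  t^-1 * (decay t n - 1) + om n <= om n.
Proof.
move=> t0; have o0 := om_gt0 n; rewrite /decay gtr0_norm//.
set y := om n * t; have y0 : 0 < y by rewrite mulr_gt0.
rewrite mulNr -/y; set E := expR (- y).
have E1 : 1 - y <= E by have := expR_ge1Dx (- y).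
have E2 : E <= 1 - y + y ^+ 2.
  have e1 : 0 < 1 + y by lra.
  have e2 : E * (1 + y) <= 1.
    apply: (@le_trans _ _ (E * expR y)); first by rewrite ler_wpM2l ?expR_ge0// expR_ge1Dx.
    by rewrite /E -expRD addNr expR0.
  rewrite -(ler_pM2r e1); apply: le_trans e2 _.
  by have := exprn_gt0 3 y0; rewrite !exprS expr0; nra.
have e3 : om n = t^-1 * y by rewrite /y mulrCA mulVf ?mulr1// gt_eqF.
have e4 : om n ^+ 2 * t = t^-1 * y ^+ 2.
  by rewrite /y; field; rewrite gt_eqF.
rewrite e4 {1 2 3 4}e3 -!mulrDr; split.
  apply/andP; split; first by rewrite mulr_ge0 ?invr_ge0 ?(ltW t0)//; lra.
  by rewrite ler_pM2l ?invr_gt0//; lra.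
rewrite ler_pM2l ?invr_gt0// gerDr subr_le0 -[leRHS]expR0 ler_expR.
by rewrite oppr_le0 ltW.
Qed.

(* Even in t, so that orbits are continuous on the whole line. *)
Definition dsemigroup (t : R) : {linear V -> V} := diag basise (fun n => (decay t n)%:C).

Lemma inner_dsemigroup t x n :
  inner (e n) (dsemigroup t x) = (decay t n)%:C * inner (e n) x.
Proof. by apply: inner_diag; exact: decay_bounded. Qed.

Lemma hnorm_dsemigroup t x : hnorm (dsemigroup t x) <= expR (- c * `|t|) * hnorm x.
Proof.
apply: hnorm_diag_le; first exact: expR_ge0.
move=> n; rewrite sqmodR ler_pXn2r// ?nnegrE ?expR_ge0//.
exact: decay_le.
Qed.

Lemma dsemigroup_c0 : c0_semigroup dsemigroup.
Proof.
split=> [t _|x|s t x s0 t0|x].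
- exact: diag_bounded.
- apply: (basis_ext basise) => n.
  by rewrite inner_dsemigroup /decay normr0 mulr0 expR0 mul1r.
- apply: (basis_ext basise) => n.
  by rewrite !inner_dsemigroup decayD// rmorphM mulrA.
- have bd t : bounded_seq (fun n => (decay t n - 1)%:C).
    exists 1 => n; rewrite sqmodR -[leRHS](expr1n _ 2).
    have := decay_le1 t n; have := decay_ge0 t n => h1 h2.
    by rewrite -[leLHS]sqrrN ler_pXn2r// ?nnegrE; lra.
  rewrite (_ : (fun t => _) = fun t => hnorm (diag basise (fun n => (decay t n - 1)%:C) x)).
    apply: (cvg_diag0 basise (M := 1)).
      apply: nearW => t n; rewrite sqmodR -[leRHS](expr1n _ 2).
      have := decay_le1 t n; have := decay_ge0 t n => h1 h2.
      by rewrite -[leLHS]sqrrN ler_pXn2r// ?nnegrE; lra.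
    move=> n; have h : (fun t : R => om n * t) @ 0^'+ --> (0 : R).
      rewrite -[X in _ --> X](mulr0 (om n)); apply: cvgM; first exact: cvg_cst.
      exact: cvg_at_right_filter.
    apply: (squeeze_cvgr _ (cvg_cst _) h); near=> t.
    have t0 : 0 < t by near: t; exact: nbhs_right_gt.
    rewrite sqmod_ge0/= sqmodR.
    have [/andP[h1 _] _] := decay_slope n t0.
    have h2 : t * (t^-1 * (decay t n - 1) + om n) >= 0 by rewrite mulr_ge0// ltW.
    rewrite mulrDr mulrA mulfV ?gt_eqF// mul1r in h2.
    have h3 := decay_le1 t n; have h4 := decay_ge0 t n.
    by rewrite expr2; nra.
  apply/funext => t; congr hnorm; apply: (basis_ext basise) => n.
  by rewrite innerBr inner_dsemigroup inner_diag// rmorphB mulrBl mul1r.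
Unshelve. all: by end_near. Qed.

Lemma sqmod_shift_ge (s : R[i]) n : closed_rhp s ->
  om n ^+ 2 <= sqmod (s + (om n)%:C).
Proof.
case: s => a b; rewrite /closed_rhp /= /sqmod /= => a0.
have o0 := om_gt0 n; have := sqr_ge0 (b + 0); rewrite !expr2; nra.
Qed.

Lemma shift_neq0 (s : R[i]) n : closed_rhp s -> s + (om n)%:C != 0.
Proof.
by move=> hs; rewrite -sqmod_gt0; apply: lt_le_trans (sqmod_shift_ge n hs); rewrite exprn_gt0.
Qed.

Definition dresolvent_symbol (s : R[i]) n : R[i] := (s + (om n)%:C)^-1.

Lemma dresolvent_le (s : R[i]) n : closed_rhp s ->
  sqmod (dresolvent_symbol s n) <= (c^-1) ^+ 2.
Proof.
move=> hs; rewrite sqmodV exprVn lef_pV2 ?posrE ?exprn_gt0// ?sqmod_gt0 ?shift_neq0//.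
apply: le_trans (sqmod_shift_ge n hs).
by rewrite ler_pXn2r// ?nnegrE ?ltW.
Qed.

Lemma dresolvent_bounded (s : R[i]) : closed_rhp s -> bounded_seq (dresolvent_symbol s).
Proof. by move=> hs; exists (c^-1 ^+ 2) => n; exact: dresolvent_le. Qed.

Definition dresolvent (s : R[i]) : {linear V -> V} := diag basise (dresolvent_symbol s).

Lemma inner_dresolvent s x n : closed_rhp s ->
  inner (e n) (dresolvent s x) = (s + (om n)%:C)^-1 * inner (e n) x.
Proof. by move=> hs; apply: inner_diag; exact: dresolvent_bounded. Qed.

Lemma dsemigroup_resolvent s : closed_rhp s ->
  is_resolvent dsemigroup s (dresolvent s).
Proof.
move=> hs; split=> [|x|x y gxy].
- exact: diag_bounded.
(* The multiplier of the error of the difference quotient on the resolvent. Its slope factor is at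
   most om n <= |s + om n|, hence the common bound 1 required by [cvg_diag0]. *)
- pose m (t : R) n : R[i] := (t^-1 * (decay t n - 1) + om n)%:C * dresolvent_symbol s n.
  have m1 t n : 0 < t -> sqmod (m t n) <= 1.
    move=> t0; have [/andP[h1 _] h2] := decay_slope n t0.
    rewrite sqmodM sqmodR sqmodV ler_pdivrMr ?sqmod_gt0 ?shift_neq0// mul1r.
    apply: le_trans (sqmod_shift_ge n hs).
    by rewrite ler_pXn2r// ?nnegrE ltW.
  rewrite /generator.
  have E (t : R) : 0 < t -> (t^-1)%:C *: (dsemigroup t (dresolvent s x) - dresolvent s x) -
      (s *: dresolvent s x - x) = diag basise (m t) x.
    move=> t0; apply: (basis_ext basise) => n.
    rewrite inner_diag; last by exists 1 => k; exact: m1.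
    rewrite !innerBr !innerZr !innerBr inner_dsemigroup inner_dresolvent// /m.
    have h := shift_neq0 n hs; rewrite /dresolvent_symbol rmorphD rmorphM rmorphB rmorph1 /=.
    by move: (t^-1)%:C (decay t n)%:C => T d; field.
  have M0 : (fun t => hnorm (diag basise (m t) x)) @ 0^'+ --> (0 : R).
    apply: (cvg_diag0 basise (M := 1)).
      near=> t => n; apply: m1; near: t; exact: nbhs_right_gt.
    move=> n.
    have h : (fun t : R => om n ^+ 2 * t) @ 0^'+ --> (0 : R).
      rewrite -[X in _ --> X](mulr0 (om n ^+ 2)); apply: cvgM; first exact: cvg_cst.
      exact: cvg_at_right_filter.
    have h2 : (fun t : R => (om n ^+ 2 * t) ^+ 2 * sqmod (dresolvent_symbol s n)) @ 0^'+ --> (0 : R).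
      rewrite -[X in _ --> X](mul0r (sqmod (dresolvent_symbol s n))).
      apply: cvgM; last exact: cvg_cst.
      rewrite -[X in _ --> X](mulr0 0); under eq_fun do rewrite expr2.
      exact: cvgM.
    apply: (squeeze_cvgr _ (cvg_cst _) h2); near=> t.
    have t0 : 0 < t by near: t; exact: nbhs_right_gt.
    rewrite sqmod_ge0/= sqmodM sqmodR ler_wpM2r ?sqmod_ge0//.
    have [/andP[h3 h4] _] := decay_slope n t0.
    by rewrite ler_pXn2r// ?nnegrE//; apply: le_trans h4.
  apply: cvg_trans M0; apply: near_eq_cvg; near=> t.
  by rewrite E//; near: t; exact: nbhs_right_gt.
- apply: (basis_ext basise) => n.
  rewrite inner_dresolvent// innerBr innerZr.
  (* The pair (x, y) is known only through a limit in norm. The coefficient of y is found by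
     bounding w by the error d of the difference quotient and by the slope error of mode n, both of
     which vanish as t -> 0. *)
  suff -> : inner (e n) y = - (om n)%:C * inner (e n) x.
    by have := shift_neq0 n hs => h; field.
  apply/subr0_eq/eqP; rewrite -sqmod_eq0 eq_le sqmod_ge0 andbT.
  set w := sqmod _.
  have h : (fun t : R => om n ^+ 2 * t) @ 0^'+ --> (0 : R).
    rewrite -[X in _ --> X](mulr0 (om n ^+ 2)); apply: cvgM; first exact: cvg_cst.
    exact: cvg_at_right_filter.
  have h0 : (fun t => 2 * normsq ((t^-1)%:C *: (dsemigroup t x - x) - y) +
      2 * ((om n ^+ 2 * t) * (om n ^+ 2 * t) * sqmod (inner (e n) x))) @ 0^'+ --> (0 : R).
    rewrite -[X in _ --> X](_ : 2 * 0 + 2 * (0 * 0 * sqmod (inner (e n) x)) = 0); last by ring.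
    apply: cvgD; apply: cvgM; try exact: cvg_cst; first exact: hnorm_cvg0.
    by apply: cvgM; [exact: cvgM|exact: cvg_cst].
  rewrite -(cvg_lim _ h0)//; apply: limr_ge; first by apply/cvg_ex; eexists; exact: h0.
  near=> t; have t0 : 0 < t by near: t; exact: nbhs_right_gt.
  set d := _ - y.
  have -> : w = sqmod (- inner (e n) d +
      (t^-1 * (decay t n - 1) + om n)%:C * inner (e n) x).
    rewrite /w /d innerBr innerZr innerBr inner_dsemigroup.
    by congr sqmod; rewrite rmorphD rmorphM rmorphB rmorph1 /=; ring.
  apply: le_trans (sqmodD_le _ _) _; apply: lerD; rewrite ler_pM2l//.
    rewrite sqmodN; apply: le_trans (CauchySchwarz _ _) _.
    by rewrite (normsq_basis basise) mul1r.
  rewrite sqmodM sqmodR ler_wpM2r ?sqmod_ge0// -expr2.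
  have [/andP[h3 h4] _] := decay_slope n t0.
  by rewrite ler_pXn2r// ?nnegrE//; apply: le_trans h4.
Unshelve. all: by end_near. Qed.

Section Realization.
Context {Y : innerType R}.
Variable C : {linear V -> Y}.
Hypothesis C_bounded : bounded_op C.

Let id_bounded : bounded_op (idfun : {linear V -> V}).
Proof. by apply/bounded_opP; exists 1 => // x; rewrite mul1r. Qed.

Let zero_bounded : bounded_op (\0 : {linear V -> Y}).
Proof. by apply/bounded_opP; exists 0 => // x; rewrite hnorm0 mul0r. Qed.

(** The disturbance enters the state directly: with B the identity, the trace that defines the H2
    norm is the trace of the Gramian itself. *)
Definition dsystem : system V Y :=
  @System R V Y V dsemigroup idfun C \0 dsemigroup_c0 id_bounded C_bounded zero_bounded.

Lemma dsystem_transfer (Phi : R[i] -> V -> Y) :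
  (forall s, closed_rhp s -> forall v, Phi s v = C (dresolvent s v)) ->
  is_transfer_function dsystem Phi.
Proof.
move=> hPhi s hs; exists (dresolvent s); first exact: dsemigroup_resolvent.
by move=> v; rewrite hPhi//= addr0.
Qed.

End Realization.

End DiagonalSemigroup.

Section Variation.
Context {R : realType} {X : hilbertType R}.
Local Notation mu := (@lebesgue_measure R).
Variable T : R -> {linear X -> X}.
Hypothesis T_c0 : c0_semigroup T.
Variables (l : X -> R) (L : R).
Hypothesis lB : forall x y, l (x - y) = l x - l y.
Hypothesis lZ : forall a x, l (a%:C *: x) = a * l x.
Hypothesis lL : forall x, `|l x| <= L * hnorm x.

(** Truncated resolvent integral: e^(-omega t) T t (omega x - z) is the derivative of -e^(-omega t)
    T t x when the generator maps x to z. The case omega = 0 integrates an orbit. *)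
Lemma Rintegral_semigroup x z (omega tau : R) : generator T x z -> 0 <= tau ->
  \int[mu]_(t in `[0, tau]) (expR (- omega * t) * l (T `|t| (omega%:C *: x - z))) =
  l x - expR (- omega * tau) * l (T tau x).
Proof.
move=> gxz tau0; have T0 : T 0 x = x by case: T_c0.
have cl y : continuous (fun t : R => l (T `|t| y)).
  exact: (functional_semigroup_continuous T_c0 lB lL).
pose F (t : R) := - expR (- omega * t) * l (T `|t| x).
transitivity (F tau - F 0); last first.
  by rewrite /F ger0_norm// normr0 T0 mulr0 expR0; ring.
apply: Rintegral_FTC2; first exact: tau0.
- move=> t /andP[t0 _].
  have h1 : is_derive t 1 (fun t => - expR (- omega * t)) (omega * expR (- omega * t)).
    have h := is_deriveM' (is_derive_cst (-1 : R) t 1) (is_derive_expRlin (- omega) t).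
    by apply: (is_derive_conv h) => [s|]; rewrite /cst ?mulN1r//; ring.
  have h2 := functional_semigroup_derive T_c0 lB lZ lL gxz t0.
  apply: (is_derive_conv (is_deriveM' h1 h2)) => //.
  by rewrite gtr0_norm// linearB linearZ lB lZ; ring.
- apply: continuous_subspaceT => t; apply: cvgM; last exact: cl.
  by apply: cvgN; exact: continuous_expRlin.
- by apply: continuous_subspaceT => t; apply: cvgM; [exact: continuous_expRlin|exact: cl].
Qed.

End Variation.

(** * Gramian and H2 norm of a diagonal system *)

Section DiagonalGramian.
Context {R : realType} {V : hilbertType R}.
Local Notation mu := (@lebesgue_measure R).
Local Notation ray := (`[0%R, +oo[%classic : set (measurableTypeR R)).
Variable e : nat -> V.
Hypothesis basise : orthonormal_basis e.
Variables (om : nat -> R) (c : R).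
Hypotheses (c_gt0 : 0 < c) (om_ge : forall n, c <= om n).
Local Notation T := (dsemigroup basise om).
Local Notation Q := (dresolvent basise om).

Let closed_rhp0 : closed_rhp (0 : R[i]). Proof. by rewrite /closed_rhp /= lexx. Qed.

Section Functional.
Variables (l : V -> R) (L : R).
Hypothesis lB : forall x y, l (x - y) = l x - l y.
Hypothesis lZ : forall a x, l (a%:C *: x) = a * l x.
Hypothesis lL : forall x, `|l x| <= L * hnorm x.

Let l_decay t y : 0 <= t -> `|l (T t y)| <= `|L| * hnorm y * expR (- c * t).
Proof.
move=> t0; apply: le_trans (lL _) _; have := hnorm_dsemigroup basise om_ge t y.
rewrite (ger0_norm t0) => h; rewrite -mulrA [hnorm y * _]mulrC.
apply: (@le_trans _ _ (`|L| * hnorm (T t y))); first by rewrite ler_wpM2r ?hnorm_ge0// ler_norm.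
by rewrite ler_wpM2l.
Qed.

Lemma dsemigroup_continuous y : continuous (fun t : R => l (T t y)).
Proof.
move=> t; have := functional_semigroup_continuous (dsemigroup_c0 basise c_gt0 om_ge) lB lL (x := y).
rewrite (_ : (fun t : R => l (T `|t| y)) = (fun t => l (T t y))); first exact.
by apply/funext => s; rewrite /dsemigroup /decay normr_id.
Qed.

Lemma dsemigroup_integrable y : mu.-integrable ray (EFin \o (fun t => l (T t y))).
Proof.
have mray := @measurable_ray R.
have hi := integrableZl mray (`|L| * hnorm y) (integrable_expRN c_gt0).
apply: (le_integrable mray _ _ hi).
  apply/measurable_EFinP; apply: measurable_funTS; apply: continuous_measurable_fun.
  exact: dsemigroup_continuous.
move=> t; rewrite rayE => t0 /=; rewrite lee_fin [leRHS]ger0_norm ?l_decay//.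
by rewrite !mulr_ge0 ?hnorm_ge0 ?expR_ge0.
Qed.

Lemma Rintegral_dsemigroup y : \int[mu]_(t in ray) l (T t y) = l (Q 0 y).
Proof.
have mray := @measurable_ray R.
have c2 : 0 < c / 2 by rewrite divr_gt0.
(* The identity is wanted at omega = 0, whereas [Rintegral_limit] asks for a positive rate.
   Borrowing c / 2 from the decay rate c of the semigroup leaves g^2 below a multiple of e^(-c
   t). *)
pose g (t : R) := expR (c / 2 * t) * l (T t (Q 0 y)).
apply: (Rintegral_limit (g := g) c2 (dsemigroup_integrable y)).
  have hi := integrableZl mray ((`|L| * hnorm (Q 0 y)) ^+ 2) (integrable_expRN c_gt0).
  apply: (le_integrable mray _ _ hi).
    apply/measurable_EFinP; apply: measurable_funX.
    apply: measurable_funTS; apply: continuous_measurable_fun.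
    by move=> t; apply: cvgM; [exact: continuous_expRlin|exact: dsemigroup_continuous].
  move=> t; rewrite rayE => t0 /=; rewrite lee_fin [leRHS]ger0_norm; last first.
    by rewrite mulr_ge0 ?sqr_ge0 ?expR_ge0.
  rewrite ger0_norm ?sqr_ge0// /g exprMn.
  apply: (@le_trans _ _ (expR (c / 2 * t) ^+ 2 *
      (`|L| * hnorm (Q 0 y) * expR (- c * t)) ^+ 2)).
    rewrite ler_wpM2l ?sqr_ge0// -[leLHS]real_normK ?num_real//.
    by rewrite ler_pXn2r ?nnegrE ?mulr_ge0 ?hnorm_ge0 ?expR_ge0//; exact: l_decay.
  rewrite exprMn mulrCA ler_wpM2l ?sqr_ge0// -exprMn -expRD -expRM_natl ler_expR.
  have := mulr_ge0 (ltW c_gt0) t0; lra.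
move=> tau tau0.
have [_ gen _] := dsemigroup_resolvent basise c_gt0 om_ge closed_rhp0.
have h := Rintegral_semigroup (dsemigroup_c0 basise c_gt0 om_ge) lB lZ lL 0 (gen y) (ltW tau0).
rewrite /g mulrA -expRD -mulrDl addNr mul0r expR0 mul1r.
rewrite oppr0 mul0r expR0 mul1r in h; rewrite -h.
apply: eq_Rintegral => t; rewrite inE /= in_itv /= => /andP[t0 _].
by rewrite mul0r expR0 mul1r ger0_norm// !scale0r !sub0r opprK.
Qed.

End Functional.

Lemma cintegral_dsemigroup x y :
  cintegral ray (fun t => inner x (T t y)) = inner x (Q 0 y).
Proof.
have h : forall z, `|Re (inner x z)| <= hnorm x * hnorm z by move=> z; exact: Re_inner_le_hnorm.
have h' : forall z, `|Im (inner x z)| <= hnorm x * hnorm z by move=> z; exact: Im_inner_le_hnorm.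
apply: complexP => /=.
  apply: (Rintegral_dsemigroup _ _ h) => [a b|a z]; first by rewrite innerBr ReB.
  by rewrite innerZr ReZ.
apply: (Rintegral_dsemigroup _ _ h') => [a b|a z]; first by rewrite innerBr ImB.
by rewrite innerZr ImZ.
Qed.

End DiagonalGramian.

Section DiagonalH2.
Context {R : realType} {V : hilbertType R} {Y : innerType R}.
Local Notation mu := (@lebesgue_measure R).
Local Notation ray := (`[0%R, +oo[%classic : set (measurableTypeR R)).
Variable e : nat -> V.
Hypothesis basise : orthonormal_basis e.
Variables (om p : nat -> R) (c K : R).
Hypotheses (c_gt0 : 0 < c) (om_ge : forall n, c <= om n).
Hypotheses (p_ge0 : forall n, 0 <= p n) (p_le : forall n, 2 * om n * p n <= K).
Variables (C : {linear V -> Y}) (Cd : {linear Y -> V}).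
Hypotheses (C_bounded : bounded_op C) (CdC : is_adjoint C Cd).
Hypothesis C_energy : forall x, Cd (C x) = diag basise (fun n => (2 * om n * p n)%:C) x.

Let om_gt0 n : 0 < om n. Proof. exact: lt_le_trans (om_ge n). Qed.

Let z_ge0 n : 0 <= 2 * om n * p n. Proof. by rewrite !mulr_ge0 ?p_ge0 ?ltW. Qed.

Let K_ge0 : 0 <= K. Proof. exact: le_trans (p_le 0%N). Qed.

Let bounded_z : bounded_seq (fun n => (2 * om n * p n)%:C).
Proof. by exists (K ^+ 2) => n; rewrite sqmodR ler_pXn2r ?nnegrE. Qed.

Let bounded_p : bounded_seq (fun n => (p n)%:C).
Proof.
exists ((K / (2 * c)) ^+ 2) => n; have c2 : 0 < 2 * c by rewrite mulr_gt0.
rewrite sqmodR ler_pXn2r ?nnegrE ?divr_ge0 ?(ltW c2)// ler_pdivlMr//.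
by apply: le_trans (p_le n); rewrite mulrC ler_wpM2r// ler_pM2l.
Qed.

Let om2_ge n : 2 * c <= 2 * om n. Proof. by rewrite ler_pM2l. Qed.
Let c2_gt0 : 0 < 2 * c. Proof. by rewrite mulr_gt0. Qed.

(** On mode n the integrand is 2 om n p n e^(-2 om n t), whose integral is p n: [C_energy] is the
    Lyapunov equation with solution p. *)
Lemma dsystem_gramian : is_observability_gramian
  (S := dsystem basise c_gt0 om_ge C_bounded) (diag basise (fun n => (p n)%:C)).
Proof.
have bd := decay_bounded c_gt0 om_ge; have bd2 := decay_bounded c2_gt0 om2_ge.
have GE (t : R) y : 0 <= t -> dsemigroup basise om t (Cd (C (dsemigroup basise om t y))) =
    dsemigroup basise (fun n => 2 * om n) t (diag basise (fun n => (2 * om n * p n)%:C) y).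
  move=> t0; apply: (basis_ext basise) => n.
  rewrite (inner_dsemigroup basise c_gt0 om_ge) C_energy (inner_diag basise)//.
  rewrite (inner_dsemigroup basise c_gt0 om_ge) (inner_dsemigroup basise c2_gt0 om2_ge).
  rewrite (inner_diag basise)// mulrCA !mulrA -[_ * (decay om t n)%:C]mulrA -rmorphM.
  rewrite [_ * (_ * _)%:C]mulrC; congr (_%:C * _ * _).
  by rewrite /decay -expRD; congr expR; ring.
exists (dsemigroup basise om), Cd; split => //.
- move=> t t0 x y; rewrite (diag_adjoint basise)//; congr inner; congr diag.
  by apply/funext => n; rewrite conjc_real.
- have hK (t : R) : 0 <= t -> (opnorm (fun x => dsemigroup basise om t (Cd (C (dsemigroup basise om t x)))) <=
      (K * expR (- (2 * c) * t))%:E)%E.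
    move=> t0; apply: opnorm_le => [|x]; first by rewrite mulr_ge0 ?expR_ge0.
    rewrite GE//; apply: le_trans (hnorm_dsemigroup basise om2_ge _ _) _.
    rewrite ger0_norm// mulrAC mulrC ler_wpM2r ?expR_ge0//.
    apply: hnorm_diag_le => // n; rewrite sqmodR ler_pXn2r ?nnegrE//.
  (* The operator norm is bounded pointwise and compared by [le_lower_integral], which bypasses its
     measurability in t. *)
  apply: (@le_lt_trans _ _ (\int[mu]_(t in ray) (K * expR (- (2 * c) * t))%:E)%E).
    apply: le_lower_integral => t; rewrite rayE => t0; last exact: hK.
    by apply: ereal_sup_ubound; exists 0; rewrite /= ?linear0 hnorm0.
  have /integrableP[_] := integrableZl (@measurable_ray R) K (integrable_expRN c2_gt0).
  apply: le_lt_trans; apply: le_lower_integral => t _.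
    by rewrite lee_fin mulr_ge0 ?expR_ge0.
  by rewrite /= lee_fin ler_norm.
- move=> x y.
  transitivity (cintegral ray (fun t => inner x (dsemigroup basise (fun n => 2 * om n) t
      (diag basise (fun n => (2 * om n * p n)%:C) y)))).
    rewrite (cintegral_dsemigroup basise c2_gt0 om2_ge); congr inner.
    apply: (basis_ext basise) => n.
    rewrite (inner_dresolvent basise c2_gt0 om2_ge) ?(inner_diag basise)//; last first.
      by rewrite /closed_rhp /= lexx.
    rewrite add0r mulrA complexV -rmorphM /= mulKf// gt_eqF// mulr_gt0//.
  rewrite /cintegral; congr (_ +i* _); apply: eq_Rintegral => t; rewrite inE rayE => t0.
    exact: (congr1 (fun z => Re (inner x z)) (esym (GE t y t0))).
  exact: (congr1 (fun z => Im (inner x z)) (esym (GE t y t0))).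
Qed.

Lemma dsystem_H2norm (w : R) : (\sum_(0 <= n <oo) (p n)%:E = w%:E)%E ->
  is_system_H2norm (dsystem basise c_gt0 om_ge C_bounded) ((2 * pi)^-1 * w).
Proof.
move=> pw; split=> [v //|].
exists (diag basise (fun n => (p n)%:C)), idfun, w; split => //.
- exact: dsystem_gramian.
- by exists w; rewrite -pw; exact: trace_diag.
- by rewrite -pw; exact: trace_diag.
Qed.

End DiagonalH2.

(** * The optimal gain and its closed loop *)

Section ClosedLoop.
Context {R : realType}.
Variables (alpha gamma : R).
Local Notation L2 := (L2T R).
Local Notation diag := (diag efun_basis).

Definition mode_decay (n : nat) : R := alpha * (freq n)%:~R ^+ 2.
Definition mode_rate n : R := closed_loop_rate gamma (mode_decay n).
Definition mode_gain n : R := riccati gamma (mode_decay n).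

Local Notation lam := mode_decay.
Local Notation om := mode_rate.
Local Notation p := mode_gain.

Lemma diffusion_coef (f g : L2) n : diffusion alpha f g ->
  inner (efun n) g = - (lam n)%:C * inner (efun n) f.
Proof.
move=> [f1 [f2 [d1 d2 ->]]]; rewrite innerZr !inner_efun.
rewrite (weak_derivative_cexp _ d2) (weak_derivative_cexp _ d1).
have i2 : 'i%C * 'i%C = -1 :> R[i] by simpc.
rewrite /lam rmorphM rmorphXn rmorph_int expr2 /=.
transitivity (('i%C * 'i%C) * (alpha%:C * ((freq n)%:~R * (freq n)%:~R)) *
  ((Num.sqrt (2 * pi))^-1%:C * inner (cexp (freq n)) f)); first by ring.
by rewrite i2; ring.
Qed.

Hypotheses (alpha_gt0 : 0 < alpha) (gamma_gt0 : 0 < gamma).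

Lemma mode_decay_ge0 n : 0 <= lam n. Proof. by rewrite mulr_ge0 ?sqr_ge0// ltW. Qed.

Lemma diffusion_diag (m : nat -> R[i]) x : bounded_seq m ->
  bounded_seq (fun n => - (lam n)%:C * m n) ->
  diffusion alpha (diag m x) (diag (fun n => - (lam n)%:C * m n) x).
Proof.
move=> bm blm; have [M hM] := bm; have [M' hM'] := blm.
pose m1 n := 'i%C * (freq n)%:~R * m n; pose m2 n := 'i%C * (freq n)%:~R * m1 n.
have i2 : 'i%C * 'i%C = -1 :> R[i] by simpc.
have kC (k : int) : k%:~R = (k%:~R : R)%:C :> R[i] by rewrite rmorph_int.
have a0 : alpha != 0 by rewrite gt_eqF.
have E n : - (lam n)%:C * m n = alpha%:C * m2 n.
  rewrite /m2 /m1 /lam rmorphM rmorphXn rmorph_int expr2 /=.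
  transitivity (alpha%:C * (('i%C * 'i%C) * ((freq n)%:~R * (freq n)%:~R)) * m n); last by ring.
  by rewrite i2; ring.
have b2 n : sqmod (m2 n) <= M' / alpha ^+ 2.
  rewrite ler_pdivlMr ?exprn_gt0// mulrC -sqmodR -sqmodM -E; exact: hM'.
(* Interpolation between m and its second derivative multiplier, by k^2 <= 1 + k^4. *)
have b1 : bounded_seq m1.
  exists (M + M' / alpha ^+ 2) => n; apply: (@le_trans _ _ (sqmod (m n) + sqmod (m2 n))).
    rewrite /m2 /m1 !sqmodM kC sqmodR (_ : sqmod 'i%C = 1); last first.
      by rewrite /sqmod /= expr0n expr1n add0r.
    rewrite !mul1r mulrA -[X in _ <= X + _]mul1r -mulrDl ler_wpM2r ?sqmod_ge0//.
    by have := sqr_ge0 (((freq n)%:~R : R) ^+ 2 - 1); rewrite !expr2; nra.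
  by apply: lerD; [exact: hM|exact: b2].
exists (diag m1 x), (diag m2 x); split.
- exact: weak_derivative_diag.
- by apply: weak_derivative_diag => //; exists (M' / alpha ^+ 2).
- apply: (basis_ext efun_basis) => n; rewrite innerZr !(inner_diag efun_basis)//=.
    by rewrite mulrA -E.
  by exists (M' / alpha ^+ 2).
Qed.

Lemma mode_rate_ge n : gamma <= om n.
Proof. exact/rate_ge_gamma/gamma_gt0. Qed.

Lemma mode_rate_gt0 n : 0 < om n. Proof. exact: lt_le_trans (mode_rate_ge n). Qed.

Lemma mode_gain_ge0 n : 0 <= p n. Proof. by apply: riccati_ge0; exact: mode_decay_ge0. Qed.

Lemma mode_gain_le n : p n <= gamma.
Proof. exact: (riccati_le_gamma gamma_gt0 (mode_decay_ge0 n)). Qed.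

Lemma mode_rateE n : om n = lam n + p n.
Proof. by rewrite /om /p /riccati addrC subrK. Qed.

Lemma mode_energy n : gamma ^+ 2 + p n ^+ 2 = 2 * om n * p n.
Proof. exact: riccati_energy. Qed.

Lemma mode_energy_le n : 2 * om n * p n <= 2 * gamma ^+ 2.
Proof.
rewrite -mode_energy mulr_natl mulr2n lerD2l ler_pXn2r ?nnegrE ?mode_gain_ge0 ?(ltW gamma_gt0)//.
exact: mode_gain_le.
Qed.

Let freq_ge n : (n%:R : R) ^+ 2 <= 4 * (freq n)%:~R ^+ 2.
Proof.
have E : 4 * (freq n)%:~R ^+ 2 = (2 * `|(freq n)%:~R|) ^+ 2 :> R.
  by rewrite exprMn real_normK ?num_real//; congr (_ * _); rewrite expr2; ring.
rewrite E ler_pXn2r ?nnegrE ?mulr_ge0// -intr_norm -[2]/((2%:Z)%:~R) -intrM -[n%:R]/((n%:Z)%:~R).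
rewrite ler_int /freq; case: ifP => on.
  rewrite NegzE normrN /= -{1}(odd_double_half n) on -mul2n /=.
  by rewrite ger0_norm//; lia.
by rewrite ger0_norm// -{1}(odd_double_half n) on -mul2n; lia.
Qed.

(** Here p n = gamma^2 / (om n + lam n), and om n + lam n >= c (1 + n^2): gamma bounds om n, while
    alpha / 4 comes from n <= 2 |freq n|. The constant D = 4 gamma^2 / c comes from (n + 1)(n + 2)
    <= 4 (1 + n^2), which compares p n with a telescoping series. *)
Lemma mode_gain_summable : exists w : R, (\sum_(0 <= n <oo) (p n)%:E = w%:E)%E.
Proof.
have c0 : 0 < Num.min gamma (alpha / 4) by rewrite lt_min gamma_gt0 divr_gt0.
set c := Num.min _ _ in c0.
have cg : c <= gamma by rewrite /c ge_min lexx.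
have ca : c <= alpha / 4 by rewrite /c ge_min lexx orbT.
pose D := 4 * gamma ^+ 2 / c; have D0 : 0 <= D by rewrite divr_ge0 ?mulr_ge0 ?sqr_ge0 ?ltW.
have term n : p n <= D * (n.+1%:R^-1 - n.+2%:R^-1).
  have n0 : 0 <= n%:R :> R by [].
  have fge := freq_ge n.
  have h0 : 0 < om n + lam n by rewrite ltr_pwDl ?mode_rate_gt0 ?mode_decay_ge0.
  have h1 : c * (1 + n%:R ^+ 2) <= om n + lam n.
    rewrite mulrDr mulr1; apply: lerD; first exact: le_trans (mode_rate_ge n).
    apply: (@le_trans _ _ (alpha / 4 * n%:R ^+ 2)); first by rewrite ler_wpM2r ?sqr_ge0.
    by rewrite /lam -mulrA ler_pM2l// mulrC ler_pdivrMr// mulrC.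
  have h2 : p n * (om n + lam n) = gamma ^+ 2 by exact: riccatiM.
  rewrite -[n.+2%:R]natr1 -[n.+1%:R]natr1.
  have -> : D * ((n%:R + 1)^-1 - (n%:R + 1 + 1)^-1) = D / ((n%:R + 1) * (n%:R + 1 + 1)).
    by field; rewrite !gt_eqF//; lra.
  have d0 : 0 < (n%:R + 1) * (n%:R + 1 + 1) :> R by rewrite mulr_gt0//; lra.
  rewrite ler_pdivlMr// /D ler_pdivlMr// -h2 [leRHS]mulrCA -!mulrA ler_wpM2l ?mode_gain_ge0//.
  have p0 := mode_gain_ge0 n.
  apply: (@le_trans _ _ (4 * (c * (1 + n%:R ^+ 2)))); last by rewrite ler_pM2l.
  rewrite [leRHS]mulrCA mulrA [leLHS]mulrC ler_pM2l// expr2.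
  by have := sqr_ge0 (n%:R - 1 : R); rewrite !expr2; nra.
have part n : \sum_(0 <= i < n) p i <= D.
  apply: (@le_trans _ _ (D * (1 - n.+1%:R^-1))); last first.
    by rewrite ler_piMr// gerBl invr_ge0.
  elim: n => [|n ih]; first by rewrite big_geq// invr1 subrr mulr0.
  rewrite big_nat_recr//=; apply: le_trans (lerD ih (term n)) _.
  by rewrite -mulrDr addrA subrK.
have h : (\sum_(0 <= n <oo) (p n)%:E <= D%:E)%E.
  apply: lime_le.
    by apply: is_cvg_nneseries => n _ _; rewrite lee_fin mode_gain_ge0.
  by apply: nearW => n; rewrite sumEFin lee_fin.
have h' : (0 <= \sum_(0 <= n <oo) (p n)%:E)%E.
  by apply: nneseries_ge0 => n _ _; rewrite lee_fin mode_gain_ge0.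
exists (fine (\sum_(0 <= n <oo) (p n)%:E)%E); rewrite fineK// ge0_fin_numE//.
by apply: le_lt_trans h _; rewrite ltry.
Qed.

Definition lqr_gain : {linear L2 -> L2} := diag (fun n => (- p n)%:C).
Definition loop_state (s : R[i]) : {linear L2 -> L2} := dresolvent efun_basis om s.
Definition loop_control (s : R[i]) : {linear L2 -> L2} :=
  diag (fun n => (- p n)%:C * (s + (om n)%:C)^-1).

Lemma bounded_gain : bounded_seq (fun n => (- p n)%:C).
Proof.
exists (gamma ^+ 2) => n; rewrite sqmodR sqrrN ler_pXn2r ?nnegrE ?mode_gain_ge0 ?(ltW gamma_gt0)//.
exact: mode_gain_le.
Qed.

Let bounded_res s := @dresolvent_bounded _ om _ gamma_gt0 mode_rate_ge s.

Lemma inner_lqr_gain x n : inner (efun n) (lqr_gain x) = (- p n)%:C * inner (efun n) x.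
Proof. by apply: inner_diag; exact: bounded_gain. Qed.

Lemma loop_controlE s x : closed_rhp s -> loop_control s x = lqr_gain (loop_state s x).
Proof.
by move=> hs; apply/esym; exact: (diag_comp efun_basis x bounded_gain (bounded_res hs)).
Qed.

Lemma hnorm_lqr_gain x : hnorm (lqr_gain x) <= gamma * hnorm x.
Proof.
apply: hnorm_diag_le => [|n]; first exact: ltW.
rewrite sqmodR sqrrN ler_pXn2r ?nnegrE ?mode_gain_ge0 ?(ltW gamma_gt0)//.
exact: mode_gain_le.
Qed.

Lemma hnorm_loop_state s x : closed_rhp s -> hnorm (loop_state s x) <= gamma^-1 * hnorm x.
Proof.
move=> hs; apply: hnorm_diag_le => [|n]; first by rewrite invr_ge0 ltW.
exact: (dresolvent_le gamma_gt0 mode_rate_ge n hs).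
Qed.

Lemma lqr_gain_symbol :
  is_symbol lqr_gain (fun k => (- riccati gamma (alpha * k%:~R ^+ 2))%:C).
Proof. exact: (@diag_symbol _ (fun k => (- riccati gamma (alpha * k%:~R ^+ 2))%:C) bounded_gain). Qed.

Definition loop_state_symbol (s : R[i]) (k : int) : R[i] :=
  (s + (closed_loop_rate gamma (alpha * k%:~R ^+ 2))%:C)^-1.

Definition loop_control_symbol (s : R[i]) (k : int) : R[i] :=
  (- riccati gamma (alpha * k%:~R ^+ 2))%:C * loop_state_symbol s k.

Lemma loop_state_is_symbol s : closed_rhp s -> is_symbol (loop_state s) (loop_state_symbol s).
Proof. by move=> hs; exact: (@diag_symbol _ (loop_state_symbol s) (bounded_res hs)). Qed.

Lemma loop_control_is_symbol s : closed_rhp s ->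
  is_symbol (loop_control s) (loop_control_symbol s).
Proof.
move=> hs; apply: (@diag_symbol _ (loop_control_symbol s)).
by apply: bounded_seqM; [exact: bounded_gain|exact: bounded_res].
Qed.

Lemma loop_state_symbol_neq0 s k : closed_rhp s -> loop_state_symbol s k != 0.
Proof.
move=> hs; have [n <-] := freq_surj k; rewrite invr_eq0.
exact: (shift_neq0 gamma_gt0 mode_rate_ge n hs).
Qed.

Let in_Hinfty_le (Phi : R[i] -> {linear L2 -> L2}) (M : R) : 0 <= M ->
  (forall s, closed_rhp s -> forall x, hnorm (Phi s x) <= M * hnorm x) -> in_Hinfty Phi.
Proof.
move=> M0 h; apply: (@le_lt_trans _ _ M%:E); last by rewrite ltry.
by apply: ge_ereal_sup => _ [s hs <-]; apply: opnorm_le => //; exact: h.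
Qed.

Lemma lqr_gain_bounded : bounded_op lqr_gain. Proof. exact: diag_bounded. Qed.

Lemma loop_affine : affine_constraint alpha loop_state loop_control.
Proof.
move=> s hs th.
(* The bound lam n <= om n <= |s + om n| says that the closed-loop resolvent maps into the domain of
   the diffusion operator. *)
have blam : bounded_seq (fun n => - (lam n)%:C * (s + (om n)%:C)^-1).
  exists 1 => n; rewrite sqmodM sqmodN sqmodR sqmodV.
  have h := sqmod_shift_ge gamma_gt0 mode_rate_ge n hs.
  have h1 := mode_rate_gt0 n; have h2 : 0 < sqmod (s + (om n)%:C).
    by apply: lt_le_trans h; rewrite exprn_gt0.
  rewrite ler_pdivrMr// mul1r; apply: le_trans h.
  rewrite ler_pXn2r ?nnegrE ?mode_decay_ge0 ?(ltW h1)//.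
  by rewrite mode_rateE lerDl mode_gain_ge0.
exists (diag (fun n => - (lam n)%:C * (s + (om n)%:C)^-1) th).
  by apply: diffusion_diag => //; exact: bounded_res.
move=> eta; rewrite -innerBr; congr inner; apply: (basis_ext efun_basis) => n.
rewrite innerBr innerBr innerDr innerZr loop_controlE// inner_lqr_gain.
rewrite (inner_diag efun_basis)// (inner_dresolvent efun_basis gamma_gt0 mode_rate_ge)//.
have := shift_neq0 gamma_gt0 mode_rate_ge n hs.
rewrite mode_rateE rmorphN rmorphD /=.
by move: (lam n)%:C (p n)%:C => a b h; field.
Qed.

Lemma loop_feasible : h2_feasible alpha loop_state loop_control.
Proof.
split; [split|move=> s hs; split|split|exact: loop_affine].
- by apply: (in_Hinfty_le (M := gamma^-1)); [rewrite invr_ge0 ltW|move=> s hs x; exact: hnorm_loop_state].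
- apply: (in_Hinfty_le (M := gamma * gamma^-1)).
    by rewrite mulr_ge0 ?invr_ge0 ?(ltW gamma_gt0).
  move=> s hs x; rewrite loop_controlE//; apply: le_trans (hnorm_lqr_gain _) _.
  by rewrite -mulrA ler_pM2l// hnorm_loop_state.
- exact: symbol_spatially_invariant (loop_state_is_symbol hs).
- exact: symbol_spatially_invariant (loop_control_is_symbol hs).
- have bid : bounded_op (idfun : {linear L2 -> L2}).
    by apply/bounded_opP; exists 1 => // x; rewrite mul1r.
  exists (dsystem efun_basis gamma_gt0 mode_rate_ge bid); last by [].
  exact: dsystem_transfer.
- exists (dsystem efun_basis gamma_gt0 mode_rate_ge lqr_gain_bounded); last by [].
  by apply: dsystem_transfer => s hs v; exact: loop_controlE.
Qed.

(** The two weighted signals with the feedback u = K psi inserted. The control weight thus becomes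
    an observation of the state, and the realization of the objective has zero feedthrough. *)
Definition loop_output (x : L2) : L2 * L2 := (gamma%:C *: x, lqr_gain x).

Let loop_output_linear : linear loop_output.
Proof.
move=> a x y; rewrite /loop_output (linearP lqr_gain) scalerDr scalerA mulrC.
by rewrite -scalerA.
Qed.
HB.instance Definition _ := GRing.isLinear.Build R[i] L2 (L2 * L2)%type _ loop_output loop_output_linear.

Definition loop_output_adj (y : L2 * L2) : L2 := gamma%:C *: y.1 + lqr_gain y.2.

Let loop_output_adj_linear : linear loop_output_adj.
Proof.
move=> a x y; rewrite /loop_output_adj /= (linearP lqr_gain) !scalerDr.
by rewrite !scalerA [gamma%:C * a]mulrC addrACA.
Qed.
HB.instance Definition _ := GRing.isLinear.Build R[i] (L2 * L2)%type L2 _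
  loop_output_adj loop_output_adj_linear.

Lemma normsq_pair (y : L2 * L2) : normsq y = normsq y.1 + normsq y.2.
Proof. by rewrite /normsq -ReD. Qed.

Lemma loop_output_bounded : bounded_op loop_output.
Proof.
apply/bounded_opP; exists (2 * gamma) => [|x]; first by rewrite mulr_ge0 ?(ltW gamma_gt0).
rewrite hnorm_leR ?mulr_ge0 ?hnorm_ge0 ?(ltW gamma_gt0)// normsq_pair /= normsqZ sqmodR.
have h := hnorm_lqr_gain x.
rewrite hnorm_leR ?mulr_ge0 ?hnorm_ge0 ?(ltW gamma_gt0)// in h.
rewrite !exprMn hnorm_sq in h *; have := mulr_ge0 (sqr_ge0 gamma) (normsq_ge0 x).
by rewrite [2 ^+ 2]expr2; lra.
Qed.

Lemma loop_objective (w : R) : (\sum_(0 <= n <oo) (p n)%:E = w%:E)%E ->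
  is_h2_objective gamma loop_state loop_control ((2 * pi)^-1 * w).
Proof.
move=> pw; exists (dsystem efun_basis gamma_gt0 mode_rate_ge loop_output_bounded).
  apply: dsystem_transfer => s hs v.
  by rewrite loop_controlE// /weightC /weightD /loop_output; congr (_, _); rewrite /= ?addr0 ?add0r.
apply: (@dsystem_H2norm _ _ _ _ efun_basis _ p gamma (2 * gamma ^+ 2) _ _ _ _ _ loop_output_adj) => //.
- exact: mode_gain_ge0.
- exact: mode_energy_le.
- move=> x y; rewrite -[LHS]/(inner y.1 (gamma%:C *: x) + inner y.2 (lqr_gain x)).
  rewrite innerDl innerZl innerZr conjc_real; congr (_ + _).
  rewrite (diag_adjoint efun_basis _ _ bounded_gain); congr inner; congr diag.
  by apply/funext => n; rewrite conjc_real.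
- move=> x; apply: (basis_ext efun_basis) => n.
  rewrite innerDr innerZr /= !inner_lqr_gain innerZr.
  rewrite (inner_diag efun_basis); last first.
    exists ((2 * gamma ^+ 2) ^+ 2) => k; rewrite sqmodR ler_pXn2r ?nnegrE ?mode_energy_le//.
      by rewrite !mulr_ge0 ?mode_gain_ge0 ?(ltW (mode_rate_gt0 k)).
    by rewrite mulr_ge0 ?sqr_ge0.
  rewrite -mode_energy !mulrA -!rmorphM /= -mulrDl -rmorphD; congr (_%:C * _).
  by rewrite mulrNN.
Qed.

End ClosedLoop.

(** * Optimality in the H2 problem *)

Section GramianEnergy.
Context {R : realType} {U Y : innerType R}.
Local Notation mu := (@lebesgue_measure R).
Local Notation ray := (`[0%R, +oo[%classic : set (measurableTypeR R)).
Variables (S : system U Y) (L : {linear state S -> state S}).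
Hypothesis gramL : is_observability_gramian L.
Local Notation T := (@opT _ _ _ S).
Local Notation C := (opC S).

Let T_c0 := @opT_c0 _ _ _ S.

(** The absolute value extends orbits evenly, so that the energy is continuous on the whole line; on
    the ray it is the integrand of the quadratic form of the Gramian. *)
Definition output_energy (y : state S) (t : R) : R := normsq (C (T `|t| y)).

Lemma output_energy_continuous y : continuous (output_energy y).
Proof.
have [M M0 hM] := (bounded_opP C).1 (@opC_bounded _ _ _ S).
have ch : continuous (fun t : R => hnorm (C (T `|t| y))).
  move=> t; apply/cvgrPdist_le => eps eps0.
  have c0 : (fun s => M * hnorm (T `|s| y - T `|t| y)) @ t --> (0 : R).
    rewrite -[X in _ --> X](mulr0 M); apply: cvgM; first exact: cvg_cst.
    exact: semigroup_continuous.
  move/cvgrPdist_le : c0 => /(_ _ eps0); apply: filterS => s; rewrite sub0r normrN ger0_norm ?mulr_ge0 ?hnorm_ge0//; apply: le_trans.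
  have h (a b : Y) : hnorm a - hnorm b <= hnorm (a - b).
    by rewrite lerBlDr -{1}(subrK b a); exact: hnormD.
  apply: (@le_trans _ _ (hnorm (C (T `|s| y) - C (T `|t| y)))).
    by rewrite ler_norml lerNl opprB h hnormB h.
  by rewrite -linearB.
rewrite (_ : output_energy y = fun t => hnorm (C (T `|t| y)) * hnorm (C (T `|t| y))).
  by move=> t; apply: cvgM; exact: ch.
by apply/funext => t; rewrite /output_energy -hnorm_sq expr2.
Qed.

Let measurable_energy y : measurable_fun ray (output_energy y).
Proof.
apply: measurable_funTS; apply: continuous_measurable_fun.
exact: output_energy_continuous.
Qed.

(** This is where convergence of the Gramian in operator norm enters: for |y| <= 1 the energy is the
    inner product of y with the Gramian integrand at y, hence below its operator norm. The general
    case follows by scaling with r = 1 + |y|, which also covers y = 0. *)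
Lemma output_energy_integrable y : mu.-integrable ray (EFin \o output_energy y).
Proof.
have mray := @measurable_ray R.
have [Td [Cd [TTd CCd Gfin _]]] := gramL.
have small x : hnorm x <= 1 -> mu.-integrable ray (EFin \o output_energy x).
  move=> x1; apply/integrableP; split; first exact/measurable_EFinP.
  apply: le_lt_trans Gfin; apply: le_lower_integral => t; rewrite rayE => t0 //=.
  rewrite ger0_norm ?normsq_ge0// /output_energy ger0_norm//.
  rewrite /normsq CCd TTd//.
  apply: (@le_trans _ _ (hnorm (Td t (Cd (C (T t x)))))%:E); last first.
    by apply: ereal_sup_ubound; exists x.
  rewrite lee_fin; apply: le_trans (ler_norm _) _; apply: le_trans (Re_inner_le_hnorm _ _) _.
  by rewrite ler_piMr// hnorm_ge0.
pose r := 1 + hnorm y; have r0 : 0 < r by rewrite ltr_pwDl// hnorm_ge0.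
have := integrableZl mray (r ^+ 2) (small (r^-1%:C *: y) _); rewrite hnormZR gtr0_norm ?invr_gt0//.
rewrite ler_pdivrMl// mulr1 lerDr ler01 => /(_ isT).
congr (_.-integrable _ _); apply/funext => t /=; rewrite -EFinM /output_energy !linearZ normsqZ sqmodR.
by rewrite mulrA -exprMn mulfV ?gt_eqF// expr1n mul1r.
Qed.

Lemma Rintegral_output_energy y :
  \int[mu]_(t in ray) output_energy y t = Re (inner y (L y)).
Proof.
have [Td [Cd [TTd CCd _ ->]]] := gramL.
rewrite /cintegral /=; apply: eq_Rintegral => t; rewrite inE rayE => t0.
by rewrite /output_energy ger0_norm// /normsq CCd TTd// inner_conj Re_conj.
Qed.

Variable z : Y.
Local Notation l := (fun y => Re (inner z (C y))).

Let lB x y : l (x - y) = l x - l y. Proof. by rewrite /= linearB innerBr ReB. Qed.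
Let lZ (a : R) x : l (a%:C *: x) = a * l x. Proof. by rewrite /= linearZ innerZr ReZ. Qed.
Let lL : exists M, forall x, `|l x| <= M * hnorm x.
Proof.
have [M M0 hM] := (bounded_opP C).1 (@opC_bounded _ _ _ S).
exists (hnorm z * M) => x; apply: le_trans (Re_inner_le_hnorm _ _) _.
by rewrite -mulrA ler_wpM2l ?hnorm_ge0.
Qed.

Lemma output_functional_continuous y : continuous (fun t : R => Re (inner z (C (T `|t| y)))).
Proof. by have [M hM] := lL; exact: (functional_semigroup_continuous T_c0 lB hM). Qed.

Lemma output_functional_integrable (omega : R) y : 0 < omega ->
  mu.-integrable ray (EFin \o (fun t => expR (- omega * t) * Re (inner z (C (T `|t| y))))).
Proof.
move=> om0; have mray := @measurable_ray R.
have o2 : 0 < 2 * omega by rewrite mulr_gt0.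
have hi := integrableD mray (integrableZl mray (normsq z) (integrable_expRN o2))
  (output_energy_integrable y).
apply: (le_integrable mray _ _ hi).
  apply/measurable_EFinP; apply: measurable_funTS; apply: continuous_measurable_fun => t.
  by apply: cvgM; [exact: continuous_expRlin|exact: output_functional_continuous].
move=> t _ /=; rewrite lee_fin [leRHS]ger0_norm ?addr_ge0 ?mulr_ge0 ?normsq_ge0 ?expR_ge0//.
have -> : expR (- (2 * omega) * t) = expR (- omega * t) ^+ 2.
  by rewrite -expRM_natl; congr expR; ring.
rewrite normrM (ger0_norm (expR_ge0 _)) /output_energy -!hnorm_sq.
apply: (@le_trans _ _ (expR (- omega * t) * (hnorm z * hnorm (C (T `|t| y))))).
  by rewrite ler_wpM2l ?expR_ge0// Re_inner_le_hnorm.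
have := sqr_ge0 (hnorm z * expR (- omega * t) - hnorm (C (T `|t| y))).
have h1 : 0 <= expR (- omega * t) * (hnorm z * hnorm (C (T `|t| y))).
  by rewrite !mulr_ge0 ?expR_ge0 ?hnorm_ge0.
by rewrite sqrrB exprMn; lra.
Qed.

(** The Laplace transform of the output at the real point omega is the transfer function. The
    semigroup may grow, so the boundary term is removed by the finite output energy of [Q x] through
    [Rintegral_limit]. *)
Lemma Rintegral_output_functional (omega : R) (Q : {linear state S -> state S}) x :
  0 < omega -> is_resolvent T omega%:C Q ->
  \int[mu]_(t in ray) (expR (- omega * t) * Re (inner z (C (T `|t| x)))) =
  Re (inner z (C (Q x))).
Proof.
move=> om0 [_ gen _]; have mray := @measurable_ray R; have [M hM] := lL.
apply: (Rintegral_limit (g := fun t => Re (inner z (C (T `|t| (Q x))))) om0).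
- exact: output_functional_integrable.
- have hi := integrableZl mray (normsq z) (output_energy_integrable (Q x)).
  apply: (le_integrable mray _ _ hi).
    apply/measurable_EFinP; apply: measurable_funX.
    apply: measurable_funTS; apply: continuous_measurable_fun.
    exact: output_functional_continuous.
  move=> t _ /=; rewrite lee_fin [leLHS]ger0_norm ?sqr_ge0//.
  rewrite [leRHS]ger0_norm ?mulr_ge0 ?normsq_ge0//.
  exact: Re_inner_le.
- move=> tau tau0; rewrite gtr0_norm//.
  have := Rintegral_semigroup T_c0 lB lZ hM omega (gen x) (ltW tau0).
  by rewrite subKr.
Qed.

End GramianEnergy.

(** A strict inequality in one term would push the second sum above w; finiteness of the remaining
    terms of a keeps the comparison strict. *)
Lemma eq_nneseries_termwise {R : realType} (a b : nat -> R) (w : R) :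
  (forall n, 0 <= a n <= b n) -> (\sum_(0 <= n <oo) (a n)%:E = w%:E)%E ->
  (\sum_(0 <= n <oo) (b n)%:E <= w%:E)%E -> forall n, a n = b n.
Proof.
move=> ab aw bw n.
have a0 k : (0 <= (a k)%:E)%E by rewrite lee_fin; have /andP[] := ab k.
have b0 k : (0 <= (b k)%:E)%E by rewrite lee_fin; have /andP[h1 h2] := ab k; exact: le_trans h2.
have ableE k : ((a k)%:E <= (b k)%:E)%E by rewrite lee_fin; have /andP[] := ab k.
apply/eqP; rewrite eq_le; have /andP[_ ->] := ab n; rewrite /= leNgt; apply/negP => lt_ab.
have h : (\sum_(0 <= k <oo | k != n) (a k)%:E <= \sum_(0 <= k <oo | k != n) (b k)%:E)%E.
  by apply: lee_nneseries => [k _ _|k _]; [exact: a0|exact: ableE].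
have := aw; rewrite (@nneseriesD1 _ _ n)// => aw'.
have : (\sum_(0 <= k <oo | k != n) (a k)%:E)%E \is a fin_num.
  rewrite ge0_fin_numE; last by apply: nneseries_ge0 => k _ _.
  apply: le_lt_trans (ltry w); rewrite -aw'; exact: leeDr.
move: bw; rewrite (@nneseriesD1 _ _ n)// -aw' => bw fa.
move: bw; apply/negP; rewrite -ltNge.
by apply: lte_leD => //; rewrite lte_fin.
Qed.

Lemma integrable_nondecreasing_eq0 {R : realType} (W : R -> R) :
  (forall t, 0 <= t -> 0 <= W 0 <= W t) ->
  (@lebesgue_measure R).-integrable (`[0%R, +oo[%classic : set (measurableTypeR R)) (EFin \o W) ->
  W 0 = 0.
Proof.
move=> hW /integrableP[_ fin]; apply/eqP; rewrite eq_le.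
have /andP[W0 _] := hW 0 (lexx _); rewrite W0 andbT leNgt; apply/negP => Wp.
move: fin; apply/negP; rewrite -leNgt leye_eq; apply/eqP/eqP.
rewrite -leye_eq.
apply: (@le_trans _ _ (\int[@lebesgue_measure R]_(t in `[0%R, +oo[) (W 0)%:E)%E).
  rewrite integral_cst//= lebesgue_measure_itv/= ltry.
  by rewrite /= mulr_infty gtr0_sg// mul1e.
apply: le_lower_integral => t; first by rewrite lee_fin.
rewrite rayE => t0 /=; rewrite lee_fin; have /andP[_ h] := hW t t0.
by apply: le_trans h (ler_norm _).
Qed.

Section ModalUniqueness.
Context {R : realType} {U Y : innerType R}.
Local Notation mu := (@lebesgue_measure R).
Local Notation ray := (`[0%R, +oo[%classic : set (measurableTypeR R)).
Variables (S : system U Y) (L : {linear state S -> state S}).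
Hypothesis gramL : is_observability_gramian L.
Local Notation T := (@opT _ _ _ S).
Local Notation C := (opC S).
Let T_c0 := @opT_c0 _ _ _ S.

(* D t = <y, C T(t) Q x> - e^(-omega t) <y, z> / (s + omega) solves D' = s D with
   Re s >= 0, so |D|^2 is nondecreasing; being integrable, it vanishes. *)
Lemma output_resolvent (omega : R) (s : R[i]) (Q : {linear state S -> state S}) x z :
  0 < omega -> closed_rhp s -> is_resolvent T s Q ->
  (forall t, 0 <= t -> C (T t x) = (expR (- omega * t))%:C *: z) ->
  C (Q x) = (s + omega%:C)^-1 *: z.
Proof.
move=> om0 hs [_ gen _] hx; apply: inner_ext => y; apply/subr0_eq.
have s_om : s + omega%:C != 0.
  rewrite -sqmod_gt0; have := hs; rewrite /closed_rhp /=; case: s {hs gen} => a b /= a0.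
  by rewrite /sqmod /= ltr_pwDl ?sqr_ge0// exprn_gt0// ltr_wpDl.
pose q := (s + omega%:C)^-1 * inner y z.
pose D (t : R) : R[i] := inner y (C (T `|t| (Q x))) - (expR (- omega * t))%:C * q.
have qE : inner y z = (s + omega%:C) * q by rewrite /q mulVKf.
have T0 u : T 0 u = u by case: T_c0.
suff D0 : D 0 = 0.
  rewrite innerZr -/q; move: D0; rewrite /D normr0 T0 mulr0 expR0 mul1r.
  by [].
have [M M0 hM] := (bounded_opP C).1 (@opC_bounded _ _ _ S).
pose lr u := Re (inner y (C u)); pose li u := Im (inner y (C u)).
have lrB u v : lr (u - v) = lr u - lr v by rewrite /lr linearB innerBr ReB.
have liB u v : li (u - v) = li u - li v by rewrite /li linearB innerBr ImB.
have lrZ (a : R) u : lr (a%:C *: u) = a * lr u by rewrite /lr linearZ innerZr ReZ.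
have liZ (a : R) u : li (a%:C *: u) = a * li u by rewrite /li linearZ innerZr ImZ.
have lrL u : `|lr u| <= (hnorm y * M) * hnorm u.
  apply: le_trans (Re_inner_le_hnorm _ _) _.
  by rewrite -mulrA ler_wpM2l ?hnorm_ge0.
have liL u : `|li u| <= (hnorm y * M) * hnorm u.
  apply: le_trans (Im_inner_le_hnorm _ _) _.
  by rewrite -mulrA ler_wpM2l ?hnorm_ge0.
pose a (t : R) := lr (T `|t| (Q x)) - expR (- omega * t) * Re q.
pose b (t : R) := li (T `|t| (Q x)) - expR (- omega * t) * Im q.
have aE t : a t = Re (D t) by rewrite /D ReB ReZ.
have bE t : b t = Im (D t) by rewrite /D ImB ImZ.
have ca : continuous a.
  move=> t; apply: cvgB; first exact: (functional_semigroup_continuous T_c0 lrB lrL).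
  by apply: cvgM; [exact: continuous_expRlin|exact: cvg_cst].
have cb : continuous b.
  move=> t; apply: cvgB; first exact: (functional_semigroup_continuous T_c0 liB liL).
  by apply: cvgM; [exact: continuous_expRlin|exact: cvg_cst].
(* The left side is the derivative of D: the generator maps [Q x] to s Q x - x, and [qE] absorbs the
   known orbit of x, which leaves s D. *)
have ED t : 0 <= t -> inner y (C (T t (s *: Q x - x))) + (omega * expR (- omega * t))%:C * q = s * D t.
  move=> t0; have -> : C (T t (s *: Q x - x)) = s *: C (T t (Q x)) - C (T t x).
    by rewrite !linearB !linearZ.
  rewrite innerBr innerZr hx// innerZr /D ger0_norm//.
  rewrite qE rmorphM /=; move: (inner y _) (expR _)%:C => v E.
  by ring.
have da (t : R) : 0 < t -> is_derive t 1 a (Re (s * D t)).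
  move=> t0; have h1 := functional_semigroup_derive T_c0 lrB lrZ lrL (gen x) t0.
  have h2 := is_deriveM' (is_derive_expRlin (- omega) t) (is_derive_cst (Re q : R) t 1).
  apply: (is_derive_conv (is_deriveB h1 h2)) => //.
  by rewrite -ED ?(ltW t0)// ReD ReZ /lr /cst; ring.
have db (t : R) : 0 < t -> is_derive t 1 b (Im (s * D t)).
  move=> t0; have h1 := functional_semigroup_derive T_c0 liB liZ liL (gen x) t0.
  have h2 := is_deriveM' (is_derive_expRlin (- omega) t) (is_derive_cst (Im q : R) t 1).
  apply: (is_derive_conv (is_deriveB h1 h2)) => //.
  by rewrite -ED ?(ltW t0)// ImD ImZ /li /cst; ring.
have rateE (u d : R[i]) : Re (u * d) * Re d + Re d * Re (u * d) +
    (Im (u * d) * Im d + Im d * Im (u * d)) = 2 * Re u * (Re d * Re d + Im d * Im d).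
  by case: u d => ? ? [? ?] /=; ring.
pose W t := a t * a t + b t * b t.
have cW : continuous W by move=> t; apply: cvgD; apply: cvgM; [exact: ca..|exact: cb|exact: cb].
have dW (t : R) : 0 < t -> is_derive t 1 W (2 * Re s * W t).
  move=> t0; apply: (is_derive_conv (is_deriveD (is_deriveM' (da t t0) (da t t0))
    (is_deriveM' (db t t0) (db t t0)))) => //.
  by rewrite /W !aE !bE rateE.
have W_ge0 t : 0 <= W t by rewrite addr_ge0// -expr2 sqr_ge0.
(* Here W' = 2 Re s W >= 0. On the imaginary axis W is constant, and integrability still forces it
   to be 0. *)
have W0 : W 0 = 0.
  apply: integrable_nondecreasing_eq0.
    move=> t t0; rewrite W_ge0/= -subr_ge0.
    have <- : \int[mu]_(r in `[0, t]) (2 * Re s * W r) = W t - W 0.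
      apply: Rintegral_FTC2 => //.
      - by move=> r /andP[r0 _]; exact: dW.
      - exact: continuous_subspaceT.
      - by apply: continuous_subspaceT => r; apply: cvgM; [exact: cvg_cst|exact: cW].
    by apply: Rintegral_ge0 => r _; rewrite !mulr_ge0.
  have mray := @measurable_ray R; have o2 : 0 < 2 * omega by rewrite mulr_gt0.
  have hi := integrableD mray (integrableZl mray (2 * normsq y) (output_energy_integrable gramL (Q x)))
    (integrableZl mray (2 * sqmod q) (integrable_expRN o2)).
  apply: (le_integrable mray _ _ hi).
    by apply/measurable_EFinP; apply: measurable_funTS; exact: continuous_measurable_fun.
  move=> t _ /=; rewrite lee_fin ger0_norm// [leRHS]ger0_norm; last first.
    by rewrite addr_ge0// !mulr_ge0 ?normsq_ge0 ?sqmod_ge0 ?expR_ge0.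
  rewrite /W aE bE -!expr2 -/(sqmod (D t)); apply: le_trans (sqmodD_le _ _) _.
  rewrite sqmodN sqmodM sqmodR -expRM_natl.
  have -> : 2%:R * (- omega * t) = - (2 * omega) * t by ring.
  apply: lerD; rewrite -mulrA ler_pM2l//; first exact: CauchySchwarz.
  by rewrite mulrC.
have WE : W 0 = sqmod (D 0) by rewrite /W aE bE -!expr2.
by apply/eqP; rewrite -sqmod_eq0 -WE W0.
Qed.

End ModalUniqueness.

(** * Modal lower bounds for an arbitrary realization *)

Section H2LowerBound.
Context {R : realType}.
Variables (alpha gamma : R).
Hypotheses (alpha_gt0 : 0 < alpha) (gamma_gt0 : 0 < gamma).
Local Notation L2 := (L2T R).
Local Notation mu := (@lebesgue_measure R).
Local Notation ray := (`[0%R, +oo[%classic : set (measurableTypeR R)).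
Local Notation lam := (mode_decay alpha).
Local Notation om := (mode_rate alpha gamma).
Local Notation p := (mode_gain alpha gamma).

Variables Phipsi Phiu : R[i] -> {linear L2 -> L2}.
Local Notation Phi := (fun s th => weightC gamma (Phipsi s th) + weightD (Phiu s th)).
Hypothesis affine : affine_constraint alpha Phipsi Phiu.

Variables (S : system L2 (L2 * L2)%type) (L : {linear state S -> state S}).
Hypotheses (tfS : is_transfer_function S Phi) (D0 : zero_feedthrough S).
Hypothesis gramL : is_observability_gramian L.

Local Notation z n := (loop_output alpha gamma (efun n)).
Local Notation x n := (opB S (efun n)).

Let om_rhp n : closed_rhp ((om n)%:C : R[i]).
Proof. by rewrite /closed_rhp /= ltW// mode_rate_gt0. Qed.

Let lqr_gain_efun n : lqr_gain alpha gamma (efun n) = (- p n)%:C *: efun n.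
Proof. by apply: (diag_basis efun_basis); exact: (bounded_gain alpha_gt0 gamma_gt0). Qed.

Let normsq_efun n : normsq (efun n : L2) = 1.
Proof. exact: (normsq_basis efun_basis). Qed.

Lemma normsq_loop_output_efun n : normsq (z n) = 2 * om n * p n.
Proof.
rewrite normsq_pair /= lqr_gain_efun (normsqZ gamma%:C) (normsqZ (- p n)%:C) !sqmodR normsq_efun !mulr1 sqrrN.
exact: mode_energy.
Qed.

Lemma affine_mode s n : closed_rhp s ->
  (s + (lam n)%:C) * inner (efun n) (Phipsi s (efun n)) - inner (efun n) (Phiu s (efun n)) = 1.
Proof.
move=> hs; have [g dg /(_ (efun n))] := affine hs (efun n).
rewrite (efun_basis.1 n n) eqxx innerBr innerZr innerDr (diffusion_coef n dg).
by move=> h; rewrite -[RHS]h; ring.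
Qed.

(** For the coefficients a, b of the pair at e_n the pairing with z is the real part of gamma^2 a -
    p b, that is of p ((om + lam) a - b) by [riccatiM]; the affine constraint at s = om says that
    the bracket is 1. *)
Lemma transfer_mode n : Re (inner (z n) (Phi (om n)%:C (efun n))) = p n.
Proof.
have -> : inner (z n) (Phi (om n)%:C (efun n)) =
    inner (gamma%:C *: efun n) (gamma%:C *: Phipsi (om n)%:C (efun n) + 0) +
    inner (lqr_gain alpha gamma (efun n)) (0 + Phiu (om n)%:C (efun n)) by [].
rewrite lqr_gain_efun addr0 add0r (innerZl gamma%:C) (innerZl (- p n)%:C) innerZr !conjc_real.
have := affine_mode n (om_rhp n).
move: (inner _ (Phipsi _ _)) (inner _ (Phiu _ _)) => a b /(congr1 (fun z => Re z)).
rewrite ReB -rmorphD ReZ /= => h.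
rewrite ReD !ReZ mulrA -expr2.
have := riccatiM gamma (lam n); rewrite -/(om n) -/(p n) => <-.
have -> : Re b = (om n + lam n) * Re a - 1 by rewrite -h; ring.
by ring.
Qed.

(** The resolvent hidden in [is_transfer_function] may be another operator Q'. Resolvents are
    unique: the generator maps Q' v to s Q' v - v, so the inverse property of Q sends v to Q' v. *)
Lemma transferE s (Q : {linear state S -> state S}) th : closed_rhp s ->
  is_resolvent (@opT _ _ _ S) s Q -> opC S (Q (opB S th)) = Phi s th.
Proof.
move=> hs [bQ gen inv]; have [Q' [_ gen' _] ->] := tfS hs; rewrite D0 addr0; congr (opC S _).
by rewrite -[RHS](inv _ _ (gen' _)) subKr.
Qed.

Lemma mode_energy_bound n :
  p n <= \int[mu]_(t in ray) output_energy (x n) t /\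
  (p n = \int[mu]_(t in ray) output_energy (x n) t ->
   forall t, 0 <= t -> opC S (opT S t (x n)) = (expR (- om n * t))%:C *: z n).
Proof.
have o0 : 0 < om n := mode_rate_gt0 alpha gamma_gt0 n.
have [Q resQ QE] := tfS (om_rhp n).
have cr : \int[mu]_(t in ray) (expR (- om n * t) * Re (inner (z n) (opC S (opT S `|t| (x n))))) = p n.
  rewrite (Rintegral_output_functional gramL (z n) _ o0 resQ).
  by rewrite (transferE _ (om_rhp n) resQ) transfer_mode.
have ME t : output_energy (x n) t -
    2 * 1 * (expR (- om n * t) * Re (inner (z n) (opC S (opT S `|t| (x n))))) +
    1 ^+ 2 * (2 * om n * p n) * expR (- (2 * om n) * t) =
    normsq (opC S (opT S `|t| (x n)) - (expR (- om n * t))%:C *: z n).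
  rewrite normsqB normsqZ sqmodR normsq_loop_output_efun innerZr ReZ /output_energy.
  rewrite (inner_conj (z n)) Re_conj -expRM_natl.
  have -> : 2%:R * (- om n * t) = - (2 * om n) * t by ring.
  by ring.
have [] := energy_bound (x0 := 1) (Z := 2 * om n * p n) o0 (output_energy_integrable gramL (x n))
  (output_functional_integrable gramL (z n) (x n) o0) cr.
  by move=> t _; rewrite ME normsq_ge0.
(* The comparison response is z itself, so [x0] is 1, and Z / (2 om n) = p n: the bound is 2 p n - p
   n. *)
have -> : 2 * 1 * p n - 1 ^+ 2 * (2 * om n * p n) / (2 * om n) = p n.
  by field; rewrite gt_eqF.
move=> h1 h2; split=> // /h2 h t t0.
apply/subr0_eq/normsq0_eq0; rewrite -{1}(ger0_norm t0) -ME.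
apply: (ae0_continuous_ray _ h) => //; apply: continuous_subspaceT => r.
apply: cvgD; last by apply: cvgM; [exact: cvg_cst|exact: continuous_expRlin].
apply: cvgB; first exact: output_energy_continuous.
apply: cvgM; first exact: cvg_cst.
by apply: cvgM; [exact: continuous_expRlin|exact: output_functional_continuous].
Qed.

Lemma mode_transfer_unique n s : p n = \int[mu]_(t in ray) output_energy (x n) t ->
  closed_rhp s -> Phi s (efun n) = (s + (om n)%:C)^-1 *: z n.
Proof.
move=> pE hs; have [Q resQ QE] := tfS hs; rewrite QE D0 addr0.
apply: (output_resolvent gramL (mode_rate_gt0 alpha gamma_gt0 n) hs resQ).
exact: (mode_energy_bound n).2.
Qed.

(** The trace is evaluated in the Fourier basis, where each diagonal entry is the quadratic form of
    the Gramian at B e_n, that is the output energy of the response to e_n. *)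
Lemma H2_trace (Bd : {linear state S -> L2}) (w : R) : is_adjoint (opB S) Bd ->
  is_trace (fun y => Bd (L (opB S y))) w%:E ->
  (\sum_(0 <= n <oo) (\int[mu]_(t in ray) output_energy (x n) t)%:E = w%:E)%E.
Proof.
move=> BBd tr; rewrite -(tr _ _ efun_basis) nneseries_esumT; last first.
  move=> n; rewrite lee_fin; apply: Rintegral_ge0 => t _; exact: normsq_ge0.
apply: eq_esum => n _; rewrite (Rintegral_output_energy gramL).
by rewrite [in RHS]inner_conj -BBd -inner_conj.
Qed.

End H2LowerBound.

Section H2Optimality.
Context {R : realType}.
Variables (alpha gamma : R).
Hypotheses (alpha_gt0 : 0 < alpha) (gamma_gt0 : 0 < gamma).
Local Notation L2 := (L2T R).
Local Notation p := (mode_gain alpha gamma).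
Local Notation om := (mode_rate alpha gamma).
Local Notation mu := (@lebesgue_measure R).
Local Notation ray := (`[0%R, +oo[%classic : set (measurableTypeR R)).

Let bounded_linear_ext (f g : {linear L2 -> L2}) : bounded_op f -> bounded_op g ->
  (forall n, f (efun n) = g (efun n)) -> f =1 g.
Proof.
move=> /bounded_opP[M M0 hM] /bounded_opP[M' M'0 hM'] fg x.
apply: inner_ext => y; apply/subr0_eq.
apply: (bounded_functional_eq0 efun_basis (phi := fun x => inner y (f x) - inner y (g x))
  (M := normsq y * (M + M') ^+ 2)) => [a b|a b|a|n].
- by rewrite !linearD !innerDr; ring.
- by rewrite !linearZ !innerZr; ring.
- rewrite -innerBr; apply: le_trans (CauchySchwarz _ _) _.
  rewrite -mulrA ler_wpM2l ?normsq_ge0// -(hnorm_sq a) -exprMn -hnorm_sq.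
  rewrite ler_pXn2r ?nnegrE ?mulr_ge0 ?addr_ge0 ?hnorm_ge0//.
  apply: le_trans (hnormD _ _) _; rewrite hnormN mulrDl.
  by apply: lerD; [exact: hM|exact: hM'].
- by rewrite fg subrr.
Qed.

Let bounded_Hinfty (Phi : R[i] -> {linear L2 -> L2}) s : in_Hinfty Phi -> closed_rhp s ->
  bounded_op (Phi s).
Proof. by move=> h hs; apply: le_lt_trans h; apply: ereal_sup_ubound; exists s. Qed.

Lemma h2_lower_bound (Phipsi Phiu : R[i] -> {linear L2 -> L2}) (v w : R) :
  affine_constraint alpha Phipsi Phiu -> is_h2_objective gamma Phipsi Phiu v ->
  (\sum_(0 <= n <oo) (p n)%:E = w%:E)%E ->
  (2 * pi)^-1 * w <= v.
Proof.
move=> aff [S tfS [D0 [L [Bd [w' [gramL _ BBd tr ->]]]]]] pw.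
rewrite ler_pM2l ?invr_gt0 ?mulr_gt0 ?pi_gt0// -lee_fin -pw -(H2_trace gramL BBd tr).
apply: lee_nneseries => [n _ _|n _]; rewrite lee_fin; first exact: mode_gain_ge0.
exact: (mode_energy_bound alpha_gt0 gamma_gt0 aff tfS D0 gramL n).1.
Qed.

(** Equal finite sums with termwise inequality force equality in each mode, which fixes the pair on
    the basis. Membership in [in_Hinfty] makes each operator bounded, so its values on the basis
    determine it. *)
Lemma h2_unique (Phipsi Phiu : R[i] -> {linear L2 -> L2}) (w : R) :
  h2_feasible alpha Phipsi Phiu ->
  (\sum_(0 <= n <oo) (p n)%:E = w%:E)%E ->
  is_h2_objective gamma Phipsi Phiu ((2 * pi)^-1 * w) ->
  forall s, closed_rhp s ->
    Phipsi s =1 loop_state alpha gamma s /\ Phiu s =1 loop_control alpha gamma s.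
Proof.
move=> [[binf1 binf2] _ _ aff] pw [S tfS [D0 [L [Bd [w' [gramL _ BBd tr wE]]]]]] s hs.
have ww : w = w'.
  by apply: mulfI wE; apply: lt0r_neq0; rewrite invr_gt0 mulr_gt0 ?pi_gt0.
rewrite -ww in tr.
have bound n := mode_energy_bound alpha_gt0 gamma_gt0 aff tfS D0 gramL n.
have ab n : 0 <= p n <= \int[mu]_(t in ray) output_energy (opB S (efun n)) t.
  by rewrite (bound n).1 mode_gain_ge0.
have sumE := H2_trace gramL BBd tr.
have eqp : forall n, p n = \int[mu]_(t in ray) output_energy (opB S (efun n)) t.
  by apply: (eq_nneseries_termwise ab pw); rewrite sumE.
have tE n := mode_transfer_unique alpha_gt0 gamma_gt0 aff tfS D0 gramL (eqp n) hs.
have g0 : gamma%:C != 0 :> R[i] by rewrite fmorph_eq0 gt_eqF.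
have bres := @dresolvent_bounded _ om _ gamma_gt0 (mode_rate_ge alpha gamma_gt0) s hs.
have sE n : loop_state alpha gamma s (efun n) = (s + (om n)%:C)^-1 *: efun n.
  exact: (diag_basis efun_basis).
have b1 : bounded_op (Phipsi s) := bounded_Hinfty binf1 hs.
have b2 : bounded_op (Phiu s) := bounded_Hinfty binf2 hs.
have b3 : bounded_op (loop_state alpha gamma s) := diag_bounded efun_basis _.
have b4 : bounded_op (loop_control alpha gamma s) := diag_bounded efun_basis _.
split; [apply: (bounded_linear_ext b1 b3)|apply: (bounded_linear_ext b2 b4)].
- move=> n; rewrite sE; have := congr1 fst (tE n); rewrite /= addr0 => h.
  apply: (can_inj (scalerK g0)); rewrite h.
  by rewrite (scalerA _ gamma%:C (efun n)) (scalerA gamma%:C _ (efun n)) mulrC.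
- move=> n; rewrite loop_controlE// sE.
  transitivity ((s + (om n)%:C)^-1 *: lqr_gain alpha gamma (efun n)).
    by have := congr1 snd (tE n); rewrite /= add0r.
  by move: (efun n) => y; rewrite linearZ.
Qed.

Lemma loop_h2_solution :
  h2_solution alpha gamma (loop_state alpha gamma) (loop_control alpha gamma).
Proof.
split; first exact: loop_feasible.
have [w pw] := mode_gain_summable alpha_gt0 gamma_gt0.
exists ((2 * pi)^-1 * w); first exact: loop_objective.
move=> Phipsi Phiu v [_ _ _ aff] obj; exact: h2_lower_bound aff obj pw.
Qed.

Lemma h2_solution_unique (Phipsi Phiu : R[i] -> {linear L2 -> L2}) :
  h2_solution alpha gamma Phipsi Phiu ->
  forall s, closed_rhp s ->
    Phipsi s =1 loop_state alpha gamma s /\ Phiu s =1 loop_control alpha gamma s.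
Proof.
move=> [feas [v obj vmin]]; have [w pw] := mode_gain_summable alpha_gt0 gamma_gt0.
have [_ _ _ aff] := feas.
have vE : v = (2 * pi)^-1 * w.
  apply/eqP; rewrite eq_le (h2_lower_bound aff obj pw) andbT.
  exact: (vmin _ _ _ (loop_feasible alpha_gt0 gamma_gt0) (loop_objective alpha_gt0 gamma_gt0 pw)).
by apply: (h2_unique feas pw); rewrite -vE.
Qed.

End H2Optimality.

(** * Optimality in the LQR problem *)

Lemma ler_sum_eq {R : realDomainType} (a b c d : R) :
  a <= c -> b <= d -> a + b = c + d -> a = c /\ b = d.
Proof. by move=> *; split; lra. Qed.

Section LQRLowerBound.
Context {R : realType}.
Variables (alpha gamma : R).
Hypotheses (alpha_gt0 : 0 < alpha) (gamma_gt0 : 0 < gamma).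
Local Notation L2 := (L2T R).
Local Notation mu := (@lebesgue_measure R).
Local Notation ray := (`[0%R, +oo[%classic : set (measurableTypeR R)).
Local Notation lam := (mode_decay alpha).
Local Notation om := (mode_rate alpha gamma).
Local Notation p := (mode_gain alpha gamma).

Definition mode_cost (psi u : R -> L2) (n : nat) (t : R) : R :=
  gamma ^+ 2 * sqmod (inner (efun n) (psi t)) + sqmod (inner (efun n) (u t)).

Lemma mode_cost_ge0 psi u n t : 0 <= mode_cost psi u n t.
Proof. by rewrite addr_ge0 ?sqmod_ge0// mulr_ge0 ?sqr_ge0 ?sqmod_ge0. Qed.

Lemma measurable_mode_cost psi u n :
  (forall f, cmeasurable ray (fun t => inner f (psi t))) ->
  (forall f, cmeasurable ray (fun t => inner f (u t))) ->
  measurable_fun ray (mode_cost psi u n).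
Proof.
move=> mpsi mu_; apply: measurable_funD; last exact: measurable_sqmod.
by apply: measurable_funM; [exact: measurable_cst|exact: measurable_sqmod].
Qed.

(** Parseval at each time, then exchange of sum and integral for nonnegative terms; weak
    measurability of state and control makes the modal costs measurable. *)
Lemma lqr_cost_modes psi u :
  (forall f, cmeasurable ray (fun t => inner f (psi t))) ->
  (forall f, cmeasurable ray (fun t => inner f (u t))) ->
  (lqr_cost gamma psi u = \sum_(0 <= n <oo) \int[mu]_(t in ray) (mode_cost psi u n t)%:E)%E.
Proof.
move=> mpsi mu_; rewrite /lqr_cost -integral_nneseries//.
- apply: eq_integral => t _; rewrite innerZr ReD ReZ -/(normsq _) -/(normsq _).
  under eq_eseriesr do rewrite /mode_cost EFinD EFinM.
  rewrite nneseriesD; last 2 first.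
  - by move=> n _ _; rewrite -EFinM lee_fin mulr_ge0 ?sqr_ge0 ?sqmod_ge0.
  - by move=> n _ _; rewrite lee_fin sqmod_ge0.
  rewrite nneseriesZl; last by move=> n _; rewrite lee_fin sqmod_ge0.
  by rewrite !(parseval_series efun_basis) EFinD EFinM.
- by move=> n; apply/measurable_EFinP; exact: measurable_mode_cost.
- by move=> n t _; rewrite lee_fin mode_cost_ge0.
Qed.

Lemma diffusion_efun n : diffusion alpha (efun n) ((- (lam n))%:C *: efun n : L2).
Proof.
(* The indicator of mode n specializes [diffusion_diag] to the eigenvector [efun n]. *)
pose m (k : nat) : R[i] := (k == n)%:R.
have bm : bounded_seq m.
  by exists 1 => k; rewrite /m; case: eqP; rewrite ?sqmod1 ?sqmod0.
have blm : bounded_seq (fun k => - (lam k)%:C * m k).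
  exists (sqmod (lam n)%:C) => k; rewrite /m; have [->|_] := eqVneq k n.
    by rewrite mulr1 sqmodN.
  by rewrite mulr0 sqmod0 sqmod_ge0.
have := diffusion_diag alpha_gt0 (efun n) bm blm.
by rewrite !diag_basis// /m eqxx mulr1 scale1r rmorphN.
Qed.

Section Trajectory.
Variables (psi0 : L2) (u psi : R -> L2).
Hypotheses (adm : admissible_control u) (sol : solves_diffusion alpha psi0 u psi).

Let mode_within f : {within ray, continuous (fun t => Re (inner f (psi t)))} /\
  {within ray, continuous (fun t => Im (inner f (psi t)))}.
Proof.
have [_ cpsi _] := sol.
split; apply/subspace_continuousP => t; rewrite rayE /from_subspace => t0.
  by apply: Re_inner_cvg; exact: cpsi.
by apply: Im_inner_cvg; exact: cpsi.
Qed.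

Lemma trajectory_measurable f : cmeasurable ray (fun t => inner f (psi t)).
Proof.
have [h1 h2] := mode_within f.
by split; apply: subspace_continuous_measurable_fun => //; exact: measurable_ray.
Qed.

Let mode_ode n t : 0 <= t ->
  Re (inner (efun n) (psi t)) = Re (inner (efun n) psi0) +
    \int[mu]_(s in `[0, t]) (- lam n * Re (inner (efun n) (psi s)) + Re (inner (efun n) (u s))) /\
  Im (inner (efun n) (psi t)) = Im (inner (efun n) psi0) +
    \int[mu]_(s in `[0, t]) (- lam n * Im (inner (efun n) (psi s)) + Im (inner (efun n) (u s))).
Proof.
move=> t0; have [_ _ /(_ _ _ (diffusion_efun n) t t0) ->] := sol.
rewrite ReD ImD; split; congr (_ + _); apply: eq_Rintegral => s _.
  by rewrite innerZl conjc_real ReD ReZ.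
by rewrite innerZl conjc_real ImD ImZ.
Qed.

(** Since lam is real, the real and imaginary parts of a mode are two independent real problems for
    [lqr_scalar]; equality in the sum forces equality in both. *)
Lemma mode_cost_bound n : mu.-integrable ray (EFin \o mode_cost psi u n) ->
  p n * sqmod (inner (efun n) psi0) <= \int[mu]_(t in ray) mode_cost psi u n t /\
  (p n * sqmod (inner (efun n) psi0) = \int[mu]_(t in ray) mode_cost psi u n t ->
   (forall t, 0 <= t -> inner (efun n) (psi t) = (expR (- om n * t))%:C * inner (efun n) psi0) /\
   ae_eq mu ray (fun t => inner (efun n) (u t))
     (fun t => (- p n)%:C * ((expR (- om n * t))%:C * inner (efun n) psi0))).
Proof.
move=> iN; have mray := @measurable_ray R.
have [c1 c2] := mode_within (efun n); have [m1 m2] := adm.1 (efun n).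
have [m3 m4] := trajectory_measurable (efun n).
pose N1 t := gamma ^+ 2 * Re (inner (efun n) (psi t)) ^+ 2 + Re (inner (efun n) (u t)) ^+ 2.
pose N2 t := gamma ^+ 2 * Im (inner (efun n) (psi t)) ^+ 2 + Im (inner (efun n) (u t)) ^+ 2.
have N12 t : mode_cost psi u n t = N1 t + N2 t by rewrite /mode_cost /N1 /N2 /sqmod; ring.
have N1_ge0 t : 0 <= N1 t by rewrite addr_ge0 ?sqr_ge0// mulr_ge0 ?sqr_ge0.
have N2_ge0 t : 0 <= N2 t by rewrite addr_ge0 ?sqr_ge0// mulr_ge0 ?sqr_ge0.
have i1 : mu.-integrable ray (EFin \o N1).
  apply: (le_integrable mray _ _ iN).
    apply/measurable_EFinP; apply: measurable_funD; last exact: measurable_funX.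
    by apply: measurable_funM; [exact: measurable_cst|exact: measurable_funX].
  by move=> t _ /=; rewrite lee_fin !ger0_norm ?mode_cost_ge0// N12 lerDl.
have i2 : mu.-integrable ray (EFin \o N2).
  apply: (le_integrable mray _ _ iN).
    apply/measurable_EFinP; apply: measurable_funD; last exact: measurable_funX.
    by apply: measurable_funM; [exact: measurable_cst|exact: measurable_funX].
  by move=> t _ /=; rewrite lee_fin !ger0_norm ?mode_cost_ge0// N12 lerDr.
have l0 := mode_decay_ge0 alpha_gt0 n.
have [b1 e1] := lqr_scalar gamma_gt0 l0 c1 m1 (fun t t0 => (mode_ode n t0).1) i1.
have [b2 e2] := lqr_scalar gamma_gt0 l0 c2 m2 (fun t t0 => (mode_ode n t0).2) i2.
have sumE : \int[mu]_(t in ray) mode_cost psi u n t =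
    \int[mu]_(t in ray) N1 t + \int[mu]_(t in ray) N2 t.
  by rewrite -RintegralD//; apply: eq_Rintegral => t _.
have pE : p n * sqmod (inner (efun n) psi0) =
    p n * Re (inner (efun n) psi0) ^+ 2 + p n * Im (inner (efun n) psi0) ^+ 2.
  by rewrite -mulrDr.
rewrite -/(p n) in b1 b2 e1 e2; rewrite -/(om n) in e1 e2.
rewrite sumE pE; split; first exact: (lerD b1 b2).
move=> E; have [E1 E2] := ler_sum_eq b1 b2 E.
have [x1 u1] := e1 E1; have [x2 u2] := e2 E2; split.
  by move=> t t0; apply: complexP; rewrite ?ReZ ?ImZ; [exact: x1|exact: x2].
apply: (@filterS _ (almost_everywhere mu) (ae_filter_ringOfSetsType mu) _ _ _
  (@filterI _ _ (ae_filter_ringOfSetsType mu) _ _ u1 u2)) => t [h1 h2] ht.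
by apply: complexP; rewrite ?ReZ ?ImZ mulrA; [exact: h1|exact: h2].
Qed.

Lemma lqr_lower_bound :
  (\sum_(0 <= n <oo) (p n * sqmod (inner (efun n) psi0))%:E <= lqr_cost gamma psi u)%E.
Proof.
rewrite (lqr_cost_modes trajectory_measurable adm.1).
apply: lee_nneseries => [n _ _|n _].
  by rewrite lee_fin mulr_ge0 ?sqmod_ge0// mode_gain_ge0.
have [fin|] := ltP (\int[mu]_(t in ray) (mode_cost psi u n t)%:E)%E +oo%E; last first.
  by rewrite leye_eq => /eqP ->; rewrite leey.
have iN : mu.-integrable ray (EFin \o mode_cost psi u n).
  apply/integrableP; split.
    by apply/measurable_EFinP; exact: (measurable_mode_cost n trajectory_measurable adm.1).
  apply: le_lt_trans fin; apply: le_lower_integral => t _ //=.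
  by rewrite ger0_norm// mode_cost_ge0.
have := (mode_cost_bound iN).1; rewrite -lee_fin /Rintegral fineK//.
exact: (integrable_fin_num (@measurable_ray R) iN).
Qed.

Lemma lqr_cost_eq : (lqr_cost gamma psi u =
    \sum_(0 <= n <oo) (p n * sqmod (inner (efun n) psi0))%:E)%E ->
  (\sum_(0 <= n <oo) (p n * sqmod (inner (efun n) psi0))%:E < +oo)%E ->
  forall n, (forall t, 0 <= t ->
    inner (efun n) (psi t) = (expR (- om n * t))%:C * inner (efun n) psi0) /\
   ae_eq mu ray (fun t => inner (efun n) (u t))
     (fun t => (- p n)%:C * ((expR (- om n * t))%:C * inner (efun n) psi0)).
Proof.
move=> E fin.
have p0 k : 0 <= p k * sqmod (inner (efun k) psi0).
  by rewrite mulr_ge0 ?sqmod_ge0// mode_gain_ge0.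
have c0 k : (0 <= \int[mu]_(t in ray) (mode_cost psi u k t)%:E)%E.
  by apply: integral_ge0 => t _; rewrite lee_fin mode_cost_ge0.
have iN k : mu.-integrable ray (EFin \o mode_cost psi u k).
  apply/integrableP; split.
    by apply/measurable_EFinP; exact: (measurable_mode_cost k trajectory_measurable adm.1).
  apply: le_lt_trans fin; rewrite -E (lqr_cost_modes trajectory_measurable adm.1).
  rewrite (@nneseriesD1 _ _ k)//; apply: le_trans (leeDl _ _); last first.
    by apply: nneseries_ge0 => j _ _.
  apply: le_lower_integral => t _ //=.
  by rewrite ger0_norm// mode_cost_ge0.
have intE k : (\int[mu]_(t in ray) (mode_cost psi u k t)%:E =
    (\int[mu]_(t in ray) mode_cost psi u k t)%:E)%E.
  rewrite /Rintegral fineK//; exact: (integrable_fin_num (@measurable_ray R) (iN k)).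
have ab k : 0 <= p k * sqmod (inner (efun k) psi0) <= \int[mu]_(t in ray) mode_cost psi u k t.
  by rewrite p0 (mode_cost_bound (iN k)).1.
have s0 : (0 <= \sum_(0 <= n <oo) (p n * sqmod (inner (efun n) psi0))%:E)%E.
  by apply: nneseries_ge0 => k _ _; rewrite lee_fin.
have sE : (\sum_(0 <= n <oo) (p n * sqmod (inner (efun n) psi0))%:E =
   (fine (\sum_(0 <= n <oo) (p n * sqmod (inner (efun n) psi0))%:E))%:E)%E.
  by rewrite fineK// ge0_fin_numE.
have bE : (\sum_(0 <= n <oo) (\int[mu]_(t in ray) mode_cost psi u n t)%:E <=
   (fine (\sum_(0 <= n <oo) (p n * sqmod (inner (efun n) psi0))%:E))%:E)%E.
  rewrite -sE -E (lqr_cost_modes trajectory_measurable adm.1).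
  by under eq_eseriesr do rewrite -intE.
move=> n; apply: (mode_cost_bound (iN n)).2.
exact: (eq_nneseries_termwise ab sE bE).
Qed.

End Trajectory.

End LQRLowerBound.

Section LQROptimality.
Context {R : realType}.
Variables (alpha gamma : R).
Hypotheses (alpha_gt0 : 0 < alpha) (gamma_gt0 : 0 < gamma).
Local Notation L2 := (L2T R).
Local Notation mu := (@lebesgue_measure R).
Local Notation ray := (`[0%R, +oo[%classic : set (measurableTypeR R)).
Local Notation lam := (mode_decay alpha).
Local Notation om := (mode_rate alpha gamma).
Local Notation p := (mode_gain alpha gamma).
Local Notation K := (lqr_gain alpha gamma).
Local Notation T := (dsemigroup efun_basis om).
Let om_ge := mode_rate_ge alpha gamma_gt0.
Let T_c0 : c0_semigroup T := dsemigroup_c0 efun_basis gamma_gt0 om_ge.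

Let K_adj x y : inner x (K y) = inner (K x) y.
Proof.
rewrite (diag_adjoint efun_basis _ _ (bounded_gain alpha_gt0 gamma_gt0)); congr inner; congr diag.
by apply/funext => n; rewrite conjc_real.
Qed.

Let Re_cont x y : continuous (fun t : R => Re (inner x (T t y))).
Proof.
have lB a b : Re (inner x (a - b)) = Re (inner x a) - Re (inner x b) by rewrite innerBr ReB.
have lL a : `|Re (inner x a)| <= hnorm x * hnorm a by exact: Re_inner_le_hnorm.
exact: (dsemigroup_continuous (basise := efun_basis) (l := fun z => Re (inner x z)) gamma_gt0 om_ge lB lL).
Qed.

Let Im_cont x y : continuous (fun t : R => Im (inner x (T t y))).
Proof.
have lB a b : Im (inner x (a - b)) = Im (inner x a) - Im (inner x b) by rewrite innerBr ImB.
have lL a : `|Im (inner x a)| <= hnorm x * hnorm a by exact: Im_inner_le_hnorm.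
exact: (dsemigroup_continuous (basise := efun_basis) (l := fun z => Im (inner x z)) gamma_gt0 om_ge lB lL).
Qed.

Let cmeas x y : cmeasurable ray (fun t => inner x (T t y)).
Proof.
by split; apply: measurable_funTS; apply: continuous_measurable_fun;
  [exact: Re_cont|exact: Im_cont].
Qed.

Lemma optimal_admissible psi0 : admissible_control (fun t => K (T t psi0)).
Proof.
split=> [f|tau].
  rewrite (_ : (fun t => inner f _) = (fun t => inner (K f) (T t psi0))); first exact: cmeas.
  by apply/funext => t; exact: K_adj.
have h t : hnorm (K (T t psi0)) ^+ 2 <= (gamma * hnorm psi0) ^+ 2.
  rewrite ler_pXn2r ?nnegrE ?mulr_ge0 ?hnorm_ge0 ?(ltW gamma_gt0)//.
  apply: le_trans (hnorm_lqr_gain alpha_gt0 gamma_gt0 _) _; rewrite ler_pM2l//.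
  apply: le_trans (hnorm_dsemigroup efun_basis om_ge _ _) _.
  rewrite ler_piMl ?hnorm_ge0// -[leRHS]expR0 ler_expR mulNr oppr_le0.
  by rewrite mulr_ge0 ?(ltW gamma_gt0).
apply: (@le_lt_trans _ _ (\int[mu]_(t in `[0%R, tau]) ((gamma * hnorm psi0) ^+ 2)%:E)%E).
  by apply: le_lower_integral => t _; rewrite lee_fin ?sqr_ge0.
rewrite integral_cst//= lebesgue_measure_itv /=.
by case: ifP => _; rewrite ?mule0// -EFinD -EFinM ltry.
Qed.

Let closed_rhp0 : closed_rhp (0 : R[i]). Proof. by rewrite /closed_rhp /= lexx. Qed.

(** The generator maps the resolvent at 0 of psi0 to -psi0, so the orbit of psi0 is minus the
    derivative of the orbit of that vector. *)
Let increment x psi0 t : 0 <= t ->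
  cintegral (`[0, t]%classic : set R) (fun s => inner x (T s psi0)) =
  inner x (dresolvent efun_basis om 0 psi0) -
  inner x (T t (dresolvent efun_basis om 0 psi0)).
Proof.
move=> t0; have [_ gen _] := dsemigroup_resolvent efun_basis gamma_gt0 om_ge closed_rhp0.
have E (l : L2 -> R) (L : R) : (forall a b, l (a - b) = l a - l b) ->
    (forall (a : R) b, l (a%:C *: b) = a * l b) -> (forall a, `|l a| <= L * hnorm a) ->
    \int[mu]_(s in `[0, t]) l (T s psi0) =
    l (dresolvent efun_basis om 0 psi0) - l (T t (dresolvent efun_basis om 0 psi0)).
  move=> lB lZ lL; have := Rintegral_semigroup T_c0 lB lZ lL 0 (gen psi0) t0.
  rewrite oppr0 mul0r expR0 mul1r => <-.
  apply: eq_Rintegral => s; rewrite inE /= in_itv /= => /andP[s0 _].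
  by rewrite mul0r expR0 mul1r ger0_norm// !scale0r !sub0r opprK.
apply: complexP; rewrite ?ReB ?ImB.
  apply: (E (fun y => Re (inner x y)) (hnorm x)) => [a b|a b|a].
  - by rewrite innerBr ReB.
  - by rewrite innerZr ReZ.
  - exact: Re_inner_le_hnorm.
apply: (E (fun y => Im (inner x y)) (hnorm x)) => [a b|a b|a].
- by rewrite innerBr ImB.
- by rewrite innerZr ImZ.
- exact: Im_inner_le_hnorm.
Qed.

(** Self-adjointness moves every operator onto f, where the claim is an identity between
    multipliers: with d the decay factor, (1 - d) / om times -lam - p = -om equals d - 1. That -lam
    is the multiplier of g over f is [diffusion_coef]. *)
Lemma optimal_solves psi0 :
  solves_diffusion alpha psi0 (fun t => K (T t psi0)) (fun t => T t psi0).
Proof.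
split=> [|t t0|f g fg t t0]; first by case: T_c0.
  have E (s : R) : T `|s| psi0 = T s psi0 by rewrite /dsemigroup /decay normr_id.
  have E2 : (fun s : R => hnorm (T `|s| psi0 - T `|t| psi0)) = (fun s => hnorm (T s psi0 - T t psi0)).
    by apply/funext => s; rewrite (E s) (E t).
  apply: cvg_within_filter.
  exact: (eq_ind _ (fun F : R -> R => F @ t --> (0 : R)) (semigroup_continuous T_c0 psi0 t) _ E2).
have -> : (fun s => inner g (T s psi0) + inner f (K (T s psi0))) =
    (fun s => inner (g + K f) (T s psi0)).
  by apply/funext => s; rewrite innerDl K_adj.
rewrite increment// -innerBr.
have bd := decay_bounded gamma_gt0 om_ge t.
have br := dresolvent_bounded gamma_gt0 om_ge closed_rhp0.
have d1 : bounded_seq (fun n => (decay om t n)%:C - 1).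
  by apply: bounded_seqD => //; exists 1 => n; rewrite sqmodN sqmod1.
have m1 : bounded_seq (fun n => (1 - (decay om t n)%:C) * dresolvent_symbol om 0 n).
  apply: bounded_seqM => //; have [M hM] := d1; exists M => n.
  by rewrite -sqmodN opprB.
have -> : dresolvent efun_basis om 0 psi0 - T t (dresolvent efun_basis om 0 psi0) =
    diag efun_basis (fun n => (1 - (decay om t n)%:C) * dresolvent_symbol om 0 n) psi0.
  apply: (basis_ext efun_basis) => n.
  rewrite innerBr (inner_dsemigroup efun_basis gamma_gt0 om_ge) !(inner_diag efun_basis)//.
  by rewrite /dresolvent_symbol; ring.
have -> : inner f (T t psi0) = inner f psi0 + inner f (diag efun_basis (fun n => (decay om t n)%:C - 1) psi0).
  rewrite -innerDr; congr inner; apply: (basis_ext efun_basis) => n.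
  rewrite innerDr (inner_dsemigroup efun_basis gamma_gt0 om_ge) (inner_diag efun_basis)//.
  by ring.
congr (_ + _); rewrite !(diag_adjoint efun_basis)//; congr inner.
apply: (basis_ext efun_basis) => n.
rewrite !(inner_diag efun_basis); [|exact: bounded_seq_conj..].
rewrite innerDr (diffusion_coef n fg) (inner_lqr_gain alpha_gt0 gamma_gt0).
have o0 : (om n)%:C != 0 :> R[i] by rewrite fmorph_eq0 gt_eqF// mode_rate_gt0.
have c1 (a : R) : (a%:C - 1)^*%C = a%:C - 1 :> R[i].
  by rewrite -[1]/(1%:C) -rmorphB conjc_real.
have c2 (a b : R) : ((1 - a%:C) * b%:C)^*%C = (1 - a%:C) * b%:C :> R[i].
  by rewrite -[1]/(1%:C) -rmorphB -rmorphM conjc_real.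
rewrite /dresolvent_symbol add0r complexV c1 c2 -complexV.
have := mode_rateE alpha gamma n => /(congr1 (real_complex R)).
rewrite rmorphD rmorphN /= => E.
transitivity ((1 - (decay om t n)%:C) * ((om n)%:C)^-1 * (- (om n)%:C) * inner (efun n) f).
  by field.
by rewrite E; ring.
Qed.

Lemma optimal_cost psi0 :
  (lqr_cost gamma (fun t => T t psi0) (fun t => K (T t psi0)) =
   \sum_(0 <= n <oo) (p n * sqmod (inner (efun n) psi0))%:E)%E.
Proof.
rewrite (lqr_cost_modes _ (fun f => cmeas f psi0) (optimal_admissible psi0).1).
apply: eq_eseriesr => n _.
have o2 : 0 < 2 * om n by rewrite mulr_gt0 ?mode_rate_gt0.
transitivity (\int[mu]_(t in ray) ((2 * om n * p n * sqmod (inner (efun n) psi0)) *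
    expR (- (2 * om n) * t))%:E)%E.
  apply: eq_integral => t; rewrite inE rayE => t0; congr EFin.
  rewrite /mode_cost inner_lqr_gain// (inner_dsemigroup efun_basis gamma_gt0 om_ge).
  rewrite !sqmodM !sqmodR sqrrN -mode_energy /decay ger0_norm//.
  have -> : expR (- (2 * om n) * t) = expR (- om n * t) ^+ 2.
    by rewrite -expRM_natl; congr expR; ring.
  by ring.
under eq_integral do rewrite EFinM.
rewrite (integralZl (@measurable_ray R) (integrable_expRN o2)).
rewrite integral_expRN// -EFinM; congr EFin.
by field; rewrite gt_eqF// mode_rate_gt0.
Qed.

Let value_finite psi0 : (\sum_(0 <= n <oo) (p n * sqmod (inner (efun n) psi0))%:E < +oo)%E.
Proof.
rewrite (diag_energy efun_basis) ?ltry// => [n|]; first exact: mode_gain_ge0.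
have [M hM] := bounded_gain alpha_gt0 gamma_gt0; exists M => n.
by rewrite -sqmodN -rmorphN; exact: hM.
Qed.

Lemma lqr_valueE psi0 :
  (lqr_value alpha gamma psi0 = \sum_(0 <= n <oo) (p n * sqmod (inner (efun n) psi0))%:E)%E.
Proof.
apply/eqP; rewrite eq_le; apply/andP; split.
  apply: ereal_inf_lbound; exists (fun t => K (T t psi0)), (fun t => T t psi0).
  by split; [exact: optimal_admissible|exact: optimal_solves|rewrite optimal_cost].
apply: le_ereal_inf_tmp => _ [u [psi [adm sol ->]]].
exact: lqr_lower_bound.
Qed.

Lemma lqr_gain_optimal : lqr_optimal_gain alpha gamma K.
Proof.
split; first exact: lqr_gain_bounded.
move=> psi0; exists (fun t => T t psi0); split.
- exact: optimal_admissible.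
- exact: optimal_solves.
- by rewrite lqr_valueE optimal_cost.
Qed.

(** Optimality forces the trajectory of K' to be [T t psi0], but the controls agree only for almost
    every t. Continuity of t -> K' (T t psi0), from boundedness of K', extends the equality to t =
    0, where the state is the arbitrary psi0. *)
Lemma lqr_gain_unique (K' : {linear L2 -> L2}) :
  lqr_optimal_gain alpha gamma K' -> K' =1 K.
Proof.
move=> [/bounded_opP[M M0 hM] opt] psi0; have [psi [adm sol cost]] := opt psi0.
rewrite lqr_valueE in cost.
have eqm := lqr_cost_eq alpha_gt0 gamma_gt0 adm sol cost (value_finite psi0).
have psiE t : 0 <= t -> psi t = T t psi0.
  move=> t0; apply: (basis_ext efun_basis) => n; rewrite (eqm n).1//.
  by rewrite (inner_dsemigroup efun_basis gamma_gt0 om_ge) /decay ger0_norm.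
have T0 : T 0 psi0 = psi0 by case: T_c0.
apply: (basis_ext efun_basis) => n; rewrite inner_lqr_gain//.
pose q := (- p n)%:C * inner (efun n) psi0.
have cont (l : L2 -> R) (r : R) : (forall a b, l (a - b) = l a - l b) ->
    (forall a, `|l a| <= hnorm (efun n : L2) * hnorm a) ->
    {within ray, continuous (fun t => l (K' (T t psi0)) - expR (- om n * t) * r)}.
  move=> lB lL; apply: continuous_subspaceT => t; apply: cvgB; last first.
    by apply: cvgM; [exact: continuous_expRlin|exact: cvg_cst].
  have lB' a b : l (K' (a - b)) = l (K' a) - l (K' b) by rewrite linearB lB.
  have lL' a : `|l (K' a)| <= hnorm (efun n : L2) * M * hnorm a.
    by apply: le_trans (lL _) _; rewrite -mulrA ler_wpM2l ?hnorm_ge0.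
  exact: (dsemigroup_continuous (basise := efun_basis) (l := fun y => l (K' y)) gamma_gt0 om_ge lB' lL').
have aeE : ae_eq mu ray (fun t => inner (efun n) (K' (T t psi0))) (fun t => (expR (- om n * t))%:C * q).
  apply: (@filterS _ (almost_everywhere mu) (ae_filter_ringOfSetsType mu) _ _ _ (eqm n).2).
  move=> t h ht; have t0 : 0 <= t by move: ht; rewrite rayE.
  by rewrite -psiE// h// /q; ring.
have r0 := ae0_continuous_ray (cont (fun y => Re (inner (efun n) y)) (Re q) _ _).
have i0 := ae0_continuous_ray (cont (fun y => Im (inner (efun n) y)) (Im q) _ _).
apply: complexP; rewrite -/q.
  have := r0 _ _ _ 0 (lexx _); rewrite T0 mulr0 expR0 mul1r => h.
  apply/subr0_eq/h => [a b|a|]; first by rewrite innerBr ReB.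
    exact: Re_inner_le_hnorm.
  apply: (@filterS _ (almost_everywhere mu) (ae_filter_ringOfSetsType mu) _ _ _ aeE) => t e ht.
  by rewrite e// ReZ subrr.
have := i0 _ _ _ 0 (lexx _); rewrite T0 mulr0 expR0 mul1r => h.
apply/subr0_eq/h => [a b|a|]; first by rewrite innerBr ImB.
  exact: Im_inner_le_hnorm.
apply: (@filterS _ (almost_everywhere mu) (ae_filter_ringOfSetsType mu) _ _ _ aeE) => t e ht.
by rewrite e// ImZ subrr.
Qed.

End LQROptimality.

Theorem proposition2 (R : realType) (alpha gamma : R)
    (halpha : 0 < alpha) (hgamma : 0 < gamma) :
  exists (Kopt : {linear L2T R -> L2T R})
         (Phipsi Phiu : R[i] -> {linear L2T R -> L2T R}),
    [/\ lqr_optimal_gain alpha gamma Kopt,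
        forall K : {linear L2T R -> L2T R},
          lqr_optimal_gain alpha gamma K -> K =1 Kopt,
        h2_solution alpha gamma Phipsi Phiu,
        forall Phipsi' Phiu' : R[i] -> {linear L2T R -> L2T R},
          h2_solution alpha gamma Phipsi' Phiu' ->
          forall s, closed_rhp s ->
            Phipsi' s =1 Phipsi s /\ Phiu' s =1 Phiu s &
        spatially_invariant Kopt /\
        exists phipsi phiu : R[i] -> int -> R[i],
          forall s, closed_rhp s ->
            [/\ is_symbol (Phipsi s) (phipsi s), is_symbol (Phiu s) (phiu s),
                forall k, phipsi s k != 0 &
                is_symbol Kopt (fun k => phiu s k / phipsi s k)]].
Proof.
exists (lqr_gain alpha gamma), (loop_state alpha gamma), (loop_control alpha gamma).
split.
- exact: lqr_gain_optimal.
- by move=> K; exact: lqr_gain_unique.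
- exact: loop_h2_solution.
- by move=> Phipsi Phiu; exact: h2_solution_unique.
- split.
    exact: symbol_spatially_invariant (lqr_gain_symbol halpha hgamma).
  exists (loop_state_symbol alpha gamma), (loop_control_symbol alpha gamma) => s hs.
  have neq0 k : loop_state_symbol alpha gamma s k != 0 by exact: loop_state_symbol_neq0.
  split=> //; [exact: loop_state_is_symbol|exact: loop_control_is_symbol|].
  (* The common factor 1 / (s + omega) cancels, so the quotient does not depend on s and the
     controller is a static gain. *)
  have -> : (fun k => loop_control_symbol alpha gamma s k / loop_state_symbol alpha gamma s k) =
      (fun k => (- riccati gamma (alpha * k%:~R ^+ 2))%:C).
    by apply/funext => k; rewrite /loop_control_symbol mulfK.
  exact: lqr_gain_symbol.
Qed.
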